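(* Let $k$ be a positive integer and let $u\in C^0(\mathcal{I}_0,H^s(\mathbb{R}))$, $s\geq3$, be a solution of $$u_t-u_{txx}+u^ku_x-u^ku_{xxx}=0,\qquad u(0,x)=u_0(x).$$ Let $m_0=u_0-u_0''$. Assume that: (1) for some $\alpha\in(1/(k+1),1)$, $$|u_0(x)|\sim o(e^{-x})\quad\text{and}\quad|u_0'(x)|\sim O(e^{-\alpha x})\quad\text{as }x\nearrow\infty;$$ (2) there exists $t_1\in\mathcal{I}_0$, $t_1>0$, such that $$|u(t_1,x)|\sim o(e^{-x})\quad\text{as }x\nearrow\infty.$$ Then: (a) if $k=1$, then $u\equiv0$; (b) if $k$ is even and $m_0(x)\geq0$ for all $x\in\mathbb{R}$, then $u\equiv0$; (c) if $k$ is odd and either $m_0(x)\geq0$ for all $x\in\mathbb{R}$ or $m_0(x)\leq0$ for all $x\in\mathbb{R}$, then $u\equiv0$.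
   Context: $H^s(\mathbb{R})$ is the usual Sobolev space. $T>0$ is the lifespan of the solution $u\in C^0([0,T);H^s(\mathbb{R}))\cap C^1([0,T);H^{s-1}(\mathbb{R}))$ (which exists and is unique by local well-posedness), $T_0\in(0,T)$ is arbitrary, and $\mathcal{I}_0=[0,T_0]$. Notation: $|f(x)|\sim O(h(x))$ as $x\nearrow\infty$ means that there is a real constant $L$ with $\lim_{x\to\infty}|f(x)|/h(x)=L$; $|f(x)|\sim o(h(x))$ as $x\nearrow\infty$ means $\lim_{x\to\infty}|f(x)|/h(x)=0$. *)

(* Defs.v *)
From HB Require Import structures.
From mathcomp Require Import all_boot all_order all_algebra.
From mathcomp Require Import all_classical all_reals all_analysis.

Set Implicit Arguments.
Unset Strict Implicit.
Unset Printing Implicit Defensive.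

Import Order.TTheory GRing.Theory Num.Theory.
Import numFieldNormedType.Exports.

Local Open Scope classical_set_scope.
Local Open Scope ring_scope.

Definition L2norm (R : realType) (f : R -> R) : \bar R :=
  ('N[@lebesgue_measure R]_(2%:E)[EFin \o f])%E.

(* Real and imaginary parts of the integral of f(x) exp(-i x xi) over
   |x| <= N. *)
Definition fourier_re (R : realType) (f : R -> R) (N xi : R) : R :=
  \int[@lebesgue_measure R]_(x in `[- N, N]) (f x * cos (x * xi)).

Definition fourier_im (R : realType) (f : R -> R) (N xi : R) : R :=
  \int[@lebesgue_measure R]_(x in `[- N, N]) (- (f x * sin (x * xi))).

(* a + i b is (a representative of) the Fourier-Plancherel transform of the
   real-valued f in L^2: the limit in L^2 of the truncated Fourier integrals. *)
Definition is_fourier (R : realType) (f a b : R -> R) : Prop :=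
  [/\ f \in Lfun (@lebesgue_measure R) 2%:E,
      a \in Lfun (@lebesgue_measure R) 2%:E,
      b \in Lfun (@lebesgue_measure R) 2%:E,
      L2norm (fun xi => fourier_re f n%:R xi - a xi) @[n --> \oo] --> 0%E &
      L2norm (fun xi => fourier_im f n%:R xi - b xi) @[n --> \oo] --> 0%E].

(* The H^s norm || (1 + xi^2)^(s/2) f^ ||_{L^2}, for s >= 0, with the
   unnormalized transform f^. Since f^ is unique up to null sets, the infimum
   is over one value if f is in L^2, and is +oo otherwise. *)
Definition sobolev_norm (R : realType) (s : R) (f : R -> R) : \bar R :=
  ereal_inf [set N | exists a b : R -> R, is_fourier f a b /\
    N = L2norm (fun xi =>
      (1 + xi ^+ 2) `^ (s / 2) * Num.sqrt (a xi ^+ 2 + b xi ^+ 2))].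

Definition in_sobolev (R : realType) (s : R) (f : R -> R) : Prop :=
  (sobolev_norm s f < +oo)%E.

Definition C0_sobolev (R : realType) (I : set R) (s : R) (u : R -> R -> R) :
    Prop :=
  forall t, I t -> in_sobolev s (u t) /\
    sobolev_norm s (fun x => u r x - u t x) @[r --> within I (nbhs t)] --> 0%E.

(* v is the derivative of u : I -> H^s, one-sided at the endpoints of I. *)
Definition sobolev_time_derivative (R : realType) (I : set R) (s : R)
    (u v : R -> R -> R) : Prop :=
  forall t, I t ->
    sobolev_norm s (fun x => (u r x - u t x) / (r - t) - v t x)
      @[r --> within I t^'] --> 0%E.

Definition test_function (R : realType) (phi : R -> R) : Prop :=
  (forall n x, derivable (derive1n n phi) x 1) /\
  (exists M : R, forall x, M < `|x| -> phi x = 0).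

Definition weak_derivative (R : realType) (n : nat) (f g : R -> R) : Prop :=
  [/\ locally_integrable setT f, locally_integrable setT g &
      forall phi, test_function phi ->
        \int[@lebesgue_measure R]_x (f x * derive1n n phi x) =
        (-1) ^+ n * \int[@lebesgue_measure R]_x (g x * phi x)].

(* u is in C^1(I, H^(s-1)) and solves
     u_t - u_txx + u^k u_x - u^k u_xxx = 0
   in H^(s-3), a subspace of L^2 when s >= 3. Space derivatives are weak, so
   each of them is determined almost everywhere. *)
Definition solves_equation (R : realType) (k : nat) (I : set R) (s : R)
    (u : R -> R -> R) : Prop :=
  exists ut : R -> R -> R,
    [/\ C0_sobolev I (s - 1) ut,
        sobolev_time_derivative I (s - 1) u ut &
        forall t, I t -> exists ux uxxx utxx : R -> R,
          [/\ weak_derivative 1 (u t) ux,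
              weak_derivative 3 (u t) uxxx,
              weak_derivative 2 (ut t) utxx &
              {ae @lebesgue_measure R, forall x,
                ut t x - utxx x + u t x ^+ k * ux x - u t x ^+ k * uxxx x = 0}]].

Definition sim_O (R : realType) (f h : R -> R) : Prop :=
  exists L : R, `|f x| / h x @[x --> +oo] --> L.

Definition sim_o (R : realType) (f h : R -> R) : Prop :=
  `|f x| / h x @[x --> +oo] --> 0.

(* Main.v *)
(* Put h = u_t + u^k u_x. The equation is h'' = h + 3k u^(k-1) u_x u_xx
   + k(k-1) u^(k-2) u_x^3. Testing it against h psi, for a weight with
   |psi'| <= 3/2 psi, bounds the psi-weighted H^1 norm of h by that of u, and
   Gronwall's inequality gives E_psi(t) <= K E_psi(0), where E_psi is the integral of
   (u^2 + u_x^2) psi and K does not depend on psi. With psi = 1 this is uniqueness: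
   it is enough to show u_0 = 0.

   If m_0 >= 0, then e^-x (u_0 + u_0') is nonincreasing with limit 0, hence
   nonnegative, so that e^x u_0 is nondecreasing; its limits at both ends are 0.

   If k = 1, let phi_N = e^N p (1 - p) with p = 1 / (1 + e^(N - x)), which increases
   to e^x as N grows. The derivative in t of the integral of u (phi_N - phi_N'') is
   the integral of 3/2 u_x^2 phi_N' + 1/2 u^2 (phi_N - phi_N'')', at least 3/2 the
   integral of u_x^2 phi_N up to an error 48 E_chi(t) <= 48 K E_chi(0), with
   chi = chi_N <= e^x tending to 0 pointwise. As alpha > 1/2, the initial datum
   makes E_chi(0) tend to 0. The values at t = 0 and t = t_1 tend to 0 because
   u = o(e^-x) at these times. Hence u_0' = 0.

   Regularity: integrating the weak equation shows that u is C^2 and u_t is C^1 in x;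
   the L^2 norms of these derivatives are bounded by the Fourier-side Sobolev norms
   through Plancherel's inequality for difference quotients. *)
Require Import Defs.
From HB Require Import structures.
From mathcomp Require Import all_boot all_order all_algebra.
From mathcomp Require Import all_classical all_reals all_analysis.
From mathcomp Require Import measurable_realfun.
From mathcomp Require Import ring lra.

Set Implicit Arguments.
Unset Strict Implicit.
Unset Printing Implicit Defensive.

Import Order.TTheory GRing.Theory Num.Theory.
Import numFieldNormedType.Exports.

Local Open Scope classical_set_scope.
Local Open Scope ring_scope.

(** * Integrals and derivatives on the line *)

Section Integrals.
Variable R : realType.
Implicit Types (f g h F : R -> R) (a b c x y : R).
Local Notation mu := (@lebesgue_measure R).

(** For k = 1 the model weight is e^x. It equals its own second derivative, so the integral of u
    (phi - phi'') would vanish identically, while its time derivative would be 3/2 of the integral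
    of u_x^2 e^x. These integrals need not converge, and cutting e^x off creates errors. The
    logistic cutoff keeps everything explicit: phi_N - phi_N'' = 6 e^N (p (1 - p))^2 is concentrated
    near x = N, where u = o(e^-x) compensates e^N. The other errors are quadratic in (u, u_x), which
    is why the energy estimate must hold for weights of exponential slope, with one constant for all
    of them.

    The obstacle to integrating by parts is that u_xxx and u_txx are only weak derivatives. They are
    used only together, in h'', which is continuous, so the identities rest on the vanishing of the
    integral of F' for an explicit C^1 function F. In the energy estimate u_xx is eliminated as
    well, since the constant is to depend on bounds of u and u_x alone. *)

Definition itg f := mu.-integrable setT (EFin \o f).

Lemma itg_measurable f : itg f -> measurable_fun setT f.
Proof. by move=> /integrableP[/measurable_EFinP]. Qed.

(** Together with [intE], passes to the library integral after [itg] and [intR] are made opaque. *)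
Lemma itgE f : itg f = mu.-integrable setT (EFin \o f).
Proof. by []. Qed.

Lemma itgD f g : itg f -> itg g -> itg (fun x => f x + g x).
Proof. by move=> ff gg; exact: (integrableD measurableT ff gg). Qed.

Lemma itgB f g : itg f -> itg g -> itg (fun x => f x - g x).
Proof. by move=> ff gg; exact: (integrableB measurableT ff gg). Qed.

Lemma itgZ c f : itg f -> itg (fun x => c * f x).
Proof. by move=> ff; exact: (integrableZl measurableT c ff). Qed.

Lemma itgZr c f : itg f -> itg (fun x => f x * c).
Proof. by move=> ff; exact: (integrableZr measurableT c ff). Qed.

Lemma itgN f : itg f -> itg (fun x => - f x).
Proof. by move=> ff; exact: (integrableN ff). Qed.

Lemma itg_norm f : itg f -> itg (fun x => `|f x|).
Proof. by move=> ff; apply: integrable_norm. Qed.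

Lemma itg_dom g f : measurable_fun setT f -> (forall x, `|f x| <= g x) ->
  itg g -> itg f.
Proof.
move=> mf fg ig; apply: (le_integrable _ _ _ ig) => //.
  exact/measurable_EFinP.
by move=> x _ /=; rewrite lee_fin (le_trans (fg x))// ler_norm.
Qed.

Lemma itgM_bdd c f h : itg f -> measurable_fun setT h ->
  (forall x, `|h x| <= c) -> itg (fun x => f x * h x).
Proof.
move=> ff mh hc; apply: (@itg_dom (fun x => c * `|f x|)).
- by apply: measurable_funM => //; exact: itg_measurable.
- by move=> x; rewrite normrM mulrC ler_wpM2r.
- exact/itgZ/itg_norm.
Qed.

Lemma cont_measurable f : continuous f -> measurable_fun setT f.
Proof. exact: continuous_measurable_fun. Qed.

Definition intR f : R := \int[mu]_x f x.

Lemma intE f : intR f = \int[mu]_x f x.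
Proof. by []. Qed.

Lemma intD f g : itg f -> itg g -> intR (fun x => f x + g x) = intR f + intR g.
Proof. by move=> ff gg; rewrite /intR RintegralD. Qed.

Lemma intB f g : itg f -> itg g -> intR (fun x => f x - g x) = intR f - intR g.
Proof. by move=> ff gg; rewrite /intR RintegralB. Qed.

Lemma intZ c f : itg f -> intR (fun x => c * f x) = c * intR f.
Proof. by move=> ff; rewrite /intR RintegralZl. Qed.

Lemma intN f : itg f -> intR (fun x => - f x) = - intR f.
Proof.
move=> ff; rewrite -mulN1r -intZ//; congr intR.
by apply/funext => x; rewrite mulN1r.
Qed.

Lemma int_ge0 f : (forall x, 0 <= f x) -> 0 <= intR f.
Proof. by move=> f0; apply: Rintegral_ge0. Qed.

Lemma int0 : intR (fun=> 0) = 0.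
Proof. by rewrite /intR Rintegral_cst// mul0r. Qed.

Lemma int_le f g : itg f -> itg g -> (forall x, f x <= g x) -> intR f <= intR g.
Proof. by move=> ff gg fg; apply: le_Rintegral. Qed.

Lemma int_norm f : itg f -> `|intR f| <= intR (fun x => `|f x|).
Proof. by move=> ff; apply: le_normr_Rintegral. Qed.

Lemma eq_int f g : (forall x, f x = g x) -> intR f = intR g.
Proof. by move=> fg; congr intR; apply/funext. Qed.

Lemma eq_itg f g : (forall x, f x = g x) -> itg f -> itg g.
Proof. by move=> /funext->. Qed.

Lemma int_EFin f : itg f -> (intR f)%:E = (\int[mu]_x (f x)%:E)%E.
Proof. by move=> ff; rewrite /intR/Rintegral fineK// integrable_fin_num. Qed.

Lemma itg_bound f c : measurable_fun setT f ->
  (\int[mu]_x (`|f x|)%:E <= c%:E)%E -> itg f.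
Proof.
move=> mf fc; apply/integrableP; split; first exact/measurable_EFinP.
by apply: le_lt_trans fc _; rewrite ltry.
Qed.

Lemma ae_imp (P Q : R -> Prop) : (forall x, P x -> Q x) ->
  {ae mu, forall x, P x} -> {ae mu, forall x, Q x}.
Proof.
by move=> PQ; apply: (@filterS _ _ (ae_filter_ringOfSetsType mu)) => x; exact: PQ.
Qed.

Lemma ae_imp2 (P Q S : R -> Prop) : (forall x, P x -> Q x -> S x) ->
  {ae mu, forall x, P x} -> {ae mu, forall x, Q x} -> {ae mu, forall x, S x}.
Proof.
move=> PQ.
by apply: (@filterS2 _ _ (ae_filter_ringOfSetsType mu)) => x; exact: PQ.
Qed.

Lemma int_dct (f_ : nat -> R -> R) f g :
  (forall n, measurable_fun setT (f_ n)) -> measurable_fun setT f ->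
  {ae mu, forall x, f_ ^~ x @ \oo --> f x} -> itg g ->
  (forall n x, `|f_ n x| <= g x) -> intR (f_ n) @[n --> \oo] --> intR f.
Proof.
move=> mf_ mf ff ig fg.
have ifn n : itg (f_ n) by exact: itg_dom (mf_ n) (fg n) ig.
have := @dominated_convergence _ _ _ mu setT measurableT
  (fun n => EFin \o f_ n) (EFin \o f) (EFin \o g).
case.
- by move=> n; apply/measurable_EFinP; exact: mf_.
- exact/measurable_EFinP.
- apply: ae_imp ff => x fx _.
  by apply: cvg_EFin; [exact: nearW|exact: fx].
- exact: ig.
- by apply: aeW => x n _ /=; rewrite lee_fin.
move=> iff _ cf.
rewrite /intR/Rintegral; apply: fine_cvg.
by rewrite fineK ?integrable_fin_num//.
Qed.

(** Fatou's lemma in the form that transfers L^2 bounds from truncations and difference quotients to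
    their limits. *)
Lemma int_fatou (f_ : nat -> R -> R) f (c : R) :
  (forall n, itg (f_ n)) -> (forall n x, 0 <= f_ n x) ->
  measurable_fun setT f ->
  (forall x, f_ ^~ x @ \oo --> f x) ->
  (forall n, intR (f_ n) <= c) -> itg f /\ intR f <= c.
Proof.
move=> ifn f0 mf ff fc.
have ge0 x : 0 <= f x.
  by apply: (cvgr_to_ge (ff x)); exact: nearW.
have H : (\int[mu]_x (f x)%:E <= c%:E)%E.
  have := @fatou _ _ _ mu setT measurableT (fun n => EFin \o f_ n).
  have -> : (fun x => limn_einf ((fun n => EFin \o f_ n)^~ x)) = EFin \o f.
    apply/funext => x.
    have /cvg_limn_einf_sup[-> //] : (EFin \o f_ n) x @[n --> \oo] --> (f x)%:E.
    by apply: cvg_EFin; [exact: nearW|exact: ff].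
  move=> fat; apply: le_trans.
    apply: fat => //.
    - by move=> n; apply/measurable_EFinP; exact: itg_measurable.
    - by move=> n x _; rewrite lee_fin.
  rewrite limn_einf_lim; apply: lime_le; first exact: is_cvg_einfs.
  apply: nearW => n; apply: (@le_trans _ _ (\int[mu]_x (f_ n x)%:E)%E).
    by apply: ereal_inf_lbound; exists n => //=.
  by rewrite -int_EFin// lee_fin.
have iF : itg f.
  apply: (@itg_bound _ c) => //.
  by under eq_integral do rewrite ger0_norm//.
by split => //; rewrite -lee_fin int_EFin.
Qed.

Lemma eq_int_ae f g : itg f -> measurable_fun setT g ->
  {ae mu, forall x, f x = g x} -> itg g /\ intR f = intR g.
Proof.
move=> ff mg fg.
have E : (\int[mu]_x `|(EFin \o f) x| = \int[mu]_x `|(EFin \o g) x|)%E.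
  apply: ae_eq_integral => //.
  - apply: measurableT_comp => //; apply/measurable_EFinP; exact: itg_measurable.
  - by apply: measurableT_comp => //; apply/measurable_EFinP.
  - by apply: ae_imp fg => x fgx _ /=; rewrite fgx.
have ig : itg g.
  apply/integrableP; split; first exact/measurable_EFinP.
  by rewrite -E; move/integrableP : ff => [].
split => //; rewrite /intR/Rintegral; congr fine.
apply: ae_eq_integral => //.
- by apply/measurable_EFinP; exact: itg_measurable.
- exact/measurable_EFinP.
- by apply: ae_imp fg => x fgx _ /=; rewrite fgx.
Qed.

(** * Affine substitution and Fubini's theorem *)

Lemma pushforward_affine a b (A : set R) : 0 < a -> measurable A ->
  pushforward mu (fun x : R => a * x + b : measurableTypeR R) A =
  (a^-1%:E * mu A)%E.
Proof.
move=> a0 mA.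
pose T := fun x : R => a * x + b : measurableTypeR R.
have mT : measurable_fun [set: measurableTypeR R] T.
  by apply: measurable_funD => //; apply: measurable_funM.
have ha : 0 <= a by exact: ltW.
pose nu := mscale (NngNum ha) (pushforward mu T).
(* [nu], which is [a] times the image measure, agrees with Lebesgue measure on the intervals ]c, d],
   and these determine it. *)
rewrite (lebesgue_measure_unique (mu := nu mT))//.
  by rewrite /nu/mscale/= muleA -EFinM mulVf ?gt_eqF// mul1e.
move=> _ [[c d]] _ <-; rewrite /nu /= /mscale /=.
have -> : pushforward mu T [set` `]c, d]] = mu [set` `](c - b) / a, (d - b) / a]].
  rewrite /pushforward; congr (mu _); apply/seteqP; split => x /=; rewrite !in_itv/= /T.
    by rewrite ltr_pdivrMr// ler_pdivlMr// [x * a]mulrC => /andP[? ?]; lra.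
  by rewrite ltr_pdivrMr// ler_pdivlMr// [x * a]mulrC => /andP[? ?]; lra.
rewrite !lebesgue_measure_itv/= !lte_fin ltr_pM2r ?invr_gt0// ltrD2r.
case: ifPn => _; last by rewrite mule0.
rewrite -EFinB -EFinD -EFinM; congr EFin; field; by rewrite gt_eqF.
Qed.

Lemma ge0_integral_affine a b (f : R -> \bar R) : 0 < a ->
  measurable_fun setT f -> (forall x, (0 <= f x)%E) ->
  (\int[mu]_x f (a * x + b)%R = (a^-1)%:E * \int[mu]_x f x)%E.
Proof.
move=> a0 mf f0.
pose T := fun x : R => a * x + b : measurableTypeR R.
have mT : measurable_fun [set: measurableTypeR R] T.
  by apply: measurable_funD => //; apply: measurable_funM.
rewrite (_ : \int[mu]_x f (a * x + b)%R =
  \int[mu]_(x in T @^-1` setT) (f \o T) x)%E; last by rewrite preimage_setT.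
rewrite -ge0_integral_pushforward//.
have ha : 0 <= a^-1 by rewrite invr_ge0 ltW.
rewrite -(ge0_integral_mscale _ measurableT (NngNum ha))//.
apply: eq_measure_integral => //= A mA _.
by rewrite /mscale /=; exact: pushforward_affine.
Qed.

Lemma itg_affine a b f : 0 < a -> itg f -> itg (fun x => f (a * x + b)).
Proof.
move=> a0 ff; apply/integrableP; split.
  apply/measurable_EFinP; apply: (measurableT_comp (itg_measurable ff)).
  by apply: measurable_funD => //; apply: measurable_funM.
rewrite (@ge0_integral_affine a b (abse \o (EFin \o f)))//.
  by rewrite lte_mul_pinfty ?lee_fin ?invr_ge0 ?ltW//; move/integrableP : ff => [].
  by apply: measurableT_comp => //; apply/measurable_EFinP; exact: itg_measurable.
by move=> x; exact: abse_ge0.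
Qed.

Lemma int_pos_neg f : itg f ->
  intR f = intR (fun x => Num.max (f x) 0) - intR (fun x => Num.max (- f x) 0).
Proof.
move=> ff; have mf := itg_measurable ff.
rewrite -intB; last 2 first.
- apply: itg_dom (itg_norm ff); first exact: measurable_maxr.
  by move=> x; rewrite ger0_norm ?le_max ?lexx ?orbT// ge_max ler_norm normr_ge0.
- apply: itg_dom (itg_norm ff).
    by apply: measurable_maxr => //; exact: measurableT_comp.
  move=> x; rewrite ger0_norm ?le_max ?lexx ?orbT// ge_max normr_ge0 andbT.
  by rewrite -normrN ler_norm.
apply: eq_int => x; rewrite /Num.max; case: ifPn; case: ifPn; lra.
Qed.

Lemma int_affine a b f : 0 < a -> itg f ->
  intR (fun x => f (a * x + b)) = a^-1 * intR f.
Proof.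
move=> a0 ff; have mf := itg_measurable ff.
have H g : itg g -> (forall x, 0 <= g x) ->
    intR (fun x => g (a * x + b)) = a^-1 * intR g.
  move=> gg g0; apply: EFin_inj; rewrite EFinM !int_EFin//; last exact: itg_affine.
  apply: (@ge0_integral_affine a b (EFin \o g)) => //.
  by apply/measurable_EFinP; exact: itg_measurable.
rewrite int_pos_neg; last exact: itg_affine.
rewrite (H (fun x => Num.max (f x) 0)) ?(H (fun x => Num.max (- f x) 0)).
- by rewrite -mulrBr -int_pos_neg.
- apply: itg_dom (itg_norm ff).
    by apply: measurable_maxr => //; exact: measurableT_comp.
  move=> x; rewrite ger0_norm ?le_max ?lexx ?orbT// ge_max normr_ge0 andbT.
  by rewrite -normrN ler_norm.
- by move=> x; rewrite le_max lexx orbT.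
- apply: itg_dom (itg_norm ff); first exact: measurable_maxr.
  by move=> x; rewrite ger0_norm ?le_max ?lexx ?orbT// ge_max ler_norm normr_ge0.
- by move=> x; rewrite le_max lexx orbT.
Qed.

(** The product |f| |g| c is an integrable majorant. The bounded kernel [K] is later a sine or
    cosine, or the indicator of x <= y, so that one statement covers the Fourier integrals and
    integration by parts. *)
Lemma int_fubini f g (K : R * R -> R) (c : R) : itg f -> itg g ->
  measurable_fun setT K -> (forall z, `|K z| <= c) ->
  itg (fun x => f x * intR (fun y => g y * K (x, y))) /\
  intR (fun x => f x * intR (fun y => g y * K (x, y))) =
  intR (fun y => g y * intR (fun x => f x * K (x, y))).
Proof.
move=> ff gg mK Kc.
have mf := itg_measurable ff; have mg := itg_measurable gg.
pose H (z : R * R) := (f z.1 * g z.2 * K z)%:E.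
have mH : measurable_fun setT H.
  apply/measurable_EFinP; apply: measurable_funM => //.
  by apply: measurable_funM; apply: measurableT_comp.
have mKx x : measurable_fun setT (fun y => K (x, y)).
  by apply: measurableT_comp => //; exact: measurable_pair1.
have mKy y : measurable_fun setT (fun x => K (x, y)).
  by apply: measurableT_comp => //; exact: measurable_pair2.
have igK x : itg (fun y => g y * K (x, y)) by exact: (@itgM_bdd c).
have ifK y : itg (fun x => f x * K (x, y)) by exact: (@itgM_bdd c).
have iH : (mu \x mu)%E.-integrable setT H.
  apply/integrable12ltyP => //.
  apply: (@le_lt_trans _ _ (\int[mu]_x (`|f x| * (c * intR (fun y => `|g y|)))%:E)%E).
    apply: ge0_le_integral => //.
    - by move=> x _; exact: integral_ge0.
    - have := @measurable_fun_fubini_tonelli_F _ _ (measurableTypeR R) (measurableTypeR R) _ mu (abse \o H).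
      apply => //; [exact: measurableT_comp|by move=> z; exact: abse_ge0].
    - apply/measurable_EFinP; apply: measurable_funM => //.
      exact: measurableT_comp.
    move=> x _; rewrite mulrA EFinM int_EFin; last exact: itg_norm.
    rewrite -ge0_integralZl//; last 2 first.
    - by apply/measurable_EFinP; exact: measurableT_comp.
    - by rewrite lee_fin mulr_ge0// (le_trans (normr_ge0 _) (Kc (0, 0))).
    apply: ge0_le_integral => //=.
    - apply/measurable_EFinP; apply: measurableT_comp => //.
      have -> : (fun y => f x * g y * K (x, y)) = (fun y => f x * (g y * K (x, y))).
        by apply/funext => y; rewrite mulrA.
      by have /itg_measurable := itgZ (f x) (igK x).
    - by apply/measurable_EFinP; apply: measurable_funM => //; exact: measurableT_comp.
    - move=> y _; rewrite lee_fin !normrM -!mulrA ler_wpM2l//.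
      by rewrite mulrC ler_wpM2r.
  have := itgZr (c * intR (fun y => `|g y|)) (itg_norm ff).
  move=> /integrableP[_]; apply: le_lt_trans.
  apply: ge0_le_integral => //.
  - move=> x _; rewrite lee_fin !mulr_ge0// ?int_ge0//.
    exact: le_trans (normr_ge0 _) (Kc (0, 0)).
  - apply/measurable_EFinP; apply: measurable_funM => //.
    exact: measurableT_comp.
  - apply/measurable_EFinP; apply: measurableT_comp => //.
    by apply: measurable_funM => //; exact: measurableT_comp.
  - by move=> x _; rewrite /= lee_fin ler_norm.
have EF : (fun x => \int[mu]_y H (x, y))%E =
    EFin \o (fun x => f x * intR (fun y => g y * K (x, y))).
  apply/funext => x /=; rewrite -intZ// int_EFin; last exact: itgZ.
  by apply: eq_integral => y _; rewrite /H/= mulrA.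
have EG : (fun y => \int[mu]_x H (x, y))%E =
    EFin \o (fun y => g y * intR (fun x => f x * K (x, y))).
  apply/funext => y /=; rewrite -intZ// int_EFin; last exact: itgZ.
  by apply: eq_integral => x _; rewrite /H/= mulrA [f x * _]mulrC.
split.
  by rewrite /itg -EF; exact: integrable_fubini_F iH.
rewrite /intR/Rintegral; congr fine.
transitivity (\int[mu]_x \int[mu]_y H (x, y))%E; first by rewrite EF.
by rewrite (Fubini iH) EG.
Qed.
Lemma cvg0_le {T : Type} (G : set_system T) {FG : Filter G} (f g : T -> R) :
  (\forall t \near G, `|f t| <= g t) -> g @ G --> (0 : R) -> f @ G --> (0 : R).
Proof.
move=> fg g0; apply: squeeze_cvgr; [|rewrite -(oppr0 R); exact: cvgN g0|exact: g0].
by apply: filterS fg => t; rewrite ler_norml.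
Qed.

(** * Derivatives on the whole line *)

Definition dv F f := forall x : R, is_derive x (1 : R) F (f x).

Lemma dv_eq F f g : dv F f -> (forall x, f x = g x) -> dv F g.
Proof. by move=> dF fg x; rewrite -fg. Qed.

Lemma dv_cst c : dv (fun=> c) (fun=> 0).
Proof. by move=> x; exact: is_derive_cst. Qed.

Lemma dv_id : dv (fun x => x) (fun=> 1).
Proof. by move=> x; exact: is_derive_id. Qed.

Lemma dvD F f G g : dv F f -> dv G g ->
  dv (fun x => F x + G x) (fun x => f x + g x).
Proof. by move=> dF dG x; exact: is_deriveD. Qed.

Lemma dvN F f : dv F f -> dv (fun x => - F x) (fun x => - f x).
Proof. by move=> dF x; exact: is_deriveN. Qed.

Lemma dvB F f G g : dv F f -> dv G g ->
  dv (fun x => F x - G x) (fun x => f x - g x).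
Proof. by move=> dF dG x; exact: is_deriveB. Qed.

Lemma dvM F f G g : dv F f -> dv G g ->
  dv (fun x => F x * G x) (fun x => f x * G x + F x * g x).
Proof.
move=> dF dG x; apply: is_derive_eq; first exact: is_deriveM.
by rewrite addrC [f x * _]mulrC.
Qed.

Lemma dvZ c F f : dv F f -> dv (fun x => c * F x) (fun x => c * f x).
Proof.
by move=> dF; apply: dv_eq (dvM (dv_cst c) dF) _ => x; rewrite mul0r add0r.
Qed.

Lemma dvX n F f : dv F f ->
  dv (fun x => F x ^+ n) (fun x => n%:R * F x ^+ n.-1 * f x).
Proof.
move=> dF x; have -> : (fun x => F x ^+ n) = F ^+ n.
  by apply/funext => y; rewrite exprfctE.
exact: is_deriveX.
Qed.

Lemma dv_comp F f G g : dv F f -> dv G g ->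
  dv (fun x => F (G x)) (fun x => g x * f (G x)).
Proof.
move=> dF dG x; have := @is_derive1_comp R F G x (f (G x)) (g x) (dF _) (dG x).
by rewrite mulrC.
Qed.

Lemma dv_affine a b F f : dv F f ->
  dv (fun x => F (a * x + b)) (fun x => a * f (a * x + b)).
Proof.
move=> dF; have := dv_comp dF (dvD (dvZ a dv_id) (dv_cst b)).
by move/dv_eq; apply => x; rewrite mulr1 addr0.
Qed.

Lemma dv_expR : dv expR expR.
Proof. by move=> x; exact: is_derive_expR. Qed.

Lemma dvV F f : dv F f -> (forall x, F x != 0) ->
  dv (fun x => (F x)^-1) (fun x => - f x / F x ^+ 2).
Proof.
move=> dF F0 x; apply: is_derive_eq; first exact: is_deriveV.
by rewrite mulNr mulrC -mulNr.
Qed.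

Lemma dv_derive1 F f : dv F f -> derive1 F = f.
Proof. by move=> dF; apply/funext => x; rewrite derive1E; have [] := dF x. Qed.

Lemma dv_derivable F f : dv F f -> forall x, derivable F x 1.
Proof. by move=> dF x; have [] := dF x. Qed.

Lemma dv_unique F f g : dv F f -> dv F g -> f = g.
Proof. by move=> /dv_derive1 <- /dv_derive1. Qed.

Lemma dv_continuous F f : dv F f -> continuous F.
Proof.
by move=> dF x; apply/differentiable_continuous/derivable1_diffP; have [] := dF x.
Qed.

(** * Integrals of derivatives *)

Lemma ftc_itv F f a b : a <= b -> dv F f ->
  continuous f -> \int[mu]_(x in `[a, b]) f x = F b - F a.
Proof.
move=> ab dF cf; have cF := dv_continuous dF.
have [ab'|] := ltP a b; last first.
  by move=> ba; rewrite (le_anti (introT andP (conj ab ba))) set_itv1 Rintegral_set1 subrr.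
rewrite /Rintegral (@continuous_FTC2 _ f F)//.
- exact: continuous_subspaceT.
- split.
  + by move=> x _; have [] := dF x.
  + by apply: cvg_at_right_filter; exact: cF.
  + by apply: cvg_at_left_filter; exact: cF.
- by move=> x _; rewrite (dv_derive1 dF).
Qed.

Lemma itg_restrict f (D : set R) : measurable D ->
  mu.-integrable D (EFin \o f) -> itg (f \_ D).
Proof.
move=> mD ifD; rewrite /itg -restrict_EFin.
by apply/(integrable_mkcond _ _).1.
Qed.

Lemma int_itv_le f a b : itg f -> `|\int[mu]_(x in `[a, b]) f x| <= intR (fun x => `|f x|).
Proof.
move=> ff.
have fab : mu.-integrable `[a, b] (EFin \o f) by exact: integrableS ff.
apply: le_trans (le_normr_Rintegral _ fab) _ => //.
rewrite Rintegral_mkcond; apply: int_le => //.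
- rewrite /itg -restrict_EFin; apply/(integrable_mkcond _ _).1 => //.
  exact: integrable_norm fab.
- exact: itg_norm.
by move=> x; rewrite patchE; case: ifPn => _ //; exact: normr_ge0.
Qed.

Lemma itg_itv_cvg f : itg f ->
  \int[mu]_(x in `[- n%:R, n%:R]) f x @[n --> \oo] --> intR f.
Proof.
move=> ff; have mf := itg_measurable ff.
under eq_fun do rewrite Rintegral_mkcond.
apply: (int_dct (g := fun x => `|f x|)) => //.
- by move=> n; apply/(measurable_restrictT _ _).1 => //; exact: measurable_funTS.
- apply: aeW => x; apply: cvg_near_cst.
  near=> n; rewrite patchE mem_set//= in_itv/= -ler_norml.
  by near: n; exact: nbhs_infty_ger.
- exact: itg_norm.
- by move=> n x; rewrite patchE; case: ifPn; rewrite ?normr0.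
Unshelve. all: by end_near. Qed.

Lemma itg_infty c : c != 0 -> ~ itg (fun=> c).
Proof.
move=> c0 /integrableP[_].
rewrite integral_cst//= -set_itvNyy lebesgue_measure_itv/=.
by rewrite addye// gt0_muley// lte_fin normr_gt0.
Qed.

(** If |F x| exceeded the integral I of |f|, then |F y| >= |F x| - I > 0 for every y, and F would
    not be integrable. *)
Lemma C1_bounded F f : dv F f ->
  continuous f -> itg F -> itg f -> forall x, `|F x| <= intR (fun x => `|f x|).
Proof.
move=> dF cf iF iff x; rewrite leNgt; apply/negP => Fx.
set I := intR _ in Fx.
have cF := dv_continuous dF.
apply: (@itg_infty (`|F x| - I)); first by rewrite gt_eqF// subr_gt0.
apply: itg_dom (itg_norm iF); first exact: measurable_cst.
move=> y; rewrite ger0_norm ?subr_ge0; last exact: ltW.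
have H : `|F x - F y| <= I.
  have [xy|yx] := leP x y.
    by rewrite distrC -(ftc_itv xy dF cf); exact: int_itv_le.
  by rewrite -(ftc_itv (ltW yx) dF cf); exact: int_itv_le.
move: (lerB_dist (F x) (F y)) => H'; lra.
Qed.

Lemma ae_continuous0 f : continuous f -> {ae mu, forall x, f x = 0} ->
  forall x, f x = 0.
Proof.
move=> cf [N [mN N0 sub]] x; apply/eqP; apply/negP => /negP fx.
have : \forall y \near x, f y != 0.
  have := cf x; move/cvgr_neq0; exact.
move=> [e /= e0 be].
have : (mu (ball x e) <= mu N)%E.
  apply: le_measure; rewrite ?inE//; first exact: measurable_ball.
  move=> y /be/eqP fy; exact: sub.
rewrite N0 (lebesgue_measure_ball x (ltW e0)) lee_fin.
by apply/negP; rewrite -ltNge mulrn_wgt0.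
Qed.

Lemma int_eq0 f : continuous f -> (forall x, 0 <= f x) -> itg f ->
  intR f <= 0 -> forall x, f x = 0.
Proof.
move=> cf f0 iff I0; apply: ae_continuous0 => //.
have /(ae_eq_integral_abs mu measurableT) : (\int[mu]_x `|(f x)%:E| = 0)%E.
  under eq_integral do rewrite gee0_abs ?lee_fin//.
  by rewrite -int_EFin//; congr EFin; apply/eqP; rewrite eq_le I0 int_ge0.
move=> H; have {}H : ae_eq mu setT (EFin \o f) (cst 0).
  by apply: H; apply/measurable_EFinP; exact: itg_measurable.
by apply: ae_imp H => x /(_ Logic.I) [].
Qed.

(** Limits of F at infinity are avoided: F is bounded by [C1_bounded], so its product with the
    cutoff 1 / (1 + (x / (n + 1))^2) tends to 0 at both ends and the integral of the derivative of
    this product is 0. The derivative of the cutoff is at most 1 / (n + 1), and dominated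
    convergence removes the cutoff. *)
Lemma int_deriv0 F f : dv F f ->
  continuous f -> itg F -> itg f -> intR f = 0.
Proof.
move=> dF cf iF iff.
have bF := C1_bounded dF cf iF iff.
have cF := dv_continuous dF.
set M := intR _ in bF.
pose den n x : R := 1 + (n.+1%:R^-1 * x) ^+ 2.
have p1 n x : 1 <= den n x by rewrite lerDl sqr_ge0.
have p0 n x : den n x != 0 by rewrite gt_eqF// (lt_le_trans _ (p1 n x)).
pose dchi n x := - (2 * n.+1%:R^-1 ^+ 2 * x) / (den n x) ^+ 2.
have dchiP n : dv (fun x => (den n x)^-1) (dchi n).
  apply: dv_eq (dvV (dvD (dv_cst 1) (dvX 2 (dvZ n.+1%:R^-1 dv_id))) (p0 n)) _ => x.
  by rewrite /dchi /den /= expr1; congr (_ / _); field.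
have den_ge n x : 2 * (n.+1%:R^-1 * `|x|) <= den n x.
  have := sqr_ge0 (1 - n.+1%:R^-1 * `|x|).
  have : `|x| ^+ 2 = x ^+ 2 by rewrite real_normK ?num_real.
  rewrite /den exprMn => <-; set a := n.+1%:R^-1; set y := `|x|; nra.
have denV_le1 n x : `|(den n x)^-1| <= 1.
  by rewrite ger0_norm ?invr_ge0 ?(le_trans _ (p1 n x))// invf_le1// (lt_le_trans _ (p1 n x)).
have dchi_le n x : `|dchi n x| <= n.+1%:R^-1.
  rewrite /dchi normrM normrN [`|(_ ^+ 2)^-1|]ger0_norm ?invr_ge0 ?sqr_ge0//.
  rewrite normrM [`|2 * _|]ger0_norm ?mulr_ge0 ?sqr_ge0//.
  rewrite ler_pdivrMr ?exprn_gt0 ?(lt_le_trans _ (p1 n x))//.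
  have := den_ge n x; have := p1 n x; set a := n.+1%:R^-1.
  have a0 : 0 <= a by rewrite invr_ge0.
  move=> d1 d2; apply: (@le_trans _ _ (a * den n x)).
    by rewrite expr2 -!mulrA mulrCA ler_wpM2l.
  by rewrite ler_wpM2l// expr2 ler_peMl// (le_trans _ d1).
have cchi n : continuous (fun x => (den n x)^-1) by exact: dv_continuous (dchiP n).
have cdchi n : continuous (dchi n).
  have dden : dv (den n) (fun x => 2%:R * (n.+1%:R^-1 * x) ^+ 1 * (n.+1%:R^-1 * 1)).
    apply: dv_eq (dvD (dv_cst 1) (dvX 2 (dvZ n.+1%:R^-1 dv_id))) _ => x /=.
    by rewrite add0r.
  have d2 := dvX 2 dden.
  have d3 : dv (fun x => - (2 * n.+1%:R^-1 ^+ 2 * x)) (fun=> - (2 * n.+1%:R^-1 ^+ 2 * 1)).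
    exact: dvN (dvZ _ dv_id).
  have d4 := dvV d2 (fun x => expf_neq0 2 (p0 n x)).
  exact: dv_continuous (dvM d3 d4).
have i1 n : itg (fun x => f x * (den n x)^-1).
  by apply: (@itgM_bdd 1) => //; exact: cont_measurable.
have i2 n : itg (fun x => F x * dchi n x).
  by apply: (@itgM_bdd n.+1%:R^-1) => //; exact: cont_measurable.
have zero n : intR (fun x => f x * (den n x)^-1 + F x * dchi n x) = 0.
  apply: (cvg_unique (@Rhausdorff R) (itg_itv_cvg (itgD (i1 n) (i2 n)))).
  have E (m : nat) : \int[mu]_(x in `[- m%:R, m%:R]) (f x * (den n x)^-1 + F x * dchi n x) =
      F m%:R / den n m%:R - F (- m%:R) / den n (- m%:R).
    apply: (ftc_itv _ (dvM dF (dchiP n))).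
      by rewrite (@le_trans _ _ 0)// oppr_le0.
    move=> x; apply: cvgD; apply: cvgM;
      solve [exact: cf|exact: cchi|exact: cF|exact: cdchi].
  rewrite (_ : (fun m : nat => _) =
    (fun m : nat => F m%:R / den n m%:R - F (- m%:R) / den n (- m%:R))); last exact/funext.
  have H (e : bool) : F ((-1) ^+ e * m%:R) / den n ((-1) ^+ e * m%:R) @[m --> \oo] --> (0 : R).
    apply/cvgrPdist_le => eps e0.
    near=> m.
    set y := (-1) ^+ e * m%:R.
    have A : eps^-1 * M <= den n y.
      apply: le_trans (den_ge n y).
      rewrite /y normrM normrX normrN1 expr1n mul1r mulrA.
      rewrite -ler_pdivrMl ?mulr_gt0 ?invr_gt0// [`|m%:R|]ger0_norm//.
      near: m; exact: nbhs_infty_ger.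
    rewrite sub0r normrN normrM [`|_^-1|]ger0_norm ?invr_ge0 ?(le_trans _ (p1 n y))//.
    rewrite ler_pdivrMr ?(lt_le_trans _ (p1 n y))//.
    by apply: le_trans (bF _) _; rewrite -(ler_pdivrMl _ _ e0).
  rewrite -[X in [set x | _ --> x] X]subr0 /=; apply: cvgB.
    by have := H false; under eq_fun do rewrite expr0 mul1r.
  by have := H true; under eq_fun do rewrite expr1 mulN1r.
have L : intR (fun x => f x * (den n x)^-1 + F x * dchi n x) @[n --> \oo] --> intR f.
  apply: (int_dct (g := fun x => `|f x| + `|F x|)).
  - by move=> n; apply: itg_measurable; exact: itgD.
  - exact: itg_measurable.
  - apply: aeW => x; rewrite -[in X in _ --> X](addr0 (f x)) -[in X in _ --> X](mulr1 (f x)).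
    have hx : den n x @[n --> \oo] --> (1 : R).
      have -> : (1 : R) = 1 + (0 * x) * (0 * x) by rewrite !mul0r addr0.
      apply: cvgD; first exact: cvg_cst.
      under eq_fun do rewrite expr2.
      by apply: cvgM; apply: cvgM; (exact: cvg_cst || exact: cvg_harmonic).
    apply: cvgD.
      apply: cvgM; first exact: cvg_cst.
      rewrite -[in X in _ --> X]invr1; apply: cvgV => //; exact: oner_neq0.
    apply: (@cvg0_le _ _ _ _ (fun n => `|F x| * harmonic n)).
      apply: nearW => n; rewrite normrM ler_wpM2l//; exact: dchi_le.
    rewrite -(mulr0 `|F x|); apply: cvgM; [exact: cvg_cst|exact: cvg_harmonic].
  - by apply: itgD; exact: itg_norm.
  - move=> n x; apply: le_trans (ler_normD _ _) _; rewrite lerD//.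
      by rewrite normrM ler_piMr.
    rewrite normrM ler_piMr// (le_trans (dchi_le n x))// invf_le1//.
    by rewrite ler1n.
apply: (cvg_unique (@Rhausdorff R) L).
by rewrite (funext zero); exact: cvg_cst.
Unshelve. all: by end_near. Qed.

End Integrals.

Global Opaque itg intR.

(** * The Plancherel inequality *)

Section Plancherel.
Variable R : realType.
Implicit Types (f g h F : R -> R) (a b c x y xi eps : R).
Local Notation mu := (@lebesgue_measure R).

Lemma itg_itv_bound f c : measurable_fun setT f -> (forall x, 0 <= f x) ->
  (forall n : nat, mu.-integrable `[- n%:R, n%:R] (EFin \o f)) ->
  (forall n : nat, \int[mu]_(x in `[- n%:R, n%:R]) f x <= c) ->
  itg f /\ intR f <= c.
Proof.
move=> mf f0 fn fc.
apply: (@int_fatou _ (fun n => f \_ `[- n%:R, n%:R])) => //.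
- by move=> n; apply: itg_restrict => //; exact: fn.
- by move=> n x; rewrite patchE; case: ifPn.
- move=> x; apply: cvg_near_cst.
  near=> n; rewrite patchE mem_set//= in_itv/= -ler_norml.
  by near: n; exact: nbhs_infty_ger.
- by move=> n; rewrite intE -Rintegral_mkcond; exact: fc.
Unshelve. all: by end_near. Qed.

Lemma continuous_itv_itg f a b : continuous f -> mu.-integrable `[a, b] (EFin \o f).
Proof.
move=> cf; apply: continuous_compact_integrable; first exact: segment_compact.
exact: continuous_subspaceT.
Qed.

(** * The Poisson kernel *)

Definition lorentz x : R := (1 + x ^+ 2)^-1.

Lemma lorentz_den x : 1 <= 1 + x ^+ 2 :> R.
Proof. by rewrite lerDl sqr_ge0. Qed.

Lemma lorentz_neq0 x : 1 + x ^+ 2 != 0 :> R.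
Proof. by rewrite gt_eqF// (lt_le_trans _ (lorentz_den x)). Qed.

Lemma lorentz_ge0 x : 0 <= lorentz x.
Proof. by rewrite invr_ge0 (le_trans _ (lorentz_den x)). Qed.

Lemma dv_atan : dv (@atan R) lorentz.
Proof. by move=> x; exact: is_derive1_atan. Qed.

Lemma continuous_lorentz : continuous lorentz.
Proof.
apply: dv_continuous (dvV (dvD (dv_cst 1) (dvX 2 (@dv_id R))) lorentz_neq0).
Qed.

Lemma itg_lorentz : itg lorentz.
Proof.
apply: (proj1 (@itg_itv_bound _ pi _ _ _ _)).
- exact: cont_measurable continuous_lorentz.
- exact: lorentz_ge0.
- by move=> n; exact: continuous_itv_itg continuous_lorentz.
- move=> n; rewrite (ftc_itv _ dv_atan continuous_lorentz)//; last first.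
    by rewrite (@le_trans _ _ 0)// oppr_le0.
  have := atan_ltpi2 (n%:R : R); have := atan_gtNpi2 (- n%:R : R); lra.
Qed.

(** The mass is 2 pi, the constant of Plancherel's formula for the unnormalized transform. The bound
    1 is enough for an upper bound of the L^2 norm, and the interval [-1, 1] already provides it. *)
Lemma int_lorentz_ge1 : 1 <= intR (fun x => 2 * lorentz x).
Proof.
rewrite intZ; last exact: itg_lorentz.
apply: (@le_trans _ _ (2 * \int[mu]_(x in `[-1, 1]) lorentz x)).
  rewrite (ftc_itv _ dv_atan continuous_lorentz); last lra.
  rewrite atanN atan1; have := @pi_ge2 R; lra.
rewrite ler_wpM2l// Rintegral_mkcond -intE; apply: int_le.
- by apply: itg_restrict => //; exact: continuous_itv_itg continuous_lorentz.
- exact: itg_lorentz.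
- by move=> x; rewrite patchE; case: ifPn => // _; exact: lorentz_ge0.
Qed.

Lemma int_itv_split f a b c : a <= b -> b <= c -> mu.-integrable `[a, c] (EFin \o f) ->
  \int[mu]_(x in `[a, c]) f x =
  \int[mu]_(x in `[a, b]) f x + \int[mu]_(x in `[b, c]) f x.
Proof.
move=> ab bc fac.
have := @Rintegral_itvB R f (BLeft a) (BRight c) b fac.
rewrite !bnd_simp => /(_ ab bc) H.
rewrite -[X in _ + X]Rintegral_itv_obnd_cbnd; last first.
  by apply: integrableS fac => //; apply: subset_itv; rewrite bnd_simp.
by rewrite -H; ring.
Qed.

Definition damp eps xi : R := expR (- (eps * `|xi|)).

Lemma damp_ge0 eps xi : 0 <= damp eps xi. Proof. exact: expR_ge0. Qed.

Lemma continuous_damp eps : continuous (damp eps).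
Proof.
move=> x; apply: continuous_comp; last exact: continuous_expR.
apply: cvgN; apply: cvgM; [exact: cvg_cst|exact: cvg_norm].
Qed.

Lemma dampE eps xi : damp eps xi = if 0 <= xi then expR (- eps * xi) else expR (eps * xi).
Proof.
by rewrite /damp; case: ifPn => h;
  [rewrite ger0_norm// mulNr|rewrite ltr0_norm ?ltNge// mulrN opprK].
Qed.

(** The primitive is the real part of e^((s + i x) xi) / (s + i x). *)
Lemma dv_poisson_primitive (s : R) x : s ^+ 2 + x ^+ 2 != 0 ->
  dv (fun xi => expR (s * xi) * (x * sin (x * xi) + s * cos (x * xi)) / (s ^+ 2 + x ^+ 2))
     (fun xi => expR (s * xi) * cos (x * xi)).
Proof.
move=> sx0.
have d1 : dv (fun xi => expR (s * xi)) (fun xi => s * expR (s * xi)).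
  by apply: dv_eq (dv_comp (@dv_expR R) (dvZ s (@dv_id R))) _ => y; rewrite mulr1.
have ds : dv (fun xi => sin (x * xi)) (fun xi => x * cos (x * xi)).
  apply: dv_eq (dv_comp (f := cos) _ (dvZ x (@dv_id R))) _; last by move=> y; rewrite mulr1.
  by move=> y; exact: is_derive_sin.
have dc : dv (fun xi => cos (x * xi)) (fun xi => - (x * sin (x * xi))).
  apply: dv_eq (dv_comp (f := fun y => - sin y) _ (dvZ x (@dv_id R))) _.
    by move=> y; exact: is_derive_cos.
  by move=> y; rewrite mulr1 mulrN.
have := dvM (dvM d1 (dvD (dvZ x ds) (dvZ s dc))) (dv_cst (s ^+ 2 + x ^+ 2)^-1).
by move/dv_eq; apply => y /=; field.
Qed.

(** On [-n, n] the integral is computed on each side of 0 with the primitive above, with s = eps on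
    the left and s = - eps on the right. The boundary terms at -n and n are of order e^(- eps n). *)
Lemma poisson_kernel eps x : 0 < eps ->
  itg (damp eps) /\
  intR (fun xi => damp eps xi * cos (x * xi)) = 2 * eps / (eps ^+ 2 + x ^+ 2).
Proof.
move=> e0.
have ex0 y : eps ^+ 2 + y ^+ 2 != 0 by rewrite gt_eqF// ltr_pwDl ?exprn_gt0 ?sqr_ge0.
have ex0' y : (- eps) ^+ 2 + y ^+ 2 != 0 by rewrite sqrrN.
have cc (y : R) : continuous (fun xi : R => cos (y * xi)).
  move=> z; apply: continuous_comp; last exact: continuous_cos.
  by apply: cvgM; [exact: cvg_cst|exact: cvg_id].
have ce (s : R) : continuous (fun xi : R => expR (s * xi)).
  move=> z; apply: continuous_comp; last exact: continuous_expR.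
  by apply: cvgM; [exact: cvg_cst|exact: cvg_id].
pose F s y (xi : R) := expR (s * xi) * (y * sin (y * xi) + s * cos (y * xi)) / (s ^+ 2 + y ^+ 2).
have I y (n : nat) : \int[mu]_(xi in `[- n%:R, n%:R]) (damp eps xi * cos (y * xi)) =
   2 * eps / (eps ^+ 2 + y ^+ 2) + (F (- eps) y n%:R - F eps y (- n%:R)).
  rewrite (@int_itv_split _ _ 0) ?oppr_le0//; last first.
    apply: continuous_itv_itg => z; apply: cvgM; [exact: continuous_damp|exact: cc].
  have -> : \int[mu]_(xi in `[- n%:R, 0]) (damp eps xi * cos (y * xi)) =
      \int[mu]_(xi in `[- n%:R, 0]) (expR (eps * xi) * cos (y * xi)).
    apply: eq_Rintegral => z /set_mem; rewrite /mkset in_itv => /andP[z1 z2].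
    rewrite dampE; case: ifPn => // z3.
    have z0 : z <= 0 := z2.
    have -> : z = 0 by apply/le_anti; rewrite z0 z3.
    by rewrite !mulr0.
  have -> : \int[mu]_(xi in `[0, n%:R]) (damp eps xi * cos (y * xi)) =
      \int[mu]_(xi in `[0, n%:R]) (expR (- eps * xi) * cos (y * xi)).
    apply: eq_Rintegral => z /set_mem; rewrite /mkset in_itv => /andP[z1 z2].
    have z0 : 0 <= z := z1.
    by rewrite dampE z0.
  rewrite (ftc_itv _ (dv_poisson_primitive (ex0 y))) ?oppr_le0//; last first.
    by move=> z; apply: cvgM; [exact: ce|exact: cc].
  rewrite (ftc_itv _ (dv_poisson_primitive (ex0' y)))//; last first.
    by move=> z; apply: cvgM; [exact: ce|exact: cc].
  rewrite /F !mulr0 sin0 cos0 expR0 !sqrrN; field.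
  exact: ex0.
have Fn y : F (- eps) y n%:R - F eps y (- n%:R) @[n --> \oo] --> (0 : R).
  set B := 2 * (`|y| + eps) / (eps ^+ 2 + y ^+ 2).
  have den0 : 0 < eps ^+ 2 + y ^+ 2 by rewrite ltr_pwDl ?exprn_gt0 ?sqr_ge0.
  have FB (s z : R) : `|s| = eps ->
    `|F s y z| <= expR (s * z) * ((`|y| + eps) / (eps ^+ 2 + y ^+ 2)).
    move=> sE; rewrite /F -[s ^+ 2]real_normK ?num_real// sE.
    rewrite !normrM normfV [`|expR _|]ger0_norm ?expR_ge0// -mulrA ler_wpM2l ?expR_ge0//.
    rewrite [`|_ + _ ^+ 2|]gtr0_norm// ler_pM2r ?invr_gt0//.
    apply: le_trans (ler_normD _ _) _; rewrite !normrM sE.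
    by rewrite lerD// ler_piMr ?normr_ge0 ?sin_max ?cos_max// ltW.
  apply: (@cvg0_le _ _ _ _ _ (fun n : nat => expR (- eps) ^+ n * B)).
    apply: nearW => n; rewrite -expRM_natl.
    apply: le_trans (ler_normB _ _) _.
    have := FB (- eps) n%:R; rewrite normrN gtr0_norm// => /(_ erefl) H1.
    have := FB eps (- n%:R); rewrite gtr0_norm// => /(_ erefl) H2.
    apply: le_trans (lerD H1 H2) _.
    have -> : - eps * n%:R = n%:R * - eps by ring.
    have -> : eps * - n%:R = n%:R * - eps by ring.
    by rewrite /B; set u := expR _; rewrite le_eqVlt; apply/orP; left; apply/eqP; ring.
  rewrite -(mul0r B); apply: cvgM; last exact: cvg_cst.
  apply: cvg_expr; rewrite ger0_norm ?expR_ge0//.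
  by rewrite -expR0 ltr_expR oppr_lt0.
have id : itg (damp eps).
  apply: (proj1 (@itg_itv_bound _ (2 / eps) _ _ _ _)).
  - exact: cont_measurable (@continuous_damp eps).
  - exact: damp_ge0.
  - by move=> n; exact: continuous_itv_itg (@continuous_damp eps).
  - move=> n; have := I 0 n.
    under eq_Rintegral do rewrite mul0r cos0 mulr1.
    move=> ->; rewrite /F !mul0r !cos0 expr0n/= !addr0 !sqrrN !add0r !mulr1.
    have e1 : 0 <= expR (- eps * n%:R) / eps by rewrite divr_ge0 ?expR_ge0 ?ltW.
    have e2 : 0 <= expR (eps * - n%:R) / eps by rewrite divr_ge0 ?expR_ge0 ?ltW.
    have -> : 2 * eps / eps ^+ 2 = 2 / eps by field; rewrite gt_eqF.
    have -> : expR (- eps * n%:R) * - eps / eps ^+ 2 = - (expR (- eps * n%:R) / eps).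
      by field; rewrite gt_eqF.
    have -> : expR (eps * - n%:R) * eps / eps ^+ 2 = expR (eps * - n%:R) / eps.
      by field; rewrite gt_eqF.
    lra.
split => //.
have := itg_itv_cvg (itgM_bdd (h := fun xi => cos (x * xi)) id (cont_measurable (cc x)) (fun z => cos_max _)).
move=> L; apply: (cvg_unique (@Rhausdorff R) L).
rewrite (_ : (fun n : nat => _) = (fun n : nat =>
  2 * eps / (eps ^+ 2 + x ^+ 2) + (F (- eps) x n%:R - F eps x (- n%:R)))); last exact/funext.
by rewrite -[X in [set x | _ --> x] X]addr0; apply: cvgD; [exact: cvg_cst|exact: Fn].
Qed.

(** The Fourier transform of g is [cosT g] - i [sinT g]. *)
Definition cosT g xi := intR (fun y => g y * cos (y * xi)).
Definition sinT g xi := intR (fun y => g y * sin (y * xi)).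

Lemma cont_cosM c : continuous (fun x : R => cos (c * x)).
Proof.
move=> z; apply: continuous_comp; last exact: continuous_cos.
by apply: cvgM; [exact: cvg_cst|exact: cvg_id].
Qed.

Lemma cont_sinM c : continuous (fun x : R => sin (c * x)).
Proof.
move=> z; apply: continuous_comp; last exact: continuous_sin.
by apply: cvgM; [exact: cvg_cst|exact: cvg_id].
Qed.

Lemma cont_cosMr c : continuous (fun x : R => cos (x * c)).
Proof.
have -> : (fun x => cos (x * c)) = (fun x => cos (c * x)) by apply/funext => x; rewrite mulrC.
exact: cont_cosM.
Qed.

Lemma cont_sinMr c : continuous (fun x : R => sin (x * c)).
Proof.
have -> : (fun x => sin (x * c)) = (fun x => sin (c * x)) by apply/funext => x; rewrite mulrC.
exact: cont_sinM.
Qed.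

Lemma itg_cos g xi : itg g -> itg (fun y => g y * cos (y * xi)).
Proof.
move=> ig; apply: (@itgM_bdd _ 1) => //; last by move=> x; exact: cos_max.
exact: cont_measurable (@cont_cosMr xi).
Qed.

Lemma itg_sin g xi : itg g -> itg (fun y => g y * sin (y * xi)).
Proof.
move=> ig; apply: (@itgM_bdd _ 1) => //; last by move=> x; exact: sin_max.
exact: cont_measurable (@cont_sinMr xi).
Qed.

Lemma cosT_bound g xi : itg g -> `|cosT g xi| <= intR (fun y => `|g y|).
Proof.
move=> ig; apply: le_trans (int_norm (itg_cos xi ig)) _.
apply: int_le; [exact/itg_norm/itg_cos|exact: itg_norm|].
by move=> x; rewrite normrM ler_piMr// cos_max.
Qed.

Lemma sinT_bound g xi : itg g -> `|sinT g xi| <= intR (fun y => `|g y|).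
Proof.
move=> ig; apply: le_trans (int_norm (itg_sin xi ig)) _.
apply: int_le; [exact/itg_norm/itg_sin|exact: itg_norm|].
by move=> x; rewrite normrM ler_piMr// sin_max.
Qed.

Lemma measurable_cosM : measurable_fun setT (fun z : R * R => cos (z.1 * z.2)).
Proof.
apply: measurableT_comp; first exact: cont_measurable (@continuous_cos R).
exact: measurable_funM.
Qed.

Lemma measurable_sinM : measurable_fun setT (fun z : R * R => sin (z.1 * z.2)).
Proof.
apply: measurableT_comp; first exact: cont_measurable (@continuous_sin R).
exact: measurable_funM.
Qed.

Lemma fubini_cosT g h : itg g -> itg h ->
  itg (fun xi => h xi * cosT g xi) /\
  intR (fun x => g x * cosT h x) = intR (fun xi => h xi * cosT g xi).
Proof.
move=> ig ih.
have [i1 e1] := int_fubini ig ih measurable_cosM (fun z => cos_max _).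
have [i2 e2] := int_fubini ih ig measurable_cosM (fun z => cos_max _).
have E x y : cos (x * y) = cos (y * x) :> R by rewrite mulrC.
split.
  by apply: eq_itg i2 => xi /=; congr (_ * _); apply: eq_int => y; rewrite E.
rewrite -[LHS]/(intR (fun x => g x * intR (fun y => h y * cos (y * x)))).
transitivity (intR (fun x => g x * intR (fun y => h y * cos (x * y)))); last exact: e1.
by apply: eq_int => x; congr (_ * _); apply: eq_int => y; rewrite E.
Qed.

Lemma fubini_sinT g h : itg g -> itg h ->
  itg (fun xi => h xi * sinT g xi) /\
  intR (fun x => g x * sinT h x) = intR (fun xi => h xi * sinT g xi).
Proof.
move=> ig ih.
have [i1 e1] := int_fubini ig ih measurable_sinM (fun z => sin_max _).
have [i2 e2] := int_fubini ih ig measurable_sinM (fun z => sin_max _).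
have E x y : sin (x * y) = sin (y * x) :> R by rewrite mulrC.
split.
  by apply: eq_itg i2 => xi /=; congr (_ * _); apply: eq_int => y; rewrite E.
rewrite -[LHS]/(intR (fun x => g x * intR (fun y => h y * sin (y * x)))).
transitivity (intR (fun x => g x * intR (fun y => h y * sin (x * y)))); last exact: e1.
by apply: eq_int => x; congr (_ * _); apply: eq_int => y; rewrite E.
Qed.

(** Fubini's theorem makes the product with the integrable function [damp 1] measurable; the damping
    factor is then divided out. *)
Lemma measurable_cosT g : itg g -> measurable_fun setT (cosT g).
Proof.
move=> ig; have [i0 _] := poisson_kernel 0 (@ltr01 R).
have [/itg_measurable m _] := fubini_cosT ig i0.
have mi : measurable_fun setT (fun xi : R => expR `|xi|).
  apply: cont_measurable => x; apply: continuous_comp; last exact: continuous_expR.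
  exact: norm_continuous.
rewrite (_ : cosT g = fun xi => expR `|xi| * (damp 1 xi * cosT g xi)).
  exact: measurable_funM.
by apply/funext => xi; rewrite mulrA /damp mul1r -expRD subrr expR0 mul1r.
Qed.

Lemma measurable_sinT g : itg g -> measurable_fun setT (sinT g).
Proof.
move=> ig; have [i0 _] := poisson_kernel 0 (@ltr01 R).
have [/itg_measurable m _] := fubini_sinT ig i0.
have mi : measurable_fun setT (fun xi : R => expR `|xi|).
  apply: cont_measurable => x; apply: continuous_comp; last exact: continuous_expR.
  exact: norm_continuous.
rewrite (_ : sinT g = fun xi => expR `|xi| * (damp 1 xi * sinT g xi)).
  exact: measurable_funM.
by apply/funext => xi; rewrite mulrA /damp mul1r -expRD subrr expR0 mul1r.
Qed.

(* Both sides are the Poisson mean of [g] at [x]. *)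
Lemma poisson_mean g eps x : 0 < eps -> itg g ->
  intR (fun s => g (eps * s + x) * (2 * lorentz s)) =
  intR (fun xi => damp eps xi * cosT g xi * cos (xi * x)) +
  intR (fun xi => damp eps xi * sinT g xi * sin (xi * x)).
Proof.
move=> e0 ig.
have [id pk] := poisson_kernel 0 e0.
pose K (z : R * R) := cos ((z.1 - x) * z.2).
have mK : measurable_fun setT K.
  apply: measurableT_comp; first exact: cont_measurable (@continuous_cos R).
  by apply: measurable_funM => //; exact: measurable_funB.
have Kc z : `|K z| <= 1 by exact: cos_max.
have [i1 e1] := int_fubini ig id mK Kc.
have -> : intR (fun s => g (eps * s + x) * (2 * lorentz s)) =
    intR (fun y => g y * intR (fun xi => damp eps xi * K (y, xi))).
  (* The substitution y = eps s + x turns eps times the kernel 2 eps / (eps^2 + (y - x)^2) into 2 /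
     (1 + s^2). *)
  pose G y := eps * (g y * intR (fun xi => damp eps xi * K (y, xi))).
  transitivity (intR (fun s => G (eps * s + x))).
    apply: eq_int => s; rewrite /G /K/= addrK.
    rewrite (proj2 (poisson_kernel (eps * s) e0)) /lorentz.
    have -> : eps ^+ 2 + (eps * s) ^+ 2 = eps ^+ 2 * (1 + s ^+ 2) by ring.
    by field; rewrite lorentz_neq0 gt_eqF.
  have iG : intR G = eps * intR (fun y => g y * intR (fun xi => damp eps xi * K (y, xi))).
    exact: intZ.
  rewrite (int_affine x e0 (itgZ eps i1 : itg G)) iG mulrA mulVf ?mul1r//.
  by rewrite gt_eqF.
rewrite e1 -intD; last 2 first.
- by have [i2 _] := fubini_cosT ig id; exact: itg_cos.
- by have [i2 _] := fubini_sinT ig id; exact: itg_sin.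
apply: eq_int => xi.
transitivity (damp eps xi * intR (fun y => cos (xi * x) * (g y * cos (y * xi)) +
    sin (xi * x) * (g y * sin (y * xi)))).
  congr (_ * _); apply: eq_int => y; rewrite /K/= mulrBl cosB [x * xi]mulrC mulrDr;
    by congr (_ + _); rewrite mulrA [RHS]mulrC.
rewrite intD; [|exact/itgZ/itg_cos|exact/itgZ/itg_sin].
rewrite intZ; last exact: itg_cos.
rewrite intZ; last exact: itg_sin.
rewrite /cosT /sinT; ring.
Qed.

(** The Poisson mean is multiplied by g and integrated; the transforms then move onto g by Fubini's
    theorem. The factor e^(- eps |xi|) makes every integral absolutely convergent. *)
Lemma damped_parseval g eps : 0 < eps -> itg g ->
  intR (fun x => g x * intR (fun s => g (eps * s + x) * (2 * lorentz s))) =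
  intR (fun xi => damp eps xi * (cosT g xi ^+ 2 + sinT g xi ^+ 2)).
Proof.
move=> e0 ig.
have [id pk] := poisson_kernel 0 e0.
have [i1 _] := fubini_cosT ig id.
have [i2 _] := fubini_sinT ig id.
have [j1 e1] := fubini_cosT ig i1.
have [j2 e2] := fubini_sinT ig i2.
transitivity (intR (fun x => g x * cosT (fun xi => damp eps xi * cosT g xi) x +
  g x * sinT (fun xi => damp eps xi * sinT g xi) x)).
  by apply: eq_int => x; rewrite (poisson_mean x e0 ig) mulrDr.
rewrite intD; last 2 first.
- by have [] := fubini_cosT i1 ig.
- by have [] := fubini_sinT i2 ig.
rewrite e1 e2 -(intD j1 j2); apply: eq_int => xi.
by rewrite !expr2 mulrDr !mulrA.
Qed.

(** In the damped identity eps = 1 / (n + 1) tends to 0. The left side tends to 2 pi times the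
    integral of g^2, because the Poisson means of the bounded g converge at its points of
    continuity; the right side stays below the integral of Q because the damping factor is at most
    1. Boundedness and continuity almost everywhere are what truncations of continuous functions
    have. *)
Lemma plancherel_le g M Q : itg g -> (forall x, `|g x| <= M) ->
  {ae mu, forall x, {for x, continuous g}} -> itg Q ->
  (forall xi, cosT g xi ^+ 2 + sinT g xi ^+ 2 <= Q xi) ->
  intR (fun x => g x ^+ 2) <= intR Q.
Proof.
move=> ig gM cg iQ gQ.
have mg := itg_measurable ig.
have M0 : 0 <= M by exact: le_trans (normr_ge0 _) (gM 0).
set c := intR (fun x => 2 * lorentz x).
have i2l : itg (fun x : R => 2 * lorentz x) by exact/itgZ/itg_lorentz.
have ig2 : itg (fun x => g x ^+ 2).
  by under eq_fun do rewrite expr2; exact: itgM_bdd gM.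
apply: (@le_trans _ _ (c * intR (fun x => g x ^+ 2))).
  rewrite ler_peMl ?int_lorentz_ge1// int_ge0// => x; exact: sqr_ge0.
pose S n x := intR (fun s => g (n.+1%:R^-1 * s + x) * (2 * lorentz s)).
have n0 n : 0 < n.+1%:R^-1 :> R by rewrite invr_gt0.
have iS n x : itg (fun s => g (n.+1%:R^-1 * s + x) * (2 * lorentz s)).
  under eq_fun do rewrite mulrC; apply: itgM_bdd i2l _ _; last by move=> s; exact: gM.
  exact: itg_measurable (itg_affine x (n0 n) ig).
have SM n x : `|S n x| <= M * c.
  apply: le_trans (int_norm (iS n x)) _; rewrite -intZ//.
  apply: int_le; [exact: itg_norm|exact: itgZ|].
  by move=> s; rewrite normrM [`|2 * _|]ger0_norm ?mulr_ge0 ?lorentz_ge0//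
    ler_wpM2r ?mulr_ge0 ?lorentz_ge0.
have S0 x : {for x, continuous g} -> S n x @[n --> \oo] --> g x * c.
  move=> gx; rewrite /c -intZ//.
  apply: (int_dct (g := fun s => M * (2 * lorentz s))).
  - by move=> n; exact: itg_measurable (iS n x).
  - by apply: itg_measurable; exact: itgZ.
  - apply: aeW => s; apply: cvgM; last exact: cvg_cst.
    apply: (cvg_comp (fun n : nat => n.+1%:R^-1 * s + x) g); last exact: gx.
    have : n.+1%:R^-1 * s + x @[n --> \oo] --> 0 * s + x.
      apply: cvgD; last exact: cvg_cst.
      by apply: cvgM; [exact: cvg_harmonic|exact: cvg_cst].
    by rewrite mul0r add0r.
  - exact: itgZ.
  - by move=> n s; rewrite normrM [`|2 * _|]ger0_norm ?mulr_ge0 ?lorentz_ge0//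
    ler_wpM2r ?mulr_ge0 ?lorentz_ge0.
have mS n : measurable_fun setT (S n).
  have [id _] := poisson_kernel 0 (n0 n).
  have [i1 _] := fubini_cosT ig id.
  have [i2 _] := fubini_sinT ig id.
  rewrite (_ : S n = fun x => cosT (fun xi => damp n.+1%:R^-1 xi * cosT g xi) x +
    sinT (fun xi => damp n.+1%:R^-1 xi * sinT g xi) x).
    by apply: measurable_funD; [exact: measurable_cosT|exact: measurable_sinT].
  by apply/funext => x; rewrite /S (poisson_mean x (n0 n) ig).
have L : intR (fun x => g x * S n x) @[n --> \oo] --> c * intR (fun x => g x ^+ 2).
  rewrite -intZ//; apply: (int_dct (g := fun x => (M * c) * `|g x|)).
  - by move=> n; exact: measurable_funM.
  - exact: itg_measurable (itgZ c ig2).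
  - apply: ae_imp cg => x gx.
    have -> : c * g x ^+ 2 = g x * (g x * c) by rewrite expr2; ring.
    by apply: cvgM; [exact: cvg_cst|exact: S0].
  - exact/itgZ/itg_norm.
  - by move=> n x; rewrite normrM mulrC ler_wpM2r.
apply: (cvgr_to_le L); apply: nearW => n.
rewrite /S damped_parseval//; apply: int_le => //.
  have [id _] := poisson_kernel 0 (n0 n).
  have [i1 _] := fubini_cosT ig id.
  have [i2 _] := fubini_sinT ig id.
  apply: eq_itg (itgD (itgM_bdd i1 (measurable_cosT ig) (fun xi => cosT_bound xi ig))
    (itgM_bdd i2 (measurable_sinT ig) (fun xi => sinT_bound xi ig))) => xi.
  by rewrite !expr2 mulrDr !mulrA.
move=> xi; apply: le_trans (gQ xi); rewrite ler_piMl ?addr_ge0 ?sqr_ge0//.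
by rewrite /damp -expR0 ler_expR oppr_le0 mulr_ge0.
Qed.

End Plancherel.

(** * Regularity from the weak formulation *)

Section Primitive.
Variable R : realType.
Implicit Types (f g u v w F : R -> R) (a b c x y : R).
Local Notation mu := (@lebesgue_measure R).

Definition locint g := measurable_fun setT g /\
  forall a b, mu.-integrable `[a, b] (EFin \o g).

Lemma locally_integrable_locint g : locally_integrable setT g -> locint g.
Proof.
move=> [mg _ H]; split => // a b; apply/integrableP; split.
  by apply/measurable_EFinP; exact: measurable_funTS.
by apply: H => //; exact: segment_compact.
Qed.

Lemma continuous_locint g : continuous g -> locint g.
Proof.
move=> cg; split; first exact: cont_measurable.
move=> a b; apply: continuous_compact_integrable; first exact: segment_compact.
exact: continuous_subspaceT.
Qed.

Lemma locint_itg g a b : locint g -> itg (g \_ `[a, b]).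
Proof. by move=> [_ H]; exact: itg_restrict. Qed.

Lemma locintM g h : locint g -> continuous h -> locint (fun x => g x * h x).
Proof.
move=> [mg lg] ch; split; first by apply: measurable_funM => //; exact: cont_measurable.
move=> a b.
have cN : {within `[a, b], continuous (fun x => `|h x|)}.
  apply: continuous_subspaceT => x; apply: continuous_comp; first exact: ch.
  exact: norm_continuous.
have [ab|ba] := leP a b; last first.
  by rewrite set_itv_ge ?bnd_simp -?ltNge//; exact: integrable_set0.
have [c _ cmax] := EVT_max ab cN.
have H : mu.-integrable `[a, b] (fun x => (`|h c|)%:E * (`|g x|)%:E)%E.
  by apply: integrableZl => //; exact: integrable_norm (lg a b).
apply: (le_integrable _ _ _ H) => //.
- apply/measurable_EFinP; apply: measurable_funTS.
  by apply: measurable_funM => //; exact: cont_measurable.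
- move=> x xab /=; rewrite lee_fin !normrM !normr_id mulrC ler_wpM2r//.
  exact: cmax.
Qed.

Lemma locintZ c g : locint g -> locint (fun x => c * g x).
Proof.
move=> lg; have -> : (fun x => c * g x) = (fun x => g x * c).
  by apply/funext => x; rewrite mulrC.
by apply: (locintM lg) => x; exact: cvg_cst.
Qed.

Lemma locintB g h : locint g -> locint h -> locint (fun x => g x - h x).
Proof.
move=> [mg lg] [mh lh]; split; first exact: measurable_funB.
move=> a b; have mab : measurable ([set` `[a, b]] : set (measurableTypeR R)) by [].
exact: (integrableB mab (lg a b) (lh a b)).
Qed.

Definition itvint g a b := \int[mu]_(x in `[a, b]) g x.

Lemma itvintE g a b : itvint g a b = intR (g \_ `[a, b]).
Proof. by rewrite /itvint Rintegral_mkcond -intE. Qed.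

Lemma itvint_split g a b c : locint g -> a <= b -> b <= c ->
  itvint g a c = itvint g a b + itvint g b c.
Proof.
move=> [_ lg] ab bc; have fac := lg a c.
have := @Rintegral_itvB R g (BLeft a) (BRight c) b fac.
rewrite !bnd_simp => /(_ ab bc) H.
rewrite /itvint -[X in _ + X]Rintegral_itv_obnd_cbnd; last first.
  by apply: integrableS fac => //; apply: subset_itv; rewrite bnd_simp.
by rewrite -H; ring.
Qed.

Lemma itvint_point g a : itvint g a a = 0.
Proof. by rewrite /itvint set_itv1 Rintegral_set1. Qed.

Definition prim g x := if 0 <= x then itvint g 0 x else - itvint g x 0.

Lemma prim_diff g a b : locint g -> a <= b -> prim g b - prim g a = itvint g a b.
Proof.
move=> lg ab; rewrite /prim; case: (leP 0 a) => a0.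
  rewrite (le_trans a0 ab) (itvint_split lg a0 ab); ring.
case: (leP 0 b) => b0.
  by rewrite opprK addrC -itvint_split// ltW.
rewrite opprK (itvint_split lg ab (ltW b0)); ring.
Qed.

Lemma prim_dv g : continuous g -> dv (prim g) g.
Proof.
move=> cg x; have lg := continuous_locint cg.
pose a := x - 1; pose F y := \int[mu]_(t in `[a, y]) g t.
have ax : a < x by rewrite /a; lra.
have xu : x < x + 1 by lra.
have [dF F'] := @continuous_FTC1_closed R g a x (x + 1) xu (lg.2 _ _) ax (cg x).
have near_eq : \forall y \near x, F y + prim g a = prim g y.
  near=> y; rewrite -[RHS](subrK (prim g a)) prim_diff//.
  apply/ltW; near: y; exact: lt_nbhsr.
apply: (@near_eq_is_derive _ _ _ (fun y => F y + prim g a)).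
  - exact: near_eq.
  have isF : is_derive x 1 F (g x) by apply: (DeriveDef dF); rewrite -derive1E.
  have := is_deriveD isF (is_derive_cst (prim g a) x 1).
  by rewrite addr0.
Unshelve. all: by end_near. Qed.

Lemma itvint_cst0 g a b : {in `[a, b], forall x, g x = 0} -> itvint g a b = 0.
Proof.
move=> g0; rewrite itvintE -[RHS](@int0 R); apply: eq_int => x.
by rewrite patchE; case: ifPn => // /set_mem xab; apply: g0.
Qed.

Lemma eq_itvint f g a b : (forall x, a <= x <= b -> f x = g x) ->
  itvint f a b = itvint g a b.
Proof.
move=> fg; apply: eq_Rintegral => x /set_mem; rewrite /mkset in_itv => H.
exact: fg.
Qed.

Lemma itvintB f g a b : locint f -> locint g ->
  itvint (fun x => f x - g x) a b = itvint f a b - itvint g a b.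
Proof. by move=> [_ lf] [_ lg]; rewrite /itvint RintegralB. Qed.

Lemma itvintZ c g a b : locint g -> itvint (fun x => c * g x) a b = c * itvint g a b.
Proof. by move=> [_ lg]; rewrite /itvint RintegralZl. Qed.

Lemma itvint_dv F f a b : a <= b -> dv F f -> continuous f -> itvint f a b = F b - F a.
Proof. by move=> ab dF cf; rewrite /itvint (ftc_itv ab dF cf). Qed.

Lemma patch_itv f a b x : (f \_ `[a, b]) x = if (a <= x <= b) then f x else 0.
Proof.
rewrite patchE; case: ifPn => [/set_mem|/negP H]; rewrite /mkset ?in_itv/=.
  by move=> ->.
case: ifPn => // h; case: H; apply/mem_set; rewrite /mkset in_itv/=; exact: h.
Qed.

Lemma prim_continuous g : locint g -> continuous (prim g).
Proof.
move=> lg x; pose a := x - 1.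
have ab : a <= x + 1 by rewrite /a; lra.
have H := parameterized_integral_continuous ab (lg.2 a (x + 1)).
have xin : x \in `]a, (x + 1)[ by rewrite in_itv/= /a; lra.
have cx : {for x, continuous (fun y => itvint g a y)}.
  have lt_ab : a < x + 1 by rewrite /a; lra.
  by have [+ _ _] := (continuous_within_itvP _ lt_ab).1 H; apply.
have near_eq : \forall y \near x, itvint g a y + prim g a = prim g y.
  near=> y; rewrite -prim_diff ?subrK//.
  by apply/ltW; near: y; apply: lt_nbhsr; rewrite /a; lra.
rewrite /continuous_at -(nbhs_singleton near_eq).
apply: cvg_trans (near_eq_cvg near_eq) _.
by apply: cvgD; [exact: cx|exact: cvg_cst].
Unshelve. all: by end_near. Qed.

Lemma prim_ibp g v v' a b : locint g -> dv v v' -> continuous v' -> a <= b ->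
  itvint (fun x => v x * g x) a b =
  v b * prim g b - v a * prim g a - itvint (fun x => v' x * prim g x) a b.
Proof.
move=> lg dvv cv' ab; have cv := dv_continuous dvv.
have lv' := continuous_locint cv'.
pose K (z : R * R) : R := (z.1 <= z.2)%R%:R.
have mK : measurable_fun setT K.
  apply: (measurableT_comp (f := fun b : bool => b%:R : R)) => //.
  exact: measurable_fun_ler.
have K1 z : `|K z| <= 1 by rewrite /K; case: (z.1 <= z.2); rewrite /= ?normr1 ?normr0.
have ig := locint_itg a b lg.
have iv' := locint_itg a b lv'.
have [_] := int_fubini ig iv' mK K1.
have lvg : locint (fun x => g x * v x) by exact: locintM.
have lvbg : locint (fun x => v b * g x).
  exact: locintZ.
have -> : intR (fun x => (g \_ `[a, b]) x * intR (fun y => (v' \_ `[a, b]) y * K (x, y))) =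
    v b * (prim g b - prim g a) - itvint (fun x => v x * g x) a b.
  rewrite prim_diff// -itvintZ//.
  have -> : itvint (fun x => v x * g x) a b = itvint (fun x => g x * v x) a b.
    by apply: eq_itvint => x _; rewrite mulrC.
  rewrite -(itvintB a b lvbg lvg) itvintE; apply: eq_int => x; rewrite !patch_itv.
  case: ifPn => [/andP[ax xb]|]; last by rewrite mul0r.
  have -> : intR (fun y => (v' \_ `[a, b]) y * K (x, y)) = itvint v' x b.
    rewrite itvintE; apply: eq_int => y; rewrite !patch_itv /K/=.
    case: (leP x y) => xy; last by rewrite mulr0.
    by rewrite mulr1 (le_trans ax xy).
  by rewrite (itvint_dv xb dvv cv'); ring.
have -> : intR (fun y => (v' \_ `[a, b]) y * intR (fun x => (g \_ `[a, b]) x * K (x, y))) =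
    itvint (fun x => v' x * prim g x) a b - prim g a * (v b - v a).
  rewrite -(itvint_dv ab dvv cv') -itvintZ// -itvintB//; last 2 first.
  - by apply: continuous_locint => x; apply: cvgM; [exact: cv'|exact: prim_continuous].
  - by apply: continuous_locint => x; apply: cvgM; [exact: cvg_cst|exact: cv'].
  rewrite itvintE; apply: eq_int => y; rewrite !patch_itv.
  case: ifPn => [/andP[ay yb]|]; last by rewrite mul0r.
  have -> : intR (fun x => (g \_ `[a, b]) x * K (x, y)) = itvint g a y.
    rewrite itvintE; apply: eq_int => x; rewrite !patch_itv /K/=.
    case: (leP x y) => xy; last by rewrite mulr0 andbF.
    by rewrite mulr1 (le_trans xy yb).
  by rewrite -prim_diff//; ring.
move=> H.
have : itvint (fun x => v x * g x) a b = v b * (prim g b - prim g a) -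
  (itvint (fun x => v' x * prim g x) a b - prim g a * (v b - v a)) by rewrite -H; ring.
by move=> ->; ring.
Qed.

(** * Smooth functions and test functions *)

Definition smooth f := forall n x, derivable (derive1n n f) x 1.

Lemma smooth_class (S : (R -> R) -> Prop) :
  (forall F, S F -> exists2 f, S f & dv F f) -> forall F, S F -> smooth F.
Proof.
move=> HS F SF n x.
have [f Sf df] : exists2 f, S f & dv (derive1n n F) f.
  elim: n => [|n [f Sf df]]; first exact: HS.
  by rewrite derive1nS (dv_derive1 df); exact: HS.
exact: dv_derivable df x.
Qed.

Lemma smooth_dv f n : smooth f -> dv (derive1n n f) (derive1n n.+1 f).
Proof. by move=> sf x; rewrite derive1nS; apply: (DeriveDef (sf n x)); rewrite derive1E. Qed.

Lemma smooth_continuous f n : smooth f -> continuous (derive1n n f).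
Proof. by move=> sf; exact: dv_continuous (smooth_dv n sf). Qed.

Lemma smooth_of_dv F f : dv F f -> smooth f -> smooth F.
Proof.
move=> dF sf [|n] x; first exact: dv_derivable dF x.
by rewrite derive1Sn (dv_derive1 dF).
Qed.

Lemma derive1n_lin f g c n : smooth f -> smooth g ->
  derive1n n (fun x => f x - c * g x) = fun x => derive1n n f x - c * derive1n n g x.
Proof.
move=> sf sg; elim: n => [//|n IH]; rewrite derive1nS IH.
by rewrite (dv_derive1 (dvB (smooth_dv n sf) (dvZ c (smooth_dv n sg)))).
Qed.

Lemma smooth_lin f g c : smooth f -> smooth g -> smooth (fun x => f x - c * g x).
Proof.
move=> sf sg n x; rewrite derive1n_lin//.
exact: dv_derivable (dvB (smooth_dv n sf) (dvZ c (smooth_dv n sg))) x.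
Qed.

Lemma smooth_affine f a b : smooth f -> smooth (fun x => f (a * x + b)).
Proof.
move=> sf.
apply: (@smooth_class (fun F => exists c n, F = fun x => c * derive1n n f (a * x + b))).
  move=> _ [c [n ->]]; exists (fun x => c * (a * derive1n n.+1 f (a * x + b))).
    by exists (c * a), n.+1; apply/funext => x; rewrite mulrA.
  exact: dvZ (dv_affine a b (smooth_dv n sf)).
by exists 1, 0%N; apply/funext => x; rewrite mul1r.
Qed.

Lemma test_lin f g c : test_function f -> test_function g ->
  test_function (fun x => f x - c * g x).
Proof.
move=> [sf [M fM]] [sg [N gN]]; split; first exact: smooth_lin.
exists (Num.max M N) => x; rewrite gt_max => /andP[Mx Nx].
by rewrite fM// gN// mulr0 subr0.
Qed.

(* The span of these functions is stable under differentiation, which makes every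
   combination of them smooth. *)
Definition flat n x : R := if 0 < x then x ^- n * expR (- x^-1) else 0.

(** From y / m <= e^(y / m), raised to the power m. *)
Lemma exprn_le_expR m y : 0 <= y -> y ^+ m <= m%:R ^+ m * expR y.
Proof.
case: m => [|m] y0; first by rewrite !expr0 mul1r -expR0 ler_expR.
have -> : expR y = expR (y / m.+1%:R) ^+ m.+1.
  by rewrite -expRM_natl mulrCA divff ?mulr1// pnatr_eq0.
rewrite -exprMn; apply: lerXn2r; rewrite ?nnegrE ?mulr_ge0 ?expR_ge0//.
rewrite -ler_pdivrMl ?ltr0n// mulrC.
by apply: le_trans (expR_ge1Dx _); rewrite lerDr.
Qed.

(** With y = 1 / x and m = n + 2, x^-n e^(-y) = (y^m / e^y) x^2. The square is what makes the
    derivative at 0 vanish in [flat_dv]. *)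
Lemma flat_le n : exists2 C, 0 <= C & forall x, `|flat n x| <= C * `|x| ^+ 2.
Proof.
pose m := n.+2; exists (m%:R ^+ m); first by rewrite exprn_ge0.
move=> x; rewrite /flat; case: ifPn => x0; last by rewrite normr0 mulr_ge0 ?exprn_ge0.
have y0 : 0 <= x^-1 by rewrite invr_ge0 ltW.
have xn : x != 0 by rewrite gt_eqF.
have en : expR x^-1 != 0 by rewrite gt_eqF ?expR_gt0.
have E : x ^- n * expR (- x^-1) = (x^-1 ^+ m / expR x^-1) * x ^+ 2.
  rewrite expRN /m !exprS !exprVn expr0; field.
  by rewrite en xn expf_neq0.
rewrite ger0_norm; last by rewrite mulr_ge0 ?expR_ge0// invr_ge0 exprn_ge0// ltW.
rewrite E [`|x|]gtr0_norm// ler_wpM2r ?sqr_ge0// ler_pdivrMr ?expR_gt0//.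
exact: exprn_le_expR.
Qed.

Lemma flat_dv n : dv (flat n) (fun x => flat n.+2 x - n%:R * flat n.+1 x).
Proof.
move=> x; have [x0|x0|->] := ltgtP x 0.
- have -> : flat n.+2 x - n%:R * flat n.+1 x = 0.
    by rewrite /flat ltNge (ltW x0)/= mulr0 subr0.
  apply: (@near_eq_is_derive _ _ _ (fun _ : R => 0 : R)).
  near=> y; have y0 : y < 0 by near: y; exact: lt_nbhsl.
  by rewrite /flat ltNge (ltW y0).
- apply: (@near_eq_is_derive _ _ _ (fun y => (y ^+ n)^-1 * expR (- y^-1))).
    near=> y; have y0 : 0 < y by near: y; exact: lt_nbhsr.
    by rewrite /flat y0.
  have xn0 : x != 0 by rewrite gt_eqF.
  have dX : is_derive x 1 (fun y => y ^+ n) (n%:R * x ^+ n.-1 * 1).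
    exact: (dvX n (@dv_id R)).
  have dI : is_derive x 1 (fun y => - y^-1) (- (- x ^- 2 *: 1)).
    by apply: is_deriveN; apply: is_deriveV.
  have dE : is_derive x 1 (fun y => expR (- y^-1)) (expR (- x^-1) * - (- x ^- 2 *: 1)).
    exact: is_derive1_comp.
  have dV : is_derive x 1 (fun y => (y ^+ n)^-1) (- (x ^+ n) ^- 2 *: (n%:R * x ^+ n.-1 * 1)).
    by apply: is_deriveV => //; rewrite expf_neq0.
  have E m : (x ^+ m)^-1 *: (expR (- x^-1) * - (- x ^- 2 *: 1)) +
      expR (- x^-1) *: (- (x ^+ m) ^- 2 *: (m%:R * x ^+ m.-1 * 1)) =
      flat m.+2 x - m%:R * flat m.+1 x.
    rewrite /flat x0 /GRing.scale/=; case: m => [|m].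
      by rewrite !expr0 /= !exprS expr0; field; rewrite ?xn0 ?expf_neq0.
    by rewrite /= !exprS; field; rewrite ?xn0 ?expf_neq0.
  by rewrite -E; exact: (is_deriveM dV dE).
- have -> : flat n.+2 0 - n%:R * flat n.+1 0 = 0 by rewrite /flat ltxx mulr0 subr0.
  have [C C0 HC] := flat_le n.
  have L : h^-1 *: (flat n (h *: 1 + 0) - flat n 0) @[h --> 0^'] --> (0 : R).
    apply: (@cvg0_le _ _ _ _ _ (fun h => C * `|h|)).
      near=> h; have h0 : h != 0 by near: h; exact: nbhs_dnbhs_neq.
      rewrite {2}/flat ltxx subr0 addr0 /GRing.scale/= mulr1 normrM normfV.
      rewrite ler_pdivrMl ?normr_gt0//; apply: le_trans (HC h) _.
      by rewrite expr2 mulrCA.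
    have : C * `|h| @[h --> (0 : R)^'] --> C * `|0 : R|.
      apply: cvgM; first exact: cvg_cst.
      by apply: cvg_norm; apply: cvg_within_filter; exact: cvg_id.
    by rewrite normr0 mulr0.
  apply: DeriveDef; first by apply/cvg_ex; exists 0.
  exact: cvg_lim L.
Unshelve. all: by end_near. Qed.

Inductive bumpy : (R -> R) -> Prop :=
| bumpy_l n : bumpy (flat n)
| bumpy_r n : bumpy (fun x => flat n (1 - x))
| bumpy_Z c f : bumpy f -> bumpy (fun x => c * f x)
| bumpy_D f g : bumpy f -> bumpy g -> bumpy (fun x => f x + g x)
| bumpy_M f g : bumpy f -> bumpy g -> bumpy (fun x => f x * g x).

Lemma bumpy_smooth f : bumpy f -> smooth f.
Proof.
apply: smooth_class => {}f; elim.
- move=> n; exists (fun x => flat n.+2 x + (- n%:R) * flat n.+1 x).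
    apply: bumpy_D; [exact: bumpy_l|apply: bumpy_Z; exact: bumpy_l].
  by apply: dv_eq (flat_dv n) _ => x; rewrite mulNr.
- move=> n; exists (fun x => -1 * flat n.+2 (1 - x) + n%:R * flat n.+1 (1 - x)).
    by apply: bumpy_D; apply: bumpy_Z; exact: bumpy_r.
  apply: dv_eq (dv_comp (flat_dv n) (dvB (dv_cst 1) (@dv_id R))) _ => x; ring.
- by move=> c g _ [g' bg dg]; exists (fun x => c * g' x); [exact: bumpy_Z|exact: dvZ].
- by move=> g h _ [g' bg dg] _ [h' bh dh]; exists (fun x => g' x + h' x);
    [exact: bumpy_D|exact: dvD].
- move=> g h Sg [g' bg dg] Sh [h' bh dh]; exists (fun x => g' x * h x + g x * h' x).
    by apply: bumpy_D; exact: bumpy_M.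
  exact: dvM.
Qed.

Lemma bump_exists : exists e : R -> R, [/\ test_function e, (forall x, 0 <= e x),
  (forall x, e x != 0 -> 0 < x < 1), itg e & intR e = 1].
Proof.
pose e0 x := flat 0 x * flat 0 (1 - x).
have se0 : smooth e0 by apply: bumpy_smooth; apply: bumpy_M; [exact: bumpy_l|exact: bumpy_r].
have f0 n x : 0 <= flat n x.
  rewrite /flat; case: ifPn => // x0.
  by rewrite mulr_ge0 ?expR_ge0 ?invr_ge0 ?exprn_ge0 ?ltW.
have ge0 x : 0 <= e0 x by rewrite mulr_ge0.
have supp x : e0 x != 0 -> 0 < x < 1.
  rewrite mulf_eq0 negb_or /flat subr_gt0.
  by case: ifPn; case: ifPn; rewrite ?eqxx ?andbF.
have ce0 : continuous e0 by exact: smooth_continuous 0%N se0.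
have ie0 : itg e0.
  apply: eq_itg (locint_itg 0 1 (continuous_locint ce0)) => x.
  rewrite patch_itv; case: ifPn => // H; apply/esym/eqP; apply: contraNT H => /supp.
  by move=> /andP[/ltW -> /ltW ->].
have pos : 0 < intR e0.
  rewrite lt_neqAle int_ge0// andbT; apply/negP => /eqP I0.
  have : e0 2^-1 = 0 by apply: int_eq0 => //; rewrite -I0.
  apply/eqP; rewrite /e0 /flat.
  have -> : 1 - 2^-1 = 2^-1 :> R by lra.
  by rewrite invr_gt0 ltr0n !expr0 invr1 !mul1r mulf_neq0// gt_eqF// expR_gt0.
exists (fun x => (intR e0)^-1 * e0 x); split.
- split; last first.
    exists 1 => x x1; apply/eqP; rewrite mulf_eq0; apply/orP; right.
    apply: contraTT x1 => /supp /andP[x0 x1]; rewrite -leNgt ger0_norm ltW//.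
  have := smooth_lin (c := - (intR e0)^-1) (bumpy_smooth (bumpy_Z 0 (bumpy_l 0))) se0.
  by congr smooth; apply/funext => x; rewrite mul0r sub0r mulNr opprK.
- by move=> x; rewrite mulr_ge0// invr_ge0 ltW.
- by move=> x; rewrite mulf_eq0 negb_or => /andP[_ /supp].
- exact: itgZ.
- by rewrite intZ// mulVf// gt_eqF.
Qed.
Lemma test_derive1 f : test_function f -> test_function (derive1 f).
Proof.
move=> [sf [M fM]]; split.
  by move=> n x; rewrite -derive1Sn; exact: sf.
exists M => x Mx.
have : is_derive x 1 f 0.
  apply: (@near_eq_is_derive _ _ _ (fun _ : R => 0 : R)).
  near=> y; rewrite /= fM//; near: y.
  by apply: (@cvgr_norm_gt _ _ _ _ _ id x) => //.
by move=> [_ <-]; rewrite derive1E.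
Unshelve. all: by end_near. Qed.

Lemma test_dv f : test_function f -> dv f (derive1 f).
Proof. by move=> [sf _]; exact: (smooth_dv 0 sf). Qed.

Lemma test_continuous f : test_function f -> continuous f.
Proof. by move=> tf; exact: dv_continuous (test_dv tf). Qed.

Lemma test_itg_mul g f : locint g -> test_function f -> itg (fun x => g x * f x).
Proof.
move=> lg tf; have [_ [M fM]] := tf.
apply: eq_itg (locint_itg (- M) M (locintM lg (test_continuous tf))) => x.
rewrite patch_itv -ler_norml; case: leP => // /fM ->.
by rewrite mulr0.
Qed.

Lemma test_int_mul g f M : locint g -> test_function f ->
  (forall x, M < `|x| -> f x = 0) ->
  intR (fun x => g x * f x) = itvint (fun x => f x * g x) (- M) M.
Proof.
move=> lg tf fM; rewrite itvintE; apply: eq_int => x.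
rewrite patch_itv -ler_norml mulrC; case: leP => // /fM ->.
by rewrite mul0r.
Qed.

(** The constant [c] is free because the derivative of a test function has integral 0; it becomes
    the constant of integration in [weak_primitive]. *)
Lemma test_prim_ibp g f c : locint g -> test_function f ->
  intR (fun x => (prim g x + c) * derive1 f x) = - intR (fun x => g x * f x).
Proof.
move=> lg tf; have [sf [M fM]] := tf.
have td := test_derive1 tf.
have [_ [M' fM']] := td.
pose N := Num.max 0 (Num.max M M') + 1.
have N0 : 0 < N by rewrite /N ltr_wpDl// le_max lexx.
have NM : M < N by rewrite /N ltr_pwDr// !le_max lexx orbT.
have NM' : M' < N by rewrite /N ltr_pwDr// !le_max lexx !orbT.
have fN x : N <= `|x| -> f x = 0 by move=> h; apply: fM; exact: lt_le_trans h.
have fN' x : N <= `|x| -> derive1 f x = 0 by move=> h; apply: fM'; exact: lt_le_trans h.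
have cp := prim_continuous lg.
have lG : locint (fun x => prim g x + c).
  by apply: continuous_locint => x; apply: cvgD; [exact: cp|exact: cvg_cst].
have lGp := continuous_locint cp.
have NN : - N <= N by lra.
rewrite (test_int_mul lG td (M := N)); last by move=> x /ltW; exact: fN'.
rewrite (test_int_mul lg tf (M := N)); last by move=> x /ltW; exact: fN.
have cd := test_continuous td.
rewrite (prim_ibp lg (test_dv tf) cd NN) !fN ?normrN ?gtr0_norm//.
rewrite !mul0r subrr sub0r opprK.
have -> : itvint (fun x => derive1 f x * (prim g x + c)) (- N) N =
    itvint (fun x => derive1 f x * prim g x - (- c) * derive1 f x) (- N) N.
  by apply: eq_itvint => x _; ring.
have l1 : locint (fun x => derive1 f x * prim g x).
  by apply: continuous_locint => x; apply: cvgM; [exact: cd|exact: cp].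
have l2 := continuous_locint cd.
rewrite itvintB//; last exact: locintZ.
rewrite itvintZ// (itvint_dv NN (test_dv tf) cd) !fN ?normrN ?gtr0_norm//.
by rewrite subrr mulr0 subr0.
Qed.

Lemma test_antiderivative f : test_function f -> intR f = 0 ->
  exists2 F, test_function F & derive1 F = f.
Proof.
move=> tf f0; have [sf [M fM]] := tf.
have cf := test_continuous tf; have lf := continuous_locint cf.
pose N := Num.max 0 M + 1.
have N0 : 0 < N by rewrite /N ltr_wpDl// le_max lexx.
have NM : M < N by rewrite /N ltr_pwDr// !le_max lexx orbT.
have fN x : N <= `|x| -> f x = 0 by move=> h; apply: fM; exact: lt_le_trans h.
pose F x := prim f x - prim f (- N).
have dF : dv F f.
  by apply: dv_eq (dvB (prim_dv cf) (dv_cst (prim f (- N)))) _ => x; rewrite subr0.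
exists F; last exact: dv_derive1.
split; first exact: smooth_of_dv dF sf.
exists N => x Nx; rewrite /F.
have [x0|x0] := leP 0 x.
  rewrite prim_diff//; last by rewrite (le_trans _ x0)// oppr_le0 ltW.
  rewrite -f0 itvintE; apply: eq_int => y; rewrite patch_itv; case: ifPn => // h.
  apply/esym/fN; rewrite leNgt ltr_norml; apply: contra h => /andP[/ltW -> yN] /=.
  by rewrite (ltW (lt_trans yN _))//; rewrite ger0_norm in Nx.
have xN : x <= - N by move: Nx; rewrite ltr0_norm//; lra.
apply/eqP; rewrite -oppr_eq0 opprB prim_diff// itvint_cst0// => y.
rewrite in_itv/= => /andP[_ yN]; apply: fN.
rewrite ler0_norm; lra.
Qed.

(** Let [e] be a test function of integral 1. Then f minus its integral times [e] has integral 0,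
    hence is the derivative of a test function, and T kills it. *)
Lemma test_linear_functional (T : (R -> R) -> R) :
  (forall f g c, test_function f -> test_function g ->
     T (fun x => f x - c * g x) = T f - c * T g) ->
  (forall f, test_function f -> T (derive1 f) = 0) ->
  exists c, forall f, test_function f -> T f = c * intR f.
Proof.
move=> Tlin T0; have [e [te e0 se ie e1]] := bump_exists.
exists (T e) => f tf.
have it : itg f.
  have l1 : locint (fun _ : R => 1 : R) by apply: continuous_locint => x; exact: cvg_cst.
  by apply: eq_itg (test_itg_mul l1 tf) => x; rewrite mul1r.
have I0 : intR (fun x => f x - intR f * e x) = 0.
  by rewrite intB//; [rewrite intZ// e1 mulr1 subrr|exact: itgZ].
have [F tF dF] := test_antiderivative (test_lin (intR f) tf te) I0.
have := T0 _ tF; rewrite dF Tlin// => /eqP; rewrite subr_eq0 => /eqP ->.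
by rewrite mulrC.
Qed.

(** Lowers the order of a weak derivative by one. The difference [T] of the two sides without
    constant vanishes on derivatives of test functions, so it is a multiple of the integral, and
    this multiple is, up to sign, the constant of integration. *)
Lemma weak_primitive n v g : locint v -> locint g ->
  (forall f, test_function f ->
     intR (fun x => v x * derive1n n.+1 f x) = (-1) ^+ n.+1 * intR (fun x => g x * f x)) ->
  exists c, forall f, test_function f ->
     intR (fun x => v x * derive1n n f x) = (-1) ^+ n * intR (fun x => (prim g x + c) * f x).
Proof.
move=> lv lg vg.
have cp := prim_continuous lg; have lgN := continuous_locint cp.
have tdn f : test_function f -> test_function (derive1n n f).
  by move=> tf; elim: n {vg} => [//|m IH]; rewrite derive1nS; exact: test_derive1.
pose T f := intR (fun x => v x * derive1n n f x) - (-1) ^+ n * intR (fun x => prim g x * f x).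
have [||c Tc] := @test_linear_functional T.
- move=> f h c tf th; rewrite /T.
  have [sf _] := tf; have [sh _] := th.
  have -> : intR (fun x => v x * derive1n n (fun x => f x - c * h x) x) =
     intR (fun x => v x * derive1n n f x) - c * intR (fun x => v x * derive1n n h x).
    rewrite -intZ; last exact: test_itg_mul (tdn _ th).
    rewrite -intB; last 2 first.
    - exact: test_itg_mul (tdn _ tf).
    - exact/itgZ/(test_itg_mul lv (tdn _ th)).
    by apply: eq_int => x; rewrite derive1n_lin//; ring.
  have -> : intR (fun x => prim g x * (f x - c * h x)) =
     intR (fun x => prim g x * f x) - c * intR (fun x => prim g x * h x).
    rewrite -intZ; last exact: test_itg_mul.
    rewrite -intB; last 2 first.
    - exact: test_itg_mul.
    - exact/itgZ/(test_itg_mul lgN th).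
    by apply: eq_int => x; ring.
  ring.
- move=> f tf; rewrite /T -derive1Sn vg//.
  have := test_prim_ibp 0 lg tf; under eq_int do rewrite addr0.
  by move=> ->; rewrite exprS; ring.
exists ((-1) ^+ n * c) => f tf.
have := Tc f tf; rewrite /T => /eqP; rewrite subr_eq => /eqP ->.
have l1 : locint (fun _ : R => (-1) ^+ n * c) by apply: continuous_locint => x; exact: cvg_cst.
transitivity ((-1) ^+ n * (intR (fun x => prim g x * f x) + intR (fun x => (-1) ^+ n * c * f x))).
  rewrite mulrDr addrC; congr (_ + _).
  rewrite intZ; last first.
    have l2 : locint (fun _ : R => 1 : R) by apply: continuous_locint => x; exact: cvg_cst.
    by apply: eq_itg (test_itg_mul l2 tf) => x; rewrite mul1r.
  by rewrite !mulrA -expr2 sqrr_sign mul1r.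
rewrite -intD; [|exact: test_itg_mul|exact: test_itg_mul].
by congr (_ * _); apply: eq_int => x; rewrite mulrDl.
Qed.

(** * The fundamental lemma of the calculus of variations *)

Lemma ae_neq c : {ae mu, forall x, x != c}.
Proof.
exists [set c]; split => //=.
- by rewrite lebesgue_measure_set1.
- by move=> x /= /negP; rewrite negbK => /eqP.
Qed.

(** Lebesgue differentiation for the truncation of w to each [-n, n]: its primitive from -oo is
    identically 0, and so is its density almost everywhere. *)
Lemma ae_of_prim0 w : locint w -> (forall a b, a <= b -> itvint w a b = 0) ->
  {ae mu, forall x, w x = 0}.
Proof.
move=> [mw lw] w0.
have H (n : nat) : {ae mu, forall x, - n%:R < x < n%:R -> w x = 0}.
  pose wn := w \_ `[- n%:R, n%:R].
  have iwn : itg wn := locint_itg (- n%:R) n%:R (conj mw lw).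
  have iy y : mu.-integrable `]-oo, y] (EFin \o wn).
    by move: iwn; rewrite itgE; exact: integrableS.
  have lwn : locally_integrable setT wn.
    by apply: open_integrable_locally; [exact: openT|rewrite -itgE].
  pose F y := \int[mu]_(t in `]-oo, y]) wn t.
  have F0 y : F y = 0.
    rewrite /F Rintegral_mkcond -intE.
    transitivity (itvint w (- n%:R) (Num.min y n%:R)).
      rewrite itvintE; apply: eq_int => x.
      have -> : (wn \_ `]-oo, y]) x = if x <= y then wn x else 0.
        rewrite patchE; case: ifPn => [/set_mem|/negP h]; rewrite /mkset ?in_itv/=.
          by move=> ->.
        case: ifPn => // xy; case: h; apply/mem_set.
        by rewrite /mkset in_itv/=.
      rewrite !patch_itv le_min; case: (leP x y) => _ /=; last by rewrite andbF.
      by rewrite /wn patch_itv.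
    case: (leP (- n%:R) (Num.min y n%:R)) => h; first exact: w0.
    by rewrite /itvint set_itv_ge ?Rintegral_set0// bnd_simp -ltNge.
  have HF : {ae mu, forall x, derivable F x 1 /\ derive1 F x = wn x} := FTC1Ny iy lwn.
  apply: ae_imp HF => x [_ Hx] /andP[x1 x2].
  have -> : w x = wn x by rewrite /wn patch_itv !ltW.
  rewrite -Hx; have -> : F = cst 0 by apply/funext => y; rewrite F0.
  by rewrite derive1_cst.
have := ae_foralln H.
apply: ae_imp => x Hx.
apply: (Hx (Num.truncn `|x|).+1).
by rewrite -ltr_norml truncnS_gt.
Qed.

(** The indicator of [a, b] is a bounded pointwise limit, outside the two endpoints, of differences
    of smooth steps: [S], the primitive of a normalized bump, rises from 0 to 1 on [0, 1]. Dominated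
    convergence gives integral 0 over every interval. *)
Lemma test_fundamental w : locint w ->
  (forall f, test_function f -> intR (fun x => w x * f x) = 0) ->
  {ae mu, forall x, w x = 0}.
Proof.
move=> lw w0; apply: ae_of_prim0 => // a b ab.
have [e [te e0 se ie e1]] := bump_exists.
have [[see _] ce] := (te, test_continuous te).
have lce := continuous_locint ce.
pose S x := prim e x.
have dS : dv S e by exact: prim_dv.
have sS : smooth S by exact: smooth_of_dv dS see.
have eN x : x <= 0 -> e x = 0.
  by move=> x0; apply/eqP; apply: contraTT x0 => /se /andP[x0 _]; rewrite -ltNge.
have eP x : 1 <= x -> e x = 0.
  by move=> x0; apply/eqP; apply: contraTT x0 => /se /andP[_ x0]; rewrite -ltNge.
have S0 x : x <= 0 -> S x = 0.
  move=> x0; rewrite /S /prim; case: (leP 0 x) => h.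
    have -> : x = 0 by apply/le_anti; rewrite x0 h.
    exact: itvint_point.
  apply/eqP; rewrite oppr_eq0 itvint_cst0// => y; rewrite in_itv/= => /andP[_]; exact: eN.
have S1 x : 1 <= x -> S x = 1.
  move=> x1; rewrite /S /prim (le_trans _ x1)// -e1 itvintE; apply: eq_int => y.
  rewrite patch_itv; case: ifPn => // h; apply/esym.
  case: (leP y 0) => y0; first exact: eN.
  by apply: eP; move: h; rewrite (ltW y0)/= -ltNge => /ltW; exact: le_trans.
have Sb x : `|S x| <= 1.
  case: (leP x 0) => x0; first by rewrite S0// normr0.
  rewrite /S /prim (ltW x0) itvintE -e1; apply: le_trans (int_norm _) _.
    exact: locint_itg.
  apply: int_le => //; first exact/itg_norm/locint_itg.
  by move=> y; rewrite patch_itv; case: ifPn => _; rewrite ?normr0// ger0_norm.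
(* Rises to the right of a and falls to the right of b, both within 1 / n; for n >= 1 it vanishes
   outside [a, b + 1], whence the dominating function. *)
pose phi n x := S (n%:R * x + - (n%:R * a)) - 1 * S (n%:R * x + - (n%:R * b)).
have phi0 n x : x <= a \/ b + 1 <= x -> (0 < n)%N -> phi n x = 0.
  move=> H n0; have n1 : 1 <= n%:R :> R by rewrite ler1n.
  rewrite /phi mul1r -!mulrBr; case: H => h.
    rewrite !S0 ?subrr// mulr_ge0_le0 ?subr_le0// (le_trans h)//.
  rewrite !S1 ?subrr//.
    by apply: (@le_trans _ _ (n%:R * 1)); [rewrite mulr1|rewrite ler_wpM2l//; lra].
  by apply: (@le_trans _ _ (n%:R * 1)); [rewrite mulr1|rewrite ler_wpM2l//; lra].
have tphi n : (0 < n)%N -> test_function (phi n).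
  move=> n0; split; first by apply: smooth_lin; exact: smooth_affine.
  exists (`|a| + `|b| + 1) => x Hx; apply: phi0 => //.
  have := ler_norm a; have := ler_norm (- a); have := ler_norm b; have := ler_norm (- b).
  rewrite !normrN; move: Hx; case: (ger0P x) => _; [right|left]; lra.
have L : intR (fun x => w x * phi n.+1 x) @[n --> \oo] --> intR (w \_ `[a, b]).
  apply: (int_dct (g := fun x => 2 * `|(w \_ `[a, (b + 1)]) x|)).
  - by move=> n; apply: itg_measurable; exact: test_itg_mul (tphi _ _).
  - by apply: itg_measurable; exact: locint_itg.
  - apply: ae_imp2 (ae_neq a) (ae_neq b) => x xa xb; apply: cvg_near_cst.
    have conv (d : R) : 0 < d -> \forall n \near \oo, 1 <= n.+1%:R * d.
      move=> d0; near=> n.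
      rewrite -ler_pdivrMr// div1r (@le_trans _ _ n%:R) ?ler_nat//.
      by near: n; exact: nbhs_infty_ger.
    have [ax|xa'] := ltP a x; last first.
      near=> n; rewrite phi0 ?mulr0//; last by left.
      by rewrite patch_itv leNgt lt_neqAle xa xa'.
    have [bx|xb'] := ltP b x.
      near=> n; rewrite patch_itv [x <= b]leNgt bx andbF /phi mul1r -!mulrBr !S1 ?subrr ?mulr0//.
        by near: n; apply: conv; lra.
      by near: n; apply: conv; lra.
    near=> n; rewrite patch_itv (ltW ax) xb' /phi mul1r -!mulrBr S1 ?S0 ?subr0 ?mulr1//.
      by rewrite mulr_ge0_le0// subr_le0.
    by near: n; apply: conv; lra.
  - by apply/itgZ/itg_norm/locint_itg.
  - move=> n x; rewrite patch_itv normrM mulrC.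
    case: ifPn => [_|].
      rewrite ler_wpM2r// /phi mul1r; apply: le_trans (ler_normB _ _) _.
      have := Sb (n.+1%:R * x + - (n.+1%:R * a)); have := Sb (n.+1%:R * x + - (n.+1%:R * b)); lra.
    rewrite negb_and -!ltNge => /orP h; rewrite phi0// ?normr0 ?mul0r ?mulr0//.
    by case: h => /ltW; [left|right].
rewrite itvintE; apply: (cvg_unique (@Rhausdorff R) L).
rewrite (_ : (fun n : nat => _) = fun=> 0); first exact: cvg_cst.
by apply/funext => n; apply: w0; exact: tphi.
Unshelve. all: by end_near. Qed.

Lemma test_eq_ae v w : locint v -> locint w ->
  (forall f, test_function f -> intR (fun x => v x * f x) = intR (fun x => w x * f x)) ->
  {ae mu, forall x, v x = w x}.
Proof.
move=> lv lw H; have := test_fundamental (locintB lv lw).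
move=> /(_ _)/ae_imp; apply => [x /eqP|f tf]; first by rewrite subr_eq0 => /eqP.
under eq_int do rewrite mulrBl.
by rewrite intB ?H ?subrr//; exact: test_itg_mul.
Qed.

(** * Classical derivatives of weak solutions *)

Lemma prim_cst_dv g c : continuous g -> dv (fun x => prim g x + c) g.
Proof.
by move=> cg; apply: dv_eq (dvD (prim_dv cg) (dv_cst c)) _ => x; rewrite addr0.
Qed.

Lemma prim_cst_continuous g c : locint g -> continuous (fun x => prim g x + c).
Proof. by move=> lg x; apply: cvgD; [exact: prim_continuous|exact: cvg_cst]. Qed.

(** Two applications of [weak_primitive], then the fundamental lemma. As v is determined almost
    everywhere only, a representative [v0] appears; for the continuous u of
    [weak_derivative3_regular] the equality holds everywhere. *)
Lemma weak_derivative2_regular v g : weak_derivative 2 v g ->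
  exists v0 v1 c, [/\ {ae mu, forall x, v x = v0 x}, dv v0 v1, locint g &
    v1 = fun x => prim g x + c].
Proof.
move=> [/locally_integrable_locint lv /locally_integrable_locint lg H].
have [c Hc] := weak_primitive lv lg H.
have cc := prim_cst_continuous (c := c) lg.
have [c' Hc'] := weak_primitive lv (continuous_locint cc) Hc.
have cc' := prim_cst_continuous (c := c') (continuous_locint cc).
exists (fun x => prim (fun x => prim g x + c) x + c'), (fun x => prim g x + c), c.
split => //; last exact: prim_cst_dv.
apply: test_eq_ae => //; first exact: continuous_locint.
by move=> f tf; rewrite -[LHS]/(intR (fun x => v x * derive1n 0 f x)) Hc'// expr0 mul1r.
Qed.

Lemma weak_derivative3_regular u g : continuous u -> weak_derivative 3 u g ->
  exists u1 u2 c, [/\ dv u u1, dv u1 u2, locint g & u2 = fun x => prim g x + c].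
Proof.
move=> cu [/locally_integrable_locint lu /locally_integrable_locint lg H].
have [c Hc] := weak_primitive lu lg H.
have cc := prim_cst_continuous (c := c) lg.
have [c' Hc'] := weak_primitive lu (continuous_locint cc) Hc.
have cc' := prim_cst_continuous (c := c') (continuous_locint cc).
have [d Hd] := weak_primitive lu (continuous_locint cc') Hc'.
have cd := prim_cst_continuous (c := d) (continuous_locint cc').
set u2 := fun x => prim g x + c in cc Hc' cc' Hd cd.
set u1 := fun x => prim u2 x + c' in cc' Hd cd.
exists u1, u2, c; split => //; last exact: prim_cst_dv.
have -> : u = fun x => prim u1 x + d.
  have E : {ae mu, forall x, u x = prim u1 x + d}.
    apply: test_eq_ae => //; first exact: continuous_locint.
    by move=> f tf; rewrite -[LHS]/(intR (fun x => u x * derive1n 0 f x)) Hd// expr0 mul1r.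
  apply/funext => x; apply/eqP; rewrite -subr_eq0; apply/eqP.
  apply: (@ae_continuous0 _ (fun x => u x - (prim u1 x + d))).
    by move=> y; apply: cvgB; [exact: cu|exact: cd].
  by apply: ae_imp E => y ->; rewrite subrr.
exact: prim_cst_dv.
Qed.
Lemma dv_prim F f : dv F f -> continuous f -> F = fun x => prim f x + F 0.
Proof.
move=> dF cf; apply/funext => x; rewrite /prim; case: leP => x0.
  by rewrite (itvint_dv x0 dF cf) subrK.
by rewrite (itvint_dv (ltW x0) dF cf) opprB subrK.
Qed.

Lemma dv_of_itvint F f : continuous f ->
  (forall a b, a <= b -> F b - F a = itvint f a b) -> dv F f.
Proof.
move=> cf H; have -> : F = fun x => prim f x + F 0; last exact: prim_cst_dv.
apply/funext => x; rewrite /prim; case: leP => x0.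
  by rewrite -H// subrK.
by rewrite -(H _ _ (ltW x0)) opprB subrK.
Qed.

Lemma weak_derivative1_ae u u1 ux : dv u u1 -> continuous u1 ->
  weak_derivative 1 u ux -> {ae mu, forall x, ux x = u1 x}.
Proof.
move=> du cu1 [_ /locally_integrable_locint lux H].
have lu1 := continuous_locint cu1.
apply: test_eq_ae => // f tf; apply: oppr_inj.
rewrite -(test_prim_ibp (u 0) lu1 tf).
have := H f tf; rewrite expr1 mulN1r => <-.
by rewrite [in LHS](dv_prim du cu1) intE.
Qed.

Lemma itvint_ae f g a b : locint f -> locint g -> {ae mu, forall x, f x = g x} ->
  itvint f a b = itvint g a b.
Proof.
move=> lf lg fg; rewrite !itvintE.
apply: (proj2 (eq_int_ae (locint_itg a b lf) (itg_measurable (locint_itg a b lg)) _)).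
by apply: ae_imp fg => x E; rewrite !patch_itv E.
Qed.

(** For [k = 1] the truncated exponent [k.-2] is harmless, since its coefficient contains [k.-1%:R],
    which is 0. *)
Definition flux k u u1 u2 x : R :=
  3 * k%:R * u x ^+ k.-1 * u1 x * u2 x + k%:R * k.-1%:R * u x ^+ k.-2 * u1 x ^+ 3.

(* Here [f] and [f1] are the continuous versions of u_t and u_tx. The combination
   h = u_t + u^k u_x is smoother than each of its terms: it has a second derivative,
   and the equation becomes h'' = h + flux. *)
Lemma equation_regular k u ut ux uxxx utxx : continuous u ->
  weak_derivative 1 u ux -> weak_derivative 3 u uxxx -> weak_derivative 2 ut utxx ->
  {ae mu, forall x, ut x - utxx x + u x ^+ k * ux x - u x ^+ k * uxxx x = 0} ->
  exists u1 u2 f f1, [/\ dv u u1, dv u1 u2, continuous u2,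
    {ae mu, forall x, ut x = f x} & dv f f1 /\ continuous f1 /\
    dv (fun x => f1 x + (k%:R * u x ^+ k.-1 * u1 x * u1 x + u x ^+ k * u2 x))
       (fun x => f x + u x ^+ k * u1 x + flux k u u1 u2 x)].
Proof.
move=> cu w1 w3 w2 eqn.
have [u1 [u2 [c [du du1 lg u2E]]]] := weak_derivative3_regular cu w3.
have [f [f1 [d [utf df lh f1E]]]] := weak_derivative2_regular w2.
have cu2 : continuous u2 by rewrite u2E; exact: prim_cst_continuous.
have cf1 : continuous f1 by rewrite f1E; exact: prim_cst_continuous.
have cu1 := dv_continuous du1; have cf := dv_continuous df.
have uxu1 := weak_derivative1_ae du cu1 w1.
exists u1, u2, f, f1; split => //; split => //; split => //.
have duk := dvX k du.
have cuk := dv_continuous duk.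
have duk1 := dvX k.-1 du.
have cuk1 := dv_continuous duk1.
have cduk : continuous (fun x => k%:R * u x ^+ k.-1 * u1 x).
  by move=> x; apply: cvgM; [apply: cvgM; [exact: cvg_cst|exact: cuk1]|exact: cu1].
pose G x := f x + u x ^+ k * u1 x + k%:R * u x ^+ k.-1 * u1 x * u2 x.
have cG : continuous G.
  move=> x; apply: cvgD; first (apply: cvgD; first exact: cf).
    by apply: cvgM; [exact: cuk|exact: cu1].
  by apply: cvgM; [exact: cduk|exact: cu2].
(* Integrated over [a, b], the equation expresses the increment of u_tx through the integral of u^k
   u_xxx. Integration by parts replaces u_xxx by its primitive u_xx, and the increment of f1 + u^k
   u2 becomes the integral of the continuous [G]. *)
have dF : dv (fun x => f1 x + u x ^+ k * u2 x) G.
  apply: dv_of_itvint => // a b ab.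
  have E1 : f1 b - f1 a = itvint utxx a b.
    by rewrite f1E -prim_diff//; ring.
  have lv : locint (fun x => u x ^+ k * uxxx x).
    by under eq_fun do rewrite mulrC; exact: locintM.
  have c1 : continuous (fun x => f x + u x ^+ k * u1 x).
    move=> x; apply: cvgD; first exact: cf.
    by apply: cvgM; [exact: cuk|exact: cu1].
  have E2 : itvint utxx a b = itvint (fun x => f x + u x ^+ k * u1 x) a b -
      itvint (fun x => u x ^+ k * uxxx x) a b.
    rewrite -itvintB//; last exact: continuous_locint.
    apply: itvint_ae => //; first by apply: locintB => //; exact: continuous_locint.
    have J := ae_imp2 (fun x p q => conj p q) eqn utf.
    apply: (ae_imp2 _ J uxu1) => x [e1 e2] e3.
    rewrite -e2 -e3; lra.
  have E3 := prim_ibp lg duk cduk ab.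
  have l1 : locint (fun x => k%:R * u x ^+ k.-1 * u1 x * u2 x).
    by apply: continuous_locint => x; apply: cvgM; [exact: cduk|exact: cu2].
  have E4 : itvint (fun x => k%:R * u x ^+ k.-1 * u1 x * prim uxxx x) a b =
      itvint (fun x => k%:R * u x ^+ k.-1 * u1 x * u2 x) a b - c * (u b ^+ k - u a ^+ k).
    rewrite -(itvint_dv ab duk cduk) -itvintZ; last exact: continuous_locint.
    rewrite -itvintB//; last exact/locintZ/continuous_locint.
    by apply: eq_itvint => x _; rewrite u2E; ring.
  have E5 : itvint G a b = itvint (fun x => f x + u x ^+ k * u1 x) a b +
      itvint (fun x => k%:R * u x ^+ k.-1 * u1 x * u2 x) a b.
    rewrite /itvint -RintegralD//; [exact: (continuous_locint c1).2|exact: l1.2].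
  rewrite E5; have -> : f1 b + u b ^+ k * u2 b - (f1 a + u a ^+ k * u2 a) =
    (f1 b - f1 a) + (u b ^+ k * u2 b - u a ^+ k * u2 a) by ring.
  rewrite E1 E2 E3 E4 u2E; ring.
(* The remaining summand of h', which is C^1 by itself. *)
have dB : dv (fun x => k%:R * u x ^+ k.-1 * u1 x * u1 x)
   (fun x => k%:R * (k.-1%:R * u x ^+ k.-2 * u1 x) * u1 x * u1 x +
     2 * (k%:R * u x ^+ k.-1 * u1 x * u2 x)).
  by apply: dv_eq (dvM (dvM (dvZ k%:R duk1) du1) du1) _ => x /=; ring.
have := dvD dF dB; rewrite (_ : (fun x => f1 x + u x ^+ k * u2 x + _) =
  fun x => f1 x + (k%:R * u x ^+ k.-1 * u1 x * u1 x + u x ^+ k * u2 x)); last first.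
  by apply/funext => x; ring.
by move/dv_eq; apply => x; rewrite /G /flux; ring.
Qed.

End Primitive.

(** * Sobolev norms and classical derivatives *)

Section SobolevL2.
Variable R : realType.
Implicit Types (f g F : R -> R) (h x y xi : R).
Local Notation mu := (@lebesgue_measure R).

Lemma itg_shift f (h : R) : itg f -> itg (fun x => f (x + h)).
Proof.
move=> ff; apply: eq_itg (itg_affine h (@ltr01 R) ff) => x.
by rewrite mul1r.
Qed.

Lemma int_shift f (h : R) : itg f -> intR (fun x => f (x + h)) = intR f.
Proof.
move=> ff; rewrite -[RHS]mul1r -[in RHS]invr1 -(int_affine h (@ltr01 R) ff).
by apply: eq_int => x; rewrite mul1r.
Qed.

Definition diff_op (al be ga h : R) f x : R := al * f (x + h) + be * f x + ga * f (x - h).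

Lemma itg_diff_op al be ga h f : itg f -> itg (diff_op al be ga h f).
Proof.
move=> ff; apply: itgD; last exact: itgZ (itg_shift (- h) ff).
by apply: itgD; [exact: itgZ (itg_shift h ff)|exact: itgZ].
Qed.

Lemma int_diff_op al be ga h f (p : R -> R) : itg f -> measurable_fun setT p ->
  (forall x, `|p x| <= 1) ->
  intR (fun x => diff_op al be ga h f x * p x) =
  intR (fun x => f x * (al * p (x - h) + be * p x + ga * p (x + h))).
Proof.
move=> ff mp p1.
have ip (d : R) : itg (fun x => f x * p (x + d)).
  apply: (itgM_bdd (c := 1) ff _ (fun x => p1 (x + d))).
  by apply: measurableT_comp => //; exact: measurable_funD.
have i0 : itg (fun x => f x * p x) by exact: (itgM_bdd (c := 1) ff mp p1).
have sh (d : R) : itg (fun x => f (x + d) * p x) /\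
    intR (fun x => f (x + d) * p x) = intR (fun x => f x * p (x - d)).
  split.
    by apply: eq_itg (itg_shift d (ip (- d))) => x; rewrite addrK.
  by rewrite -(int_shift d (ip (- d))); apply: eq_int => x; rewrite addrK.
have [j1 e1] := sh h; have [j2 e2] := sh (- h).
transitivity (intR (fun x => al * (f (x + h) * p x) + be * (f x * p x) +
    ga * (f (x - h) * p x))).
  by apply: eq_int => x; rewrite /diff_op; ring.
rewrite (intD (itgD (itgZ al j1) (itgZ be i0)) (itgZ ga j2)).
rewrite (intD (itgZ al j1) (itgZ be i0)) (intZ al j1) (intZ be i0) (intZ ga j2).
rewrite e1 e2 -(intZ al (ip (- h))) -(intZ be i0) -(intZ ga (ip (- - h))).
rewrite -(intD (itgZ al (ip (- h))) (itgZ be i0)).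
rewrite -(intD (itgD (itgZ al (ip (- h))) (itgZ be i0)) (itgZ ga (ip (- - h)))).
by apply: eq_int => x; rewrite opprK; ring.
Qed.

(** [symb_re] + i [symb_im] is the Fourier multiplier al e^(i h xi) + be + ga e^(- i h xi) of
    [diff_op]. *)
Definition symb_re (al be ga h xi : R) : R := be + (al + ga) * cos (h * xi).
Definition symb_im (al ga h xi : R) : R := (al - ga) * sin (h * xi).

Lemma cosT_diff_op al be ga h f xi : itg f ->
  cosT (diff_op al be ga h f) xi =
  symb_re al be ga h xi * cosT f xi + symb_im al ga h xi * sinT f xi.
Proof.
move=> ff; rewrite /cosT int_diff_op//; last 2 first.
- exact: cont_measurable (@cont_cosMr R xi).
- by move=> x; exact: cos_max.
rewrite -(intZ _ (itg_cos xi ff)) -(intZ _ (itg_sin xi ff)).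
rewrite -(intD (itgZ _ (itg_cos xi ff)) (itgZ _ (itg_sin xi ff))).
apply: eq_int => x; rewrite mulrBl mulrDl cosB cosD /symb_re /symb_im; ring.
Qed.

Lemma sinT_diff_op al be ga h f xi : itg f ->
  sinT (diff_op al be ga h f) xi =
  symb_re al be ga h xi * sinT f xi - symb_im al ga h xi * cosT f xi.
Proof.
move=> ff; rewrite /sinT int_diff_op//; last 2 first.
- exact: cont_measurable (@cont_sinMr R xi).
- by move=> x; exact: sin_max.
rewrite -(intZ _ (itg_cos xi ff)) -(intZ _ (itg_sin xi ff)).
rewrite -(intB (itgZ _ (itg_sin xi ff)) (itgZ _ (itg_cos xi ff))).
apply: eq_int => x; rewrite mulrBl mulrDl sinB sinD /symb_re /symb_im; ring.
Qed.

Lemma L2norm_sqr f : measurable_fun setT f ->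
  (\int[mu]_x (f x ^+ 2)%:E = L2norm f * L2norm f)%E.
Proof.
move=> mf; have N0 : (0 <= L2norm f)%E := Lnorm_ge0 mu 2%:E (EFin \o f).
have p2 (y : R) : 0 <= y -> y `^ 2 = y ^+ 2 by move=> y0; rewrite -powR_mulrn.
have H : (L2norm f `^ 2 = \int[mu]_x `|(EFin \o f) x| `^ 2)%E.
  by rewrite /L2norm powR_Lnorm// pnatr_eq0.
transitivity (L2norm f `^ 2)%E.
  rewrite H; apply: eq_integral => x _ /=.
  by rewrite p2// real_normK// num_real.
case: (L2norm f) N0 => [r| |//] r0.
  by rewrite poweR_EFin p2// expr2 EFinM.
by rewrite poweRyr ?pnatr_eq0.
Qed.

Lemma L2norm_lty f : measurable_fun setT f -> (L2norm f < +oo)%E ->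
  itg (fun x => f x ^+ 2) /\ intR (fun x => f x ^+ 2) = fine (L2norm f) ^+ 2.
Proof.
move=> mf foo; have N0 : (0 <= L2norm f)%E by exact: Lnorm_ge0.
have Nf : L2norm f \is a fin_num by rewrite ge0_fin_numE.
have H := L2norm_sqr mf.
have i2 : itg (fun x => f x ^+ 2).
  apply: (@itg_bound _ _ (fine (L2norm f) ^+ 2)).
    exact: measurable_funX.
  under eq_integral do rewrite ger0_norm ?sqr_ge0//.
  by rewrite H expr2 EFinM fineK.
by split => //; apply: EFin_inj; rewrite int_EFin// H expr2 EFinM fineK.
Qed.

Lemma sin_norm_le x : `|sin x| <= `|x|.
Proof.
have [->|x0] := eqVneq x 0; first by rewrite sin0.
have dsin : dv (@sin R) (@cos R) by move=> y; exact: is_derive_sin.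
have H (a : R) : 0 < a -> `|sin a| <= a.
  move=> a0.
  have [] := @MVT R sin cos 0 a a0 (fun y _ => dsin y).
    exact/continuous_subspaceT/continuous_sin.
  move=> c _; rewrite sin0 !subr0 => ->; rewrite normrM [`|a|]gtr0_norm//.
  by rewrite ler_piMl ?cos_max// ltW.
case: (ltgtP x 0) x0 => // x0 _.
  by rewrite -normrN -sinN -[`|x|]normrN [leRHS]gtr0_norm ?oppr_gt0// H// oppr_gt0.
by rewrite [leRHS]gtr0_norm// H.
Qed.

Lemma one_sub_cos x : 2 - 2 * cos x = (2 * sin (x / 2)) ^+ 2.
Proof.
have {1}-> : x = x / 2 + x / 2 by lra.
rewrite cosD; have := cos2Dsin2 (x / 2); nra.
Qed.

(** * L^2 bounds for differences through truncated transforms *)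

Definition trunc (n : nat) f : R -> R := f \_ `[- n%:R, n%:R].

Lemma trunc_near f x : \forall n \near \oo, trunc n f x = f x.
Proof.
near=> n; rewrite /trunc patchE mem_set//= in_itv/= -ler_norml.
by near: n; exact: nbhs_infty_ger.
Unshelve. all: by end_near. Qed.

Lemma fourier_re_trunc f g (n : nat) xi : measurable_fun setT f ->
  {ae mu, forall x, f x = g x} -> continuous g ->
  fourier_re f n%:R xi = cosT (trunc n g) xi.
Proof.
move=> mf fg cg; rewrite /cosT.
have itr : itg (trunc n g) by apply: itg_restrict => //; exact: continuous_itv_itg.
rewrite /fourier_re Rintegral_mkcond -intE.
apply: esym; apply: (proj2 (eq_int_ae (itg_cos xi itr) _ _)).
- apply/(measurable_restrictT _ _).1 => //; apply: measurable_funTS.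
  by apply: measurable_funM => //; exact: cont_measurable (@cont_cosMr R xi).
- apply: ae_imp fg => x fgx; rewrite /trunc !patchE fgx.
  by case: ifPn => //; rewrite mul0r.
Qed.

Lemma fourier_im_trunc f g (n : nat) xi : measurable_fun setT f ->
  {ae mu, forall x, f x = g x} -> continuous g ->
  fourier_im f n%:R xi = - sinT (trunc n g) xi.
Proof.
move=> mf fg cg; rewrite /sinT.
have itr : itg (trunc n g) by apply: itg_restrict => //; exact: continuous_itv_itg.
rewrite /fourier_im Rintegral_mkcond -intE -(intN (itg_sin xi itr)).
apply: esym; apply: (proj2 (eq_int_ae (itgN (itg_sin xi itr)) _ _)).
- apply/(measurable_restrictT _ _).1 => //; apply: measurable_funTS.
  apply: measurableT_comp => //.
  by apply: measurable_funM => //; exact: cont_measurable (@cont_sinMr R xi).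
- apply: ae_imp fg => x fgx; rewrite /trunc !patchE fgx.
  by case: ifPn => //; rewrite mul0r oppr0.
Qed.

Lemma near_lt_ereal {T : Type} (F : set_system T) {FF : Filter F}
  (u : T -> \bar R) e : 0 < e -> u @ F --> 0%E ->
  \forall t \near F, (u t < e%:E)%E.
Proof.
by move=> e0 u0; apply: (u0 (fun z => (z < e%:E)%E)); apply: open_ereal_lt'; rewrite lte_fin.
Qed.

Lemma L2norm_cvg0 (v_ : nat -> R -> R) : (forall n, measurable_fun setT (v_ n)) ->
  L2norm (v_ n) @[n --> \oo] --> 0%E -> forall e, 0 < e ->
  \forall n \near \oo, itg (fun x => v_ n x ^+ 2) /\ intR (fun x => v_ n x ^+ 2) <= e.
Proof.
move=> mv v0 e e0.
have s0 : 0 < Num.sqrt e by rewrite sqrtr_gt0.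
have : \forall n \near \oo, (L2norm (v_ n) < (Num.sqrt e)%:E)%E.
  by apply: near_lt_ereal.
apply: filterS => n Ln.
have N0 : (0 <= L2norm (v_ n))%E by exact: Lnorm_ge0.
have [i2 ->] := L2norm_lty (mv n) (lt_le_trans Ln (leey _)).
split => //; have -> : e = Num.sqrt e ^+ 2 by rewrite sqr_sqrtr// ltW.
rewrite ler_pXn2r ?nnegrE ?fine_ge0 ?sqrtr_ge0//.
rewrite -lee_fin fineK ?ge0_fin_numE//; first exact: ltW.
exact: lt_le_trans Ln (leey _).
Qed.

Lemma trunc_bounded (n : nat) g : continuous g ->
  exists M, forall x, `|trunc n g x| <= M.
Proof.
move=> cg.
have cN : {within `[- n%:R, n%:R], continuous (fun x => `|g x|)}.
  apply: continuous_subspaceT => x; apply: continuous_comp; first exact: cg.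
  exact: norm_continuous.
have nn : - n%:R <= n%:R :> R by rewrite (@le_trans _ _ 0)// oppr_le0.
have [c _ cmax] := EVT_max nn cN.
exists `|g c| => x; rewrite /trunc patchE; case: ifPn => [/set_mem xn|_].
  exact: cmax.
by rewrite normr0.
Qed.

Lemma trunc_ae_continuous (n : nat) g : continuous g ->
  forall x, x != - n%:R -> x != n%:R -> {for x, continuous (trunc n g)}.
Proof.
move=> cg x x1 x2.
have [xn|xn] := ltP `|x| n%:R.
  have H : \forall y \near x, g y = trunc n g y.
    near=> y; rewrite /trunc patchE mem_set//= in_itv/= -ler_norml ltW//.
    near: y; apply: (@cvgr_norm_lt _ _ _ _ _ id x) => //.
  rewrite /prop_for /continuous_at /trunc patchE mem_set; last first.
    by rewrite /= in_itv/= -ler_norml ltW.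
  apply: cvg_trans; last exact: cg.
  exact: near_eq_cvg.
have {}xn : n%:R < `|x|.
  rewrite lt_neqAle xn andbT; apply/negP => /eqP h.
  by move: x1 x2; rewrite h; case: (ger0P x) => _; rewrite ?opprK eqxx.
have H : \forall y \near x, 0 = trunc n g y.
  near=> y; rewrite /trunc patchE memNset//= in_itv/= -ler_norml; apply/negP.
  rewrite -ltNge; near: y; apply: (@cvgr_norm_gt _ _ _ _ _ id x) => //.
have T0 : trunc n g x = 0.
  rewrite /trunc patchE memNset//= in_itv/= -ler_norml; apply/negP.
  by rewrite -ltNge.
have L : (fun _ : R => (0 : R)) y @[y --> x] --> (0 : R) by exact: cvg_cst.
rewrite /prop_for /continuous_at T0; apply: (cvg_trans _ L).
exact: near_eq_cvg.
Unshelve. all: by end_near. Qed.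

(** [plancherel_le] is applied to the difference of the truncation of g to [-n, n]. The transform of
    this truncation is a + i b plus an error small in L^2, so the multiplier is bounded in two ways:
    by [w] against a and b, and by the constant [K] against the error, which is small only without
    weight. Fatou's lemma lets n tend to infinity, and then the parameter d of Young's inequality
    tends to 0. *)
Lemma diff_op_L2 al be ga h f a b g (w : R -> R) (K : R) :
  is_fourier f a b -> {ae mu, forall x, f x = g x} -> continuous g ->
  (forall xi, symb_re al be ga h xi ^+ 2 + symb_im al ga h xi ^+ 2 <= w xi) ->
  (forall xi, symb_re al be ga h xi ^+ 2 + symb_im al ga h xi ^+ 2 <= K) ->
  itg (fun xi => w xi * (a xi ^+ 2 + b xi ^+ 2)) ->
  itg (fun x => diff_op al be ga h g x ^+ 2) /\
  intR (fun x => diff_op al be ga h g x ^+ 2) <=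
    intR (fun xi => w xi * (a xi ^+ 2 + b xi ^+ 2)).
Proof.
move=> [fL aL bL ca cbounded] fg cg mw mK iw.
set m := fun xi => symb_re al be ga h xi ^+ 2 + symb_im al ga h xi ^+ 2.
have m0 xi : 0 <= m xi by rewrite addr_ge0 ?sqr_ge0.
have mK' xi : m xi <= K by exact: mK.
have K0 : 0 <= K by exact: le_trans (m0 0) (mK 0).
have mf : measurable_fun setT f by exact: (set_mem (sub_Lfun_mfun fL)).
have ma : measurable_fun setT a by exact: (set_mem (sub_Lfun_mfun aL)).
have mb : measurable_fun setT b by exact: (set_mem (sub_Lfun_mfun bL)).
have itr n : itg (trunc n g) by apply: itg_restrict => //; exact: continuous_itv_itg.
pose va n xi := cosT (trunc n g) xi - a xi.
pose vb n xi := - sinT (trunc n g) xi - b xi.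
have mva n : measurable_fun setT (va n).
  by apply: measurable_funB => //; exact: measurable_cosT.
have mvb n : measurable_fun setT (vb n).
  by apply: measurable_funB => //; apply: measurableT_comp => //; exact: measurable_sinT.
have {}ca : L2norm (va n) @[n --> \oo] --> 0%E.
  rewrite (_ : (fun n => _) = (fun n : nat => L2norm (fun xi => fourier_re f n%:R xi - a xi)))//.
  apply/funext => n; congr L2norm; apply/funext => xi.
  by rewrite (fourier_re_trunc n xi mf fg cg).
have {}cbounded : L2norm (vb n) @[n --> \oo] --> 0%E.
  rewrite (_ : (fun n => _) = (fun n : nat => L2norm (fun xi => fourier_im f n%:R xi - b xi)))//.
  apply/funext => n; congr L2norm; apply/funext => xi.
  by rewrite (fourier_im_trunc n xi mf fg cg).
set I := intR (fun xi => w xi * _).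
pose G n := diff_op al be ga h (trunc n g).
have iG n : itg (G n) by exact: itg_diff_op.
have GM n : exists M, forall x, `|G n x| <= M.
  have [M HM] := trunc_bounded n cg.
  exists (`|al| * M + `|be| * M + `|ga| * M) => x.
  rewrite /G /diff_op; apply: le_trans (ler_normD _ _) _.
  apply: lerD; last by rewrite normrM ler_wpM2l.
  by apply: le_trans (ler_normD _ _) _; apply: lerD; rewrite normrM ler_wpM2l.
have iG2 n : itg (fun x => G n x ^+ 2).
  have [M HM] := GM n.
  by under eq_fun do rewrite expr2; exact: itgM_bdd (itg_measurable (iG n)) HM.
have cG n : {ae mu, forall x, {for x, continuous (G n)}}.
  have E (c d : R) : {ae mu, forall x, x + c != d}.
    by apply: ae_imp (ae_neq (d - c)) => x; apply: contra => /eqP <-; rewrite addrK.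
  have C (c : R) : {ae mu, forall x, {for (x + c), continuous (trunc n g)}}.
    apply: ae_imp2 (E c (- n%:R)) (E c n%:R) => x; exact: trunc_ae_continuous.
  have D (c x : R) : {for (x + c), continuous (trunc n g)} ->
      {for x, continuous (fun y => trunc n g (y + c))}.
    move=> H; apply: (continuous_comp (f := fun y => y + c)) => //.
    by apply: cvgD; [exact: cvg_id|exact: cvg_cst].
  apply: ae_imp2 (C h) (ae_imp2 (fun x a b => conj a b) (C (- h)) (C 0)).
  move=> x c1 [c2 c3]; rewrite addr0 in c3.
  apply: cvgD; [apply: cvgD|]; apply: cvgM; try exact: cvg_cst.
  - exact: (D h).
  - exact: c3.
  - exact: (D (- h)).
have bound d : 0 < d -> \forall n \near \oo, intR (fun x => G n x ^+ 2) <= (1 + d) * I + d.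
  (* Makes the error (1 + 1/d) K (e + e) equal to d K / (K + 1), which is at most d; K + 1 allows K
     = 0. *)
  move=> d0; pose e := d / (2 * (1 + d^-1) * (K + 1)).
  have di : 0 < d^-1 by rewrite invr_gt0.
  have p0 : 0 < 2 * (1 + d^-1) * (K + 1) by apply: mulr_gt0; [apply: mulr_gt0; lra|lra].
  have e0 : 0 < e by exact: divr_gt0.
  have := L2norm_cvg0 mva ca e0; have := L2norm_cvg0 mvb cbounded e0.
  apply: filterS2 => n [ib eb] [ia ea].
  have [M HM] := GM n.
  pose Q xi := (1 + d) * (w xi * (a xi ^+ 2 + b xi ^+ 2)) +
    (1 + d^-1) * K * (va n xi ^+ 2 + vb n xi ^+ 2).
  have iQ : itg Q by apply: itgD; apply: itgZ => //; exact: itgD.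
  apply: (@le_trans _ _ (intR Q)).
    apply: plancherel_le (iG n) HM (cG n) iQ _ => xi.
    rewrite /G (cosT_diff_op _ _ _ _ _ (itr n)) (sinT_diff_op _ _ _ _ _ (itr n)).
    set A := symb_re _ _ _ _ _; set B := symb_im _ _ _ _.
    set re := cosT _ _; set im := sinT _ _.
    have -> : (A * re + B * im) ^+ 2 + (A * im - B * re) ^+ 2 =
      m xi * (re ^+ 2 + im ^+ 2) by rewrite /m -/A -/B; ring.
    have young (u v : R) : u ^+ 2 <= (1 + d) * v ^+ 2 + (1 + d^-1) * (u - v) ^+ 2.
      rewrite -subr_ge0.
      have -> : (1 + d) * v ^+ 2 + (1 + d^-1) * (u - v) ^+ 2 - u ^+ 2 =
          d^-1 * (d * v - (u - v)) ^+ 2 by field; rewrite gt_eqF.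
      by rewrite mulr_ge0 ?sqr_ge0// ltW.
    have -> : im ^+ 2 = (- im) ^+ 2 by rewrite sqrrN.
    apply: (@le_trans _ _ (m xi * ((1 + d) * (a xi ^+ 2 + b xi ^+ 2) +
       (1 + d^-1) * (va n xi ^+ 2 + vb n xi ^+ 2)))).
      rewrite ler_wpM2l//.
      have := young re (a xi); have := young (- im) (b xi).
      rewrite /va /vb -/re -/im; lra.
    rewrite mulrDr /Q; apply: lerD.
      rewrite mulrCA; apply: ler_wpM2l; first lra.
      by apply: ler_wpM2r; [rewrite addr_ge0 ?sqr_ge0|exact: mw].
    rewrite mulrCA -mulrA; apply: ler_wpM2l; first lra.
    by rewrite ler_wpM2r ?addr_ge0 ?sqr_ge0.
  rewrite (intD (itgZ (1 +
    d) iw) (itgZ _ (itgD ia ib))) (intZ _ iw) (intZ _ (itgD ia ib)) (intD ia ib).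
  rewrite lerD2l.
  apply: (@le_trans _ _ ((1 + d^-1) * K * (e + e))).
    by apply: ler_wpM2l; [apply: mulr_ge0; lra|exact: lerD].
  have -> : (1 + d^-1) * K * (e + e) = d * (K / (K + 1)).
    have K1 : K + 1 != 0 by rewrite gt_eqF//; lra.
    have d1 : d + 1 != 0 by rewrite gt_eqF//; lra.
    have d2 : d != 0 by rewrite gt_eqF.
    by rewrite /e; field; rewrite K1 d1 d2.
  have K1 : K / (K + 1) <= 1 by rewrite ler_pdivrMr ?mul1r; lra.
  by apply: ler_piMr => //; exact: ltW.
have lim d : 0 < d -> itg (fun x => diff_op al be ga h g x ^+ 2) /\
    intR (fun x => diff_op al be ga h g x ^+ 2) <= (1 + d) * I + d.
  move=> d0; have [N _ HN] := bound d d0.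
  apply: (@int_fatou _ (fun n => fun x => G (n + N)%N x ^+ 2)).
  - by move=> n; exact: iG2.
  - by move=> n x; exact: sqr_ge0.
  - apply: measurable_funX; apply: measurable_funD; first apply: measurable_funD.
    + apply: measurable_funM => //; apply: cont_measurable => y.
      by apply: continuous_comp; [apply: cvgD; [exact: cvg_id|exact: cvg_cst]|exact: cg].
    + by apply: measurable_funM => //; exact: cont_measurable.
    + apply: measurable_funM => //; apply: cont_measurable => y.
      by apply: continuous_comp; [apply: cvgB; [exact: cvg_id|exact: cvg_cst]|exact: cg].
  - move=> x; apply: cvg_near_cst.
    have : \forall n \near \oo, G n x = diff_op al be ga h g x.
      apply: filterS3 (trunc_near g (x + h)) (trunc_near g x) (trunc_near g (x - h)).
      by move=> n; rewrite /G /diff_op => -> -> ->.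
    move=> [N1 _ HN1]; exists N1 => // n /= nN.
    by rewrite HN1//= (leq_trans nN)// leq_addr.
  - by move=> n; apply: HN => /=; rewrite leq_addl.
split; first by have [] := lim 1 ltr01.
apply/ler_addgt0Pr => e e0.
have I0 : 0 <= I.
  apply: int_ge0 => xi; rewrite mulr_ge0 ?addr_ge0 ?sqr_ge0//.
  exact: le_trans (m0 xi) (mw xi).
(* With d = e / (I + 1) the bound (1 + d) I + d is equal to I + e. *)
have d0 : 0 < e / (I + 1) by rewrite divr_gt0// ltr_wpDl.
have [_] := lim _ d0; move/le_trans; apply.
rewrite le_eqVlt; apply/orP; left; apply/eqP; field.
by rewrite gt_eqF// ltr_wpDl.
Qed.
(** The Sobolev norm is an infimum; a strict bound on it yields an actual transform satisfying the
    same bound. *)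
Lemma sobolev_weight (s : R) f (N : R) : 0 <= s -> (sobolev_norm s f < N%:E)%E ->
  exists a b, [/\ is_fourier f a b,
    itg (fun xi => ((1 + xi ^+ 2) `^ (s / 2)) ^+ 2 * (a xi ^+ 2 + b xi ^+ 2)) &
    intR (fun xi => ((1 + xi ^+ 2) `^ (s / 2)) ^+ 2 * (a xi ^+ 2 + b xi ^+ 2)) <= N ^+ 2].
Proof.
move=> s0 /ereal_inf_lt[_ [a [b [fab ->]]] LN].
exists a, b.
have [fL aL bL _ _] := fab.
have ma : measurable_fun setT a by exact: (set_mem (sub_Lfun_mfun aL)).
have mb : measurable_fun setT b by exact: (set_mem (sub_Lfun_mfun bL)).
set v := fun xi => _ in LN.
have ms : measurable_fun setT (fun xi : R => 1 + xi ^+ 2).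
  by apply: measurable_funD => //; exact: measurable_funX.
have mv : measurable_fun setT v.
  apply: measurable_funM.
    apply: (measurableT_comp (measurable_powR _)); exact: ms.
  apply: (measurableT_comp (cont_measurable (@sqrt_continuous R))).
  by apply: measurable_funD; exact: measurable_funX.
have [i2 e2] := L2norm_lty mv (lt_le_trans LN (leey _)).
have E xi : v xi ^+ 2 = ((1 + xi ^+ 2) `^ (s / 2)) ^+ 2 * (a xi ^+ 2 + b xi ^+ 2).
  by rewrite /v exprMn sqr_sqrtr// addr_ge0 ?sqr_ge0.
have L0 : (0 <= L2norm v)%E by exact: Lnorm_ge0.
split => //; first exact: eq_itg i2.
rewrite -(eq_int E) e2.
have LN' : fine (L2norm v) <= N.
  rewrite -lee_fin fineK ?ge0_fin_numE//; first exact: ltW.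
  exact: lt_le_trans LN (leey _).
by rewrite ler_pXn2r ?nnegrE ?fine_ge0// (le_trans _ LN')// fine_ge0.
Qed.

Lemma sobolev_weight_ge (s : R) (k : nat) xi : k%:R <= s ->
  (xi ^+ k) ^+ 2 <= ((1 + xi ^+ 2) `^ (s / 2)) ^+ 2.
Proof.
move=> ks; set A := 1 + xi ^+ 2.
have A1 : 1 <= A by rewrite lerDl sqr_ge0.
have A0 : 0 <= A by exact: le_trans A1.
have -> : (A `^ (s / 2)) ^+ 2 = A `^ s.
  by rewrite -powR_mulrn ?powR_ge0// -powRrM divfK// pnatr_eq0.
apply: (@le_trans _ _ (A `^ k%:R)); last exact: ler_powR.
rewrite powR_mulrn// -exprM mulnC exprM.
by apply: lerXn2r; rewrite ?nnegrE ?sqr_ge0// lerDr.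
Qed.

Lemma itg_wle (w v a b : R -> R) : measurable_fun setT w -> measurable_fun setT a ->
  measurable_fun setT b -> (forall xi, 0 <= w xi <= v xi) ->
  itg (fun xi => v xi * (a xi ^+ 2 + b xi ^+ 2)) ->
  itg (fun xi => w xi * (a xi ^+ 2 + b xi ^+ 2)) /\
  intR (fun xi => w xi * (a xi ^+ 2 + b xi ^+ 2)) <=
  intR (fun xi => v xi * (a xi ^+ 2 + b xi ^+ 2)).
Proof.
move=> mw ma mb wv iv.
have le xi : w xi * (a xi ^+ 2 + b xi ^+ 2) <= v xi * (a xi ^+ 2 + b xi ^+ 2).
  by rewrite ler_wpM2r ?addr_ge0 ?sqr_ge0//; have /andP[] := wv xi.
have iw : itg (fun xi => w xi * (a xi ^+ 2 + b xi ^+ 2)).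
  apply: itg_dom iv.
    by apply: measurable_funM => //; apply: measurable_funD; exact: measurable_funX.
  move=> xi; rewrite ger0_norm//.
  by have /andP[w0 _] := wv xi; rewrite mulr_ge0 ?addr_ge0 ?sqr_ge0.
by split => //; exact: int_le.
Qed.

Lemma sobolev_diff_op (s N : R) f g al be ga h (k : nat) K :
  k%:R <= s -> (sobolev_norm s f < N%:E)%E -> {ae mu, forall x, f x = g x} ->
  continuous g ->
  (forall xi, symb_re al be ga h xi ^+ 2 + symb_im al ga h xi ^+ 2 <= (xi ^+ k) ^+ 2) ->
  (forall xi, symb_re al be ga h xi ^+ 2 + symb_im al ga h xi ^+ 2 <= K) ->
  itg (fun x => diff_op al be ga h g x ^+ 2) /\
  intR (fun x => diff_op al be ga h g x ^+ 2) <= N ^+ 2.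
Proof.
move=> ks fN fg cg mk mK.
have s0 : 0 <= s by rewrite (le_trans _ ks).
have [a [b [fab iw wN]]] := sobolev_weight s0 fN.
have [fL aL bL _ _] := fab.
have ma : measurable_fun setT a by exact: (set_mem (sub_Lfun_mfun aL)).
have mb : measurable_fun setT b by exact: (set_mem (sub_Lfun_mfun bL)).
have [i1 l1] := @itg_wle (fun xi => (xi ^+ k) ^+ 2) _ a b
  (measurable_funX 2 (measurable_funX k (@measurable_id _ _ _))) ma mb
  (fun xi => introT andP (conj (sqr_ge0 _) (sobolev_weight_ge xi ks))) iw.
have [i2 l2] := diff_op_L2 fab fg cg mk mK i1.
by split => //; apply: le_trans l2 (le_trans l1 wN).
Qed.

Lemma sobolev_L2_0 (s N : R) f g : 0 <= s -> (sobolev_norm s f < N%:E)%E ->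
  {ae mu, forall x, f x = g x} -> continuous g ->
  itg (fun x => g x ^+ 2) /\ intR (fun x => g x ^+ 2) <= N ^+ 2.
Proof.
move=> s0 fN fg cg.
have E x : diff_op 0 1 0 0 g x = g x by rewrite /diff_op; ring.
have symE xi : symb_re 0 1 0 0 xi ^+ 2 + symb_im 0 0 0 xi ^+ 2 = 1.
  by rewrite /symb_re /symb_im; ring.
have [||i l] := @sobolev_diff_op s N f g 0 1 0 0 0 1 s0 fN fg cg.
- by move=> xi; rewrite symE expr0 expr1n.
- by move=> xi; rewrite symE.
split; first by apply: eq_itg i => x; rewrite E.
by apply: le_trans l; rewrite le_eqVlt; apply/orP; left; apply/eqP; apply: eq_int => x; rewrite E.
Qed.

Lemma dv_mvt g g' x y : dv g g' -> x < y -> exists2 c, x < c < y & g y - g x = g' c * (y - x).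
Proof.
move=> dg xy.
have [|c] := @MVT R g g' x y xy (fun z _ => dg z).
  exact/continuous_subspaceT/(dv_continuous dg).
by rewrite in_itv/= => cxy e; exists c.
Qed.

(** The multiplier of the central difference quotient is i sin(h xi) / h, of size at most |xi|. By
    the mean value theorem the quotients converge pointwise to g', and Fatou's lemma carries the
    bound over. *)
Lemma sobolev_L2_1 (s N : R) f g g' : 1 <= s -> (sobolev_norm s f < N%:E)%E ->
  {ae mu, forall x, f x = g x} -> dv g g' -> continuous g' ->
  itg (fun x => g' x ^+ 2) /\ intR (fun x => g' x ^+ 2) <= N ^+ 2.
Proof.
move=> s1 fN fg dg cg'; have cg := dv_continuous dg.
pose h n : R := n.+1%:R^-1.
have h0 n : 0 < h n by rewrite invr_gt0.
pose G n := diff_op ((2 * h n)^-1) 0 (- (2 * h n)^-1) (h n) g.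
have HG n : itg (fun x => G n x ^+ 2) /\ intR (fun x => G n x ^+ 2) <= N ^+ 2.
  have symE xi : symb_re ((2 * h n)^-1) 0 (- (2 * h n)^-1) (h n) xi ^+ 2 +
      symb_im ((2 * h n)^-1) (- (2 * h n)^-1) (h n) xi ^+ 2 = (sin (h n * xi) / h n) ^+ 2.
    by rewrite /symb_re /symb_im; field; rewrite gt_eqF.
  apply: (@sobolev_diff_op s N f g _ _ _ _ 1 ((h n)^-1 ^+ 2)) => // xi.
    rewrite symE -[leLHS]real_normK ?num_real// -[leRHS]real_normK ?num_real//.
    rewrite ler_pXn2r ?nnegrE// expr1 normrM normfV [`|h n|]gtr0_norm//.
    by rewrite ler_pdivrMr// (le_trans (sin_norm_le _))// normrM gtr0_norm// mulrC.
  rewrite symE -[leLHS]real_normK ?num_real//.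
  have hi : 0 <= (h n)^-1 by rewrite invr_ge0 ltW.
  rewrite ler_pXn2r ?nnegrE// normrM normfV [`|h n|]gtr0_norm//.
  by rewrite ler_piMl// sin_max.
apply: (@int_fatou _ (fun n x => G n x ^+ 2)).
- by move=> n; have [] := HG n.
- by move=> n x; exact: sqr_ge0.
- by apply: measurable_funX; exact: cont_measurable.
- move=> x; under eq_fun do rewrite expr2; rewrite expr2.
  suff L : G n x @[n --> \oo] --> g' x by exact: cvgM.
  apply/cvgrPdist_le => e e0.
  have /cvgrPdist_le/(_ e e0) [d /= d0 Hd] := cg' x.
  have : \forall n \near \oo, h n < d.
    have := @cvg_harmonic R; move/cvgr_lt; exact.
  apply: filterS => n hn.
  have hn0 := h0 n.
  have xh : x - h n < x + h n by lra.
  have [c /andP[c1 c2] Ec] := dv_mvt dg xh.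
  have -> : G n x = g' c.
    rewrite /G /diff_op mul0r addr0 mulNr -mulrBr Ec; field; exact: lt0r_neq0.
  by apply: Hd; rewrite /ball_/= ltr_distl; lra.
- by move=> n; have [] := HG n.
Qed.

(** The multiplier of the second difference quotient is - (2 sin(h xi / 2) / h)^2, of size at most
    xi^2. Pointwise convergence comes from the mean value theorem for y |-> g (y + h) - g y on
    [x - h, x], then for g'. *)
Lemma sobolev_L2_2 (s N : R) f g g' g2 : 2 <= s -> (sobolev_norm s f < N%:E)%E ->
  {ae mu, forall x, f x = g x} -> dv g g' -> dv g' g2 -> continuous g2 ->
  itg (fun x => g2 x ^+ 2) /\ intR (fun x => g2 x ^+ 2) <= N ^+ 2.
Proof.
move=> s1 fN fg dg dg' cg2; have cg := dv_continuous dg.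
pose h n : R := n.+1%:R^-1.
have h0 n : 0 < h n by rewrite invr_gt0.
pose G n := diff_op (h n ^- 2) (- 2 * h n ^- 2) (h n ^- 2) (h n) g.
have HG n : itg (fun x => G n x ^+ 2) /\ intR (fun x => G n x ^+ 2) <= N ^+ 2.
  have symE xi : symb_re (h n ^- 2) (- 2 * h n ^- 2) (h n ^- 2) (h n) xi ^+ 2 +
      symb_im (h n ^- 2) (h n ^- 2) (h n) xi ^+ 2 = ((2 * sin (h n * xi / 2) / h n) ^+ 2) ^+ 2.
    transitivity (((2 - 2 * cos (h n * xi)) / h n ^+ 2) ^+ 2).
      by rewrite /symb_re /symb_im; field; rewrite gt_eqF.
    by congr (_ ^+ 2); rewrite one_sub_cos expr_div_n.
  apply: (@sobolev_diff_op s N f g _ _ _ _ 2 (((2 / h n) ^+ 2) ^+ 2)) => // xi.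
    rewrite symE ler_pXn2r ?nnegrE ?sqr_ge0//.
    rewrite -[leLHS]real_normK ?num_real// -[leRHS]real_normK ?num_real//.
    rewrite ler_pXn2r ?nnegrE// normrM normfV [`|h n|]gtr0_norm//.
    rewrite ler_pdivrMr// normrM [`|2|]ger0_norm//.
    have := sin_norm_le (h n * xi / 2).
    have -> : h n * xi / 2 = (h n / 2) * xi by ring.
    have hh : 0 <= h n / 2 by rewrite divr_ge0// ltW.
    rewrite [X in _ <= X -> _]normrM [`|h n / 2|]ger0_norm//; lra.
  rewrite symE ler_pXn2r ?nnegrE ?sqr_ge0//.
  rewrite -[leLHS]real_normK ?num_real//.
  have hi : 0 <= 2 / h n by rewrite divr_ge0// ltW.
  rewrite ler_pXn2r ?nnegrE// normrM normfV [`|h n|]gtr0_norm//.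
  rewrite ler_pM2r ?invr_gt0// normrM [`|2|]ger0_norm//.
  by have := sin_max (h n * xi / 2); lra.
apply: (@int_fatou _ (fun n x => G n x ^+ 2)).
- by move=> n; have [] := HG n.
- by move=> n x; exact: sqr_ge0.
- by apply: measurable_funX; exact: cont_measurable.
- move=> x; under eq_fun do rewrite expr2; rewrite expr2.
  suff L : G n x @[n --> \oo] --> g2 x by exact: cvgM.
  apply/cvgrPdist_le => e e0.
  have /cvgrPdist_le/(_ e e0) [d /= d0 Hd] := cg2 x.
  have : \forall n \near \oo, h n < d.
    have := @cvg_harmonic R; move/cvgr_lt; exact.
  apply: filterS => n hn.
  have hn0 := h0 n.
  have dpsi : dv (fun y => g (y + h n) - g y) (fun y => g' (y + h n) - g' y).
    apply: (dvB _ dg); apply: dv_eq (dv_comp dg (dvD (@dv_id R) (dv_cst (h n)))) _ => y.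
    by rewrite addr0 mul1r.
  have xh : x - h n < x by lra.
  have [c /andP[c1 c2] Ec] := dv_mvt dpsi xh.
  have ch : c < c + h n by lra.
  have [c' /andP[d1 d2] Ec'] := dv_mvt dg' ch.
  have -> : G n x = g2 c'.
    have E1 : g (x + h n) - 2 * g x + g (x - h n) = g2 c' * h n * h n.
      move: Ec; rewrite Ec' subrK => e1.
      transitivity (g (x + h n) - g x - (g x - g (x - h n))); first ring.
      rewrite e1; ring.
    transitivity (h n ^- 2 * (g (x + h n) - 2 * g x + g (x - h n))).
      by rewrite /G /diff_op; ring.
    by rewrite E1; field; rewrite gt_eqF.
  by apply: Hd; rewrite /ball_/= ltr_distl; lra.
- by move=> n; have [] := HG n.
Qed.

End SobolevL2.

(** * Continuous functions that are bounded, integrable or square integrable *)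

Section SquareIntegrable.
Variable R : realType.
Local Notation mu := (@lebesgue_measure R).
Implicit Types (f g h p q : R -> R).

Definition cbounded g := continuous g /\ exists c : R, forall x, `|g x| <= c.
Definition sqint g := continuous g /\ itg (fun x => g x ^+ 2).
Definition cintegrable g := continuous g /\ itg g.

Lemma ctsD f g : continuous f -> continuous g -> continuous (fun x => f x + g x).
Proof. by move=> cf cg x; apply: cvgD; [exact: cf|exact: cg]. Qed.
Lemma ctsM f g : continuous f -> continuous g -> continuous (fun x => f x * g x).
Proof. by move=> cf cg x; apply: cvgM; [exact: cf|exact: cg]. Qed.
Lemma ctsN f : continuous f -> continuous (fun x => - f x).
Proof. by move=> cf x; apply: cvgN; exact: cf. Qed.
Lemma cts_cst (c : R) : continuous (fun _ : R => c).
Proof. by move=> x; exact: cvg_cst. Qed.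
Lemma ctsX f n : continuous f -> continuous (fun x => f x ^+ n).
Proof.
move=> cf; elim: n => [|n IH].
  rewrite (_ : (fun x => _) = fun=> 1); last by apply/funext => x; rewrite expr0.
  exact: cts_cst.
rewrite (_ : (fun x => _) = fun x => f x * f x ^+ n); last by apply/funext => x; rewrite exprS.
exact: ctsM.
Qed.

Lemma cboundedD f g : cbounded f -> cbounded g -> cbounded (fun x => f x + g x).
Proof.
move=> [cf [a ha]] [cg [b hb]]; split; first exact: ctsD.
exists (a + b) => x; apply: (le_trans (ler_normD _ _)); exact: lerD.
Qed.
Lemma cboundedM f g : cbounded f -> cbounded g -> cbounded (fun x => f x * g x).
Proof.
move=> [cf [a ha]] [cg [b hb]]; split; first exact: ctsM.
exists (a * b) => x; rewrite normrM; exact: ler_pM.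
Qed.
Lemma cboundedN f : cbounded f -> cbounded (fun x => - f x).
Proof. by move=> [cf [a ha]]; split; [exact: ctsN|exists a => x; rewrite normrN]. Qed.
Lemma cbounded_cst (c : R) : cbounded (fun=> c).
Proof. by split; [exact: cts_cst|exists `|c|]. Qed.
Lemma cboundedX f n : cbounded f -> cbounded (fun x => f x ^+ n).
Proof.
move=> [cf [a ha]]; split; first exact: ctsX.
by exists (a ^+ n) => x; rewrite normrX; apply: lerXn2r; rewrite ?nnegrE//; exact: le_trans (ha x).
Qed.

Lemma cintegrable_bM f g : cbounded f -> cintegrable g -> cintegrable (fun x => f x * g x).
Proof.
move=> [cf [a ha]] [cg ig]; split; first exact: ctsM.
apply: (@eq_itg _ (fun x => g x * f x)) => [x|]; first by rewrite mulrC.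
by apply: (itgM_bdd (c := a)) => //; exact: cont_measurable.
Qed.
Lemma cintegrable_Mb f g : cintegrable f -> cbounded g -> cintegrable (fun x => f x * g x).
Proof.
move=> hf hg; rewrite (_ : (fun x => _) = fun x => g x * f x); first exact: cintegrable_bM.
by apply/funext => x; rewrite mulrC.
Qed.
Lemma cintegrableD f g : cintegrable f -> cintegrable g -> cintegrable (fun x => f x + g x).
Proof. by move=> [? ?] [? ?]; split; [exact: ctsD|exact: itgD]. Qed.
Lemma cintegrableN f : cintegrable f -> cintegrable (fun x => - f x).
Proof. by move=> [? ?]; split; [exact: ctsN|exact: itgN]. Qed.
Lemma cintegrable_sqintM f g : sqint f -> sqint g -> cintegrable (fun x => f x * g x).
Proof.
move=> [cf if2] [cg ig2]; split; first exact: ctsM.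
apply: (itg_dom (g := fun x => f x ^+ 2 + g x ^+ 2)).
- exact: cont_measurable (ctsM cf cg).
- move=> x; rewrite normrM -(real_normK (num_real (f x))) -(real_normK (num_real (g x))).
  have := sqr_ge0 (`|f x| - `|g x|); have := sqr_ge0 `|f x|; have := sqr_ge0 `|g x|.
  by rewrite !expr2; lra.
- exact: itgD.
Qed.
Lemma cintegrable_sqr f : sqint f -> cintegrable (fun x => f x ^+ 2).
Proof. by move=> [cf if2]; split => //; exact: ctsX. Qed.

Lemma sqintD f g : sqint f -> sqint g -> sqint (fun x => f x + g x).
Proof.
move=> hf hg; have [cf _] := hf; have [cg _] := hg; split; first exact: ctsD.
have := cintegrableD (cintegrableD (cintegrable_sqr hf) (cintegrable_sqr hg)) (cintegrable_bM (cbounded_cst 2) (cintegrable_sqintM hf hg)).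
by move=> [_]; apply: eq_itg => x; rewrite !expr2; ring.
Qed.
Lemma sqint_bM f g : cbounded f -> sqint g -> sqint (fun x => f x * g x).
Proof.
move=> hf hg; split; first exact: ctsM hf.1 hg.1.
have [_] := cintegrable_bM (cboundedM hf hf) (cintegrable_sqr hg).
by apply: eq_itg => x; rewrite !expr2; ring.
Qed.
Lemma sqint_Mb f g : sqint f -> cbounded g -> sqint (fun x => f x * g x).
Proof.
move=> hf hg; rewrite (_ : (fun x => _) = fun x => g x * f x); first exact: sqint_bM.
by apply/funext => x; rewrite mulrC.
Qed.
Lemma sqintN f : sqint f -> sqint (fun x => - f x).
Proof.
move=> [cf if2]; split; first exact: ctsN.
by apply: eq_itg if2 => x; rewrite sqrrN.
Qed.

End SquareIntegrable.

(** Proceeds along the structure of the expression. A product needs a bounded factor or, for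
    integrability, two square-integrable ones. *)
Ltac solve_closure := first [ assumption
  | lazymatch goal with
    | |- cbounded (fun _ => ?c) => exact: cbounded_cst
    | |- cbounded (fun x => @?f x + @?g x) => apply: (@cboundedD _ f g); solve_closure
    | |- cbounded (fun x => - @?f x) => apply: (@cboundedN _ f); solve_closure
    | |- cbounded (fun x => @?f x ^+ ?n) => apply: (@cboundedX _ f n); solve_closure
    | |- cbounded (fun x => @?f x * @?g x) => apply: (@cboundedM _ f g); solve_closure
    | |- sqint (fun x => @?f x + @?g x) => apply: (@sqintD _ f g); solve_closure
    | |- sqint (fun x => - @?f x) => apply: (@sqintN _ f); solve_closure
    | |- sqint (fun x => @?f x * @?g x) =>
        first [apply: (@sqint_bM _ f g);
          [solve_closure|solve_closure] | apply: (@sqint_Mb _ f g); [solve_closure|solve_closure]]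
    | |- cintegrable (fun x => @?f x + @?g x) => apply: (@cintegrableD _ f g); solve_closure
    | |- cintegrable (fun x => - @?f x) => apply: (@cintegrableN _ f); solve_closure
    | |- cintegrable (fun x => @?f x ^+ 2) => apply: (@cintegrable_sqr _ f); solve_closure
    | |- cintegrable (fun x => @?f x * @?g x) =>
        first [apply: (@cintegrable_bM _ f g);
          [solve_closure|solve_closure] | apply: (@cintegrable_Mb _ f g);
            [solve_closure|solve_closure]
          | apply: (@cintegrable_sqintM _ f g); [solve_closure|solve_closure]]
    end ].

(** * Weighted energy estimate at a fixed time *)

Section StaticEnergy.
Variable R : realType.
Local Notation mu := (@lebesgue_measure R).
Implicit Types (u f w : R -> R).

(** The embedding of H^1 in the bounded functions: [C1_bounded] for g^2, with 2 |g g'| <= g^2 +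
    g'^2. *)
Lemma sqint_sup g g' : sqint g -> sqint g' -> dv g g' ->
  forall x : R, `|g x| ^+ 2 <= intR (fun y => g y ^+ 2) + intR (fun y => g' y ^+ 2).
Proof.
move=> hg hg' dg x.
have l1g : cintegrable (fun y => 2 * g y * g' y) by rewrite (_ : (fun y => _) =
  fun y => 2 * (g y * g' y)); [solve_closure|apply/funext => y; ring].
have d2 : dv (fun y => g y ^+ 2) (fun y => 2 * g y * g' y).
  by apply: dv_eq (dvX 2 dg) _ => y /=; rewrite expr1.
have := C1_bounded d2 l1g.1 (cintegrable_sqr hg).2 l1g.2 x.
rewrite normrX => /le_trans; apply.
rewrite -intD; [|exact: hg.2|exact: hg'.2].
apply: int_le; [exact: itg_norm l1g.2|exact: itgD hg.2 hg'.2|] => y.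
rewrite ler_norml; apply/andP; split.
  by have := sqr_ge0 (g y + g' y); rewrite !expr2; lra.
by have := sqr_ge0 (g y - g' y); rewrite !expr2; lra.
Qed.

Lemma young (B a x y : R) : `|a| <= B -> 4 * (a * x * y) <= x ^+ 2 / 4 + 16 * B ^+ 2 * y ^+ 2.
Proof.
move=> aB; have H : a ^+ 2 <= B ^+ 2.
  by rewrite -real_normK ?num_real// lerXn2r ?nnegrE// (le_trans _ aB).
have : a ^+ 2 * y ^+ 2 <= B ^+ 2 * y ^+ 2 by rewrite ler_wpM2r// sqr_ge0.
have := sqr_ge0 (x / 2 - 4 * (a * y)); rewrite !expr2; lra.
Qed.

Lemma young2 (B a x y : R) : `|a| <= B -> a * x * y <= B * (x ^+ 2 + y ^+ 2).
Proof.
move=> aB; have B0 : 0 <= B by exact: le_trans aB.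
have H : `|x * y| <= x ^+ 2 + y ^+ 2.
  rewrite ler_norml; apply/andP; split.
    by have := sqr_ge0 (x + y); have := sqr_ge0 x; have := sqr_ge0 y; rewrite !expr2; lra.
  by have := sqr_ge0 (x - y); have := sqr_ge0 x; have := sqr_ge0 y; rewrite !expr2; lra.
rewrite -mulrA; apply: (le_trans (ler_norm _)); rewrite normrM; exact: ler_pM.
Qed.

(* The integrand of the energy identity divided by the weight [psi], with [y = u_x],
   [s = psi' / psi], [h1 = h'], [a = u^k], and with [v y], [w y] such that
   flux = (v y)' - w y, which keeps u_xx out of the estimate. *)
Lemma energy_pointwise (B a v w s u y h h1 : R) : `|a| <= B -> `|v| <= B -> `|w| <= B ->
  `|s| <= 3/2 ->
  u * h + y * h1 - a * u * y - v / 3 * y ^+ 2 + a * s / 2 * y ^+ 2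
   - 4 * ((h ^+ 2 + h1 ^+ 2) - w * h * y + s * h * h1 - v * h1 * y - s * v * h * y)
  <= (1 + 4 * B + 80 * B ^+ 2) * (u ^+ 2 + y ^+ 2).
Proof.
move=> aB vB wB sB.
have B0 : 0 <= B by exact: le_trans aB.
have svB : `|s * v| <= 3/2 * B by rewrite normrM; exact: ler_pM.
have asB : `|a * s / 2| <= B.
  rewrite !normrM [`|2^-1|]ger0_norm ?invr_ge0//.
  have : `|a| * `|s| <= B * (3/2) by exact: ler_pM.
  lra.
have v3 : `|- (v / 3)| <= B.
  by rewrite normrN normrM [`|3^-1|]ger0_norm ?invr_ge0//; lra.
have Y1 := young h y wB.
have Y2 := young h1 y vB.
have Y3 := young h y svB.
(* Of the 4 (h^2 + h1^2) available, this term costs 3, since |s| <= 3/2. The other terms take 3/4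
   h^2 and 1/2 h1^2 from what remains. *)
have Y4 : 4 * (- s * h * h1) <= 3 * (h ^+ 2 + h1 ^+ 2).
  have : - s * h * h1 <= 3/2 * `|h * h1|.
    rewrite -mulrA; apply: (le_trans (ler_norm _)); rewrite normrM normrN.
    exact: ler_wpM2r.
  have : `|h * h1| <= (h ^+ 2 + h1 ^+ 2) / 2.
    rewrite ler_norml; apply/andP; split.
      by have := sqr_ge0 (h + h1); rewrite !expr2; lra.
    by have := sqr_ge0 (h - h1); rewrite !expr2; lra.
  lra.
have Y5 : - a * u * y <= B * (u ^+ 2 + y ^+ 2) by apply: young2; rewrite normrN.
have Y6 : a * s / 2 * y ^+ 2 <= B * y ^+ 2.
  by rewrite ler_wpM2r ?sqr_ge0// (le_trans (ler_norm _)).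
have Y7 : - (v / 3) * y ^+ 2 <= B * y ^+ 2.
  by rewrite ler_wpM2r ?sqr_ge0// (le_trans (ler_norm _)).
have Y8 : u * h <= h ^+ 2 / 4 + u ^+ 2.
  by have := sqr_ge0 (h / 2 - u); rewrite !expr2; lra.
have Y9 : y * h1 <= h1 ^+ 2 / 4 + y ^+ 2.
  by have := sqr_ge0 (h1 / 2 - y); rewrite !expr2; lra.
have N1 : 0 <= B ^+ 2 * y ^+ 2 by rewrite mulr_ge0// sqr_ge0.
have N2 : 0 <= B ^+ 2 * u ^+ 2 by rewrite mulr_ge0// sqr_ge0.
have N3 : 0 <= B * u ^+ 2 by rewrite mulr_ge0// sqr_ge0.
have N4 : 0 <= B * y ^+ 2 by rewrite mulr_ge0// sqr_ge0.
have N5 := sqr_ge0 h; have N6 := sqr_ge0 h1.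
(* The coefficient of y^2 is 1 + 3 B + (16 + 16 + 36) B^2, rounded up in the statement. *)
move: Y1 Y2 Y3; rewrite exprMn.
move: (B ^+ 2) N1 N2 => b2 N1 N2.
rewrite !expr2 in Y4 Y5 Y6 Y7 Y8 Y9 N1 N2 N3 N4 N5 N6 *; lra.
Qed.

(* With the constant [3/2], the term h h' psi' of the energy identity is absorbed in
   (h^2 + h'^2) psi. *)
Definition weight psi psi' := [/\ dv psi psi', cbounded psi, cbounded psi' &
  forall x : R, 0 <= psi x /\ `|psi' x| <= 3/2 * psi x].

(* A solution at a fixed time; [f] and [f1] are u_t and u_tx. *)
Record slice (k : nat) u u1 u2 f f1 : Prop := Slice {
  sl_du : dv u u1; sl_du1 : dv u1 u2; sl_df : dv f f1;
  sl_dh : dv (fun x : R => f1 x + (k%:R * u x ^+ k.-1 * u1 x * u1 x + u x ^+ k * u2 x))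
           (fun x => f x + u x ^+ k * u1 x + flux k u u1 u2 x);
  sl_u : sqint u; sl_u1 : sqint u1; sl_u2 : sqint u2; sl_f : sqint f; sl_f1 : sqint f1 }.

Lemma slice_cbounded k u u1 u2 f f1 : slice k u u1 u2 f f1 -> cbounded u /\ cbounded u1.
Proof.
move=> [du du1 _ _ su su1 su2 _ _].
have H (g g' : R -> R) : sqint g -> sqint g' -> dv g g' -> cbounded g.
  move=> sg sg' dg; split; first exact: sg.1.
  exists (1 + (intR (fun y => g y ^+ 2) + intR (fun y => g' y ^+ 2))) => x.
  have := sqint_sup sg sg' dg x; have := sqr_ge0 (1 - `|g x|); have := normr_ge0 (g x).
  rewrite !expr2; nra.
by split; [exact: H su su1 du|exact: H su1 su2 du1].
Qed.

(** [B] dominates u^k and the coefficients [v] and [w] of [static_energy] when |u| and |u_x| are at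
    most [M]; the polynomial in [B] is that of [energy_pointwise]. *)
Definition energy_cst (k : nat) (M : R) : R :=
  let B := 2 * k%:R ^+ 2 * M ^+ k in 1 + 4 * B + 80 * B ^+ 2.

(** The integral of [F'] is 0, and subtracting it from the left side leaves an integrand that
    [energy_pointwise] bounds point by point. *)
Lemma static_energy k u u1 u2 f f1 psi psi' (M : R) : (0 < k)%N -> 1 <= M ->
  slice k u u1 u2 f f1 -> (forall x, `|u x| <= M) -> (forall x, `|u1 x| <= M) ->
  weight psi psi' ->
  intR (fun x => (u x * f x + u1 x * f1 x) * psi x) <=
  energy_cst k M * intR (fun x => (u x ^+ 2 + u1 x ^+ 2) * psi x).
Proof.
move=> k0 M1 sl uM u1M [dpsi bpsi bpsi' psiP].
have [bu bu1] := slice_cbounded sl.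
case: sl => du du1 df dh su su1 su2 sf sf1.
pose K : R := k%:R.
pose v x := (3 / 2 * K) * (u x ^+ k.-1 * u1 x).
pose w x := (K * k.-1%:R / 2) * (u x ^+ k.-2 * u1 x ^+ 2).
pose h x := f x + u x ^+ k * u1 x.
pose h1 x := f1 x + (K * u x ^+ k.-1 * u1 x * u1 x + u x ^+ k * u2 x).
have duk : dv (fun x => u x ^+ k) (fun x => K * u x ^+ k.-1 * u1 x) by exact: dvX.
have duk1 : dv (fun x => u x ^+ k.-1) (fun x => k.-1%:R * u x ^+ k.-2 * u1 x) by exact: dvX.
have dhh : dv h h1 by exact: dvD df (dvM duk du1).
have dv1 : dv v (fun x => 3 / 2 * K * (k.-1%:R * u x ^+ k.-2 * u1 x * u1 x + u x ^+ k.-1 * u2 x)).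
  exact: dvZ (dvM duk1 du1).
have bv : cbounded v by rewrite /v; solve_closure.
have bw : cbounded w by rewrite /w; solve_closure.
have sh : sqint h by rewrite /h; solve_closure.
have sh1 : sqint h1 by rewrite /h1; solve_closure.
(* The first part is 4 times the outcome of testing h'' = h + flux against h psi, with the flux
   integrated by parts. The second part removes u_x u^k u_xx psi, which appears when u_tx is
   expressed through h'. *)
pose F x := 4 * (h x * h1 x * psi x - v x * u1 x * h x * psi x) - 1 /
  2 * (u x ^+ k * u1 x * u1 x * psi x).
have lF : cintegrable F by rewrite /F; solve_closure.
pose F' x := 4 * ((h x * h x + h1 x * h1 x) * psi x - w x * u1 x * h x * psi x +
   h x * h1 x * psi' x - v x * u1 x * h1 x * psi x - v x * u1 x * h x * psi' x)
  - ((v x / 3 * u1 x * u1 x + u x ^+ k * u1 x * u2 x) * psi x + 1 /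
    2 * (u x ^+ k * u1 x * u1 x * psi' x)).
have lF' : cintegrable F' by rewrite /F'; solve_closure.
have dF : dv F F'.
  have dA := dvM (dvM dhh dh) dpsi.
  have dB := dvM (dvM (dvM dv1 du1) dhh) dpsi.
  have dC := dvM (dvM (dvM duk du1) du1) dpsi.
  apply: dv_eq (dvB (dvZ 4 (dvB dA dB)) (dvZ (1/2) dC)) _ => x /=.
  rewrite /F' /flux /v /w /h1 /h /K /=.
  by field.
have I0 := int_deriv0 dF lF'.1 lF.2 lF'.2.
have lL : cintegrable (fun x => (u x * f x + u1 x * f1 x) * psi x) by solve_closure.
have lE : cintegrable (fun x => (u x ^+ 2 + u1 x ^+ 2) * psi x) by solve_closure.
rewrite -intZ; last exact: lE.2.
rewrite -[leLHS]subr0 -I0 -intB; [|exact: lL.2|exact: lF'.2].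
apply: int_le; [exact: itgB lL.2 lF'.2|exact: itgZ lE.2|] => x.
(* Where psi vanishes, so does psi', and the default value 0 of the quotient is the right one. *)
pose s := psi' x / psi x.
have [p0 pp] := psiP x.
have spsi : psi' x = s * psi x.
  have [z|z] := eqVneq (psi x) 0; last by rewrite /s divfK.
  by apply/eqP; rewrite z mulr0 -normr_le0; move: pp; rewrite z mulr0.
have sB : `|s| <= 3/2.
  have [z|z] := eqVneq (psi x) 0; first by rewrite /s z invr0 mulr0 normr0.
  have zp : 0 < psi x by rewrite lt_neqAle eq_sym z p0.
  by rewrite /s normrM normfV (ger0_norm p0) ler_pdivrMr.
pose B : R := 2 * k%:R ^+ 2 * M ^+ k.
have M0 : 0 <= M by exact: le_trans M1.
have K1 : 1 <= K by rewrite ler1n.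
have K0 : 0 <= K by exact: le_trans K1.
have Mk : 0 <= M ^+ k by rewrite exprn_ge0.
have powM (z : R) n : `|z| <= M -> `|z| ^+ n <= M ^+ n.
  by move=> zM; rewrite lerXn2r ?nnegrE.
have aB : `|u x ^+ k| <= B.
  rewrite normrX; apply: (le_trans (powM _ k (uM x))); rewrite /B -[leLHS]mul1r ler_wpM2r//.
  have : 1 <= K ^+ 2 by rewrite exprn_ege1.
  rewrite /K; lra.
have KK : K <= K ^+ 2 by rewrite expr2 ler_peMr.
have vB : `|v x| <= B.
  rewrite /v normrM ger0_norm ?mulr_ge0// normrM normrX /B.
  have : `|u x| ^+ k.-1 * `|u1 x| <= M ^+ k.
    by rewrite -[k in leRHS](prednK k0) exprSr; apply: ler_pM => //; exact: powM.
  move=> H; apply: ler_pM => //; rewrite ?mulr_ge0//.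
  by rewrite -/K; lra.
have wB : `|w x| <= B.
  (* For k = 1, [k.-2 + 2] differs from k, but there w = 0. *)
  rewrite /w; have [k1|k1] := eqVneq k.-1 0%N.
    by rewrite k1 mulr0 !mul0r normr0 /B !mulr_ge0// exprn_ge0.
  have kk : k.-1%:R <= K by rewrite ler_nat leq_pred.
  rewrite normrM ger0_norm ?mulr_ge0// normrM !normrX /B.
  have : `|u x| ^+ k.-2 * `|u1 x| ^+ 2 <= M ^+ k.
    have -> : (k = k.-2 + 2)%N by move: k0 k1; case: (k) => [|[|n]]//; rewrite addn2.
    by rewrite exprD /= addn2 /=; apply: ler_pM; rewrite ?exprn_ge0//; exact: powM.
  move=> H; apply: ler_pM => //; rewrite ?mulr_ge0// ?exprn_ge0//.
  have : K * k.-1%:R <= K ^+ 2 by rewrite expr2 ler_wpM2l.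
  have := sqr_ge0 K; rewrite -/K; lra.
have P := energy_pointwise (u x) (u1 x) (h x) (h1 x) aB vB wB sB.
have := ler_wpM2r p0 P; rewrite -/(energy_cst k M) => H.
rewrite [leRHS]mulrA; apply: le_trans H; rewrite /F' spsi le_eqVlt; apply/orP; left; apply/eqP.
by rewrite /energy_cst -/B /v /h1 /h /K /=; field.
Qed.

End StaticEnergy.

(** * Differentiation in time *)

Section TimeDerivative.
Variable R : realType.
Local Notation mu := (@lebesgue_measure R).
Implicit Types (I : set R) (F G : R -> R) (t l : R).

(* One-sided at the endpoints of [I]. *)
Definition derive_within I F t l := (F r - F t) / (r - t) @[r --> within I t^'] --> l.

Lemma within_dnbhs I (t : R) (P : R -> Prop) :
  (\forall r \near within I t^', P r) <->
  exists2 d : R, 0 < d & forall r, I r -> r != t -> `|r - t| < d -> P r.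
Proof.
split.
  rewrite near_withinE /dnbhs near_withinE => -[d /= d0 H]; exists d => // r Ir rt rd.
  by apply: H => //; rewrite /ball /= distrC.
move=> [d d0 H]; rewrite near_withinE /dnbhs near_withinE; exists d => //= r rd rt Ir.
by apply: H => //; rewrite distrC.
Qed.

Lemma derive_within_sub I J F t l : I `<=` J -> derive_within J F t l -> derive_within I F t l.
Proof.
move=> IJ H; apply: cvg_trans H; apply: cvg_app => P.
move=> /within_dnbhs[d d0 H]; apply/within_dnbhs; exists d => // r Ir; apply: H; exact: IJ.
Qed.

Lemma derive_within_is_derive a b F t l : a < t < b -> derive_within `[a, b] F t l ->
  is_derive t 1 F l.
Proof.
move=> /andP[at_ tb] H.
have L : h^-1 *: (F (h *: 1 + t) - F t) @[h --> (0 : R)^'] --> l.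
  apply/cvgrPdist_le => e e0.
  move/cvgrPdist_le/(_ _ e0)/within_dnbhs: H => [d d0 H].
  have ta : 0 < t - a by rewrite subr_gt0.
  have bt : 0 < b - t by rewrite subr_gt0.
  rewrite /dnbhs near_withinE; exists (Num.min d (Num.min (t - a) (b - t))) => /=.
    by rewrite !lt_min d0 ta bt.
  move=> h; rewrite /ball /= sub0r normrN !lt_min => /and3P[hd hta htb] h0.
  have -> : h^-1 *: (F (h *: 1 + t) - F t) = (F (h + t) - F t) / ((h + t) - t).
    by rewrite addrK mulrC [h *: 1]mulr1.
  apply: H; rewrite ?addrK//; last by rewrite -subr_eq0 addrK.
  rewrite /mkset/= in_itv/=; move: hta htb; rewrite !ltr_norml; lra.
apply: DeriveDef; first by apply: cvgP L.
exact: cvg_lim L.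
Qed.

Lemma derive_within_cvg I F t l : derive_within I F t l -> F @ within I (nbhs t) --> F t.
Proof.
move=> H; apply/subr_cvg0.
apply: (@cvg0_le _ _ _ _ _ (fun r => (`|l| + 1) * `|r - t|)).
  move/cvgrPdist_le/(_ _ ltr01)/within_dnbhs: H => [d d0 H].
  rewrite near_withinE; exists d => //= r rd Ir.
  have [->|rt] := eqVneq r t; first by rewrite !subrr normr0 mulr0.
  have rt0 : r - t != 0 by rewrite subr_eq0.
  rewrite -(divfK rt0 (F r - F t)) normrM ler_wpM2r//.
  have := H r Ir rt; rewrite distrC => /(_ rd) H1.
  have := lerB_dist ((F r - F t) / (r - t)) l.
  rewrite distrC; lra.
have -> : (0 : R) = (`|l| + 1) * `|t - t| by rewrite subrr normr0 mulr0.
apply: cvg_within_filter; apply: cvgM; first exact: cvg_cst.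
by apply: cvg_norm; apply: cvgB; [exact: cvg_id|exact: cvg_cst].
Qed.

Lemma cvg_ext {T : Type} (P : set_system T) (f g : T -> R) (l : R) : (forall r, f r = g r) ->
  f @ P --> l -> g @ P --> l.
Proof. by move=> /funext ->. Qed.

Lemma derive_withinN I F t l : derive_within I F t l -> derive_within I (fun r => - F r) t (- l).
Proof.
move=> /cvgN; apply: cvg_ext => r /=.
by rewrite -mulNr opprB opprK addrC.
Qed.

Lemma derive_withinD I F G t l m : derive_within I F t l -> derive_within I G t m ->
  derive_within I (fun r => F r + G r) t (l + m).
Proof.
rewrite /derive_within => H1 H2; apply: cvg_ext (cvgD H1 H2) => r /=.
by rewrite !fctE -mulrDl; congr (_ / _); ring.
Qed.

Lemma is_derive_within I F t l : is_derive t 1 F l -> derive_within I F t l.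
Proof.
move=> [dF <-]; have := dF; rewrite /derivable => /cvgrPdist_le H.
rewrite /derive_within; apply/cvgrPdist_le => e e0; apply/within_dnbhs.
have := H e e0; rewrite /dnbhs near_withinE => -[d /= d0 Hd]; exists d => // r _ rt rd.
have := Hd (r - t); rewrite /ball /= sub0r normrN subr_eq0 => /(_ rd rt).
by rewrite [_ *: 1]mulr1 subrK [_^-1 *: _]mulrC /derive.
Qed.

Lemma derive_withinM I F G t l m : I t -> derive_within I F t l -> derive_within I G t m ->
  derive_within I (fun r => F r * G r) t (l * G t + F t * m).
Proof.
move=> It H1 H2.
have cG : G @ within I t^' --> G t.
  apply/cvgrPdist_le => e e0; have /cvgrPdist_le/(_ _ e0) := derive_within_cvg H2.
  rewrite near_withinE => H; rewrite near_withinE /dnbhs near_withinE.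
  by apply: filterS H => r H _; exact: H.
rewrite /derive_within in H1 H2 *.
apply: cvg_ext (cvgD (cvgM H1 cG) (cvgM (cvg_cst (F t)) H2)) => r /=.
by transitivity ((F r - F t) / (r - t) * G r + F t * ((G r - G t) / (r - t))); [by []|ring].
Qed.

Lemma derive_within_mono a b F (l : R -> R) : a <= b ->
  (forall t, a <= t <= b -> derive_within `[a, b] F t (l t) /\ 0 <= l t) -> F a <= F b.
Proof.
move=> ab H.
have D t : t \in `]a, b[ -> is_derive t 1 F (l t).
  rewrite in_itv/= => /andP[h1 h2]; apply: (@derive_within_is_derive a b); first by rewrite h1.
  by apply: (H _ _).1; rewrite !ltW.
apply: (@ger0_derive1_le_cc _ F a b) => //; rewrite ?in_itv/= ?lexx ?ab//.
- by move=> t /D [].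
- by move=> t tab; rewrite derive1E; have [_ ->] := D t tab; apply: (H _ _).2; move: tab;
  rewrite in_itv/= => /andP[h1 h2]; rewrite !ltW.
- apply/subspace_continuousP => t; rewrite /mkset/= in_itv/= => tab.
  exact: derive_within_cvg (H t tab).1.
Qed.

(** The function e^(- C t) F t is nonincreasing. *)
Lemma gronwall a b F (l : R -> R) (C : R) : a <= b ->
  (forall t, a <= t <= b -> derive_within `[a, b] F t (l t) /\ l t <= C * F t) ->
  F b <= expR (C * (b - a)) * F a.
Proof.
move=> ab H.
have dE : dv (fun r => expR (- C * r)) (fun r => - C * expR (- C * r)).
  have A := dvZ (- C) (@dv_id R).
  have B := dv_comp (@dv_expR R) A.
  by apply: (dv_eq B) => x /=; rewrite mulr1.
have M := derive_within_mono (F := fun r => - (expR (- C * r) * F r))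
  (l := fun t => - (- C * expR (- C * t) * F t + expR (- C * t) * l t)) ab.
have : - (expR (- C * a) * F a) <= - (expR (- C * b) * F b).
  apply: M => t tab; have [Ht lt] := H t tab; split.
    apply: derive_withinN; apply: derive_withinM => //; last exact: is_derive_within.
  have : expR (- C * t) * l t <= expR (- C * t) * (C * F t) by rewrite ler_wpM2l// expR_ge0.
  lra.
rewrite lerN2 => Q.
have := ler_wpM2l (expR_ge0 (C * b)) Q.
rewrite !mulrA -!expRD mulNr subrr expR0 mul1r; congr (_ <= _ * _).
by congr expR; ring.
Qed.

Section Quadratic.
Variables (I : set R) (v : R -> R -> R) (g : R -> R) (t : R).
Hypotheses (It : I t) (sv : forall r, I r -> sqint (v r)) (sg : sqint g).
Let J r := intR (fun x => ((v r x - v t x) / (r - t) - g x) ^+ 2).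
Hypothesis J0 : J @ within I t^' --> (0 : R).
(** An upper bound for the L^2 distance between the difference quotient and g. The summand |r - t|
    makes it positive for r different from t, so that Young's inequality may divide by it. *)
Let del r := Num.sqrt (J r) + `|r - t|.

Let sQ r : I r -> sqint (fun x => (v r x - v t x) / (r - t) - g x).
Proof. by move=> Ir; have := sv Ir; have := sv It => H1 H2; solve_closure. Qed.

Let del0 : del @ within I t^' --> (0 : R).
Proof.
rewrite -[X in _ --> X](addr0 0); apply: cvgD.
  rewrite -[X in _ --> X]sqrtr0; apply: continuous_cvg J0; exact: sqrt_continuous.
have -> : (0 : R) = `|t - t| by rewrite subrr normr0.
apply: cvg_within_filter; apply: cvg_within_filter.
by apply: cvg_norm; apply: cvgB; [exact: cvg_id|exact: cvg_cst].
Qed.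

Let del_gt0 r : r != t -> 0 < del r.
Proof.
by move=> rt; rewrite ltr_wpDl ?sqrtr_ge0// normr_gt0 subr_eq0.
Qed.

Let J_del r : J r <= del r ^+ 2.
Proof.
have J0' : 0 <= J r by apply: int_ge0 => x; exact: sqr_ge0.
rewrite -[leLHS]sqr_sqrtr// lerXn2r ?nnegrE ?addr_ge0 ?sqrtr_ge0//.
by rewrite lerDl.
Qed.

Let young_del (r p q : R) : r != t -> `|2 * p * q| <= del r * p ^+ 2 + q ^+ 2 / del r.
Proof.
move=> /del_gt0; set d := del r => d0.
have e : q = d * (q / d) by rewrite mulrCA divff ?mulr1// gt_eqF.
have -> : q ^+ 2 / d = d * (q / d) ^+ 2.
  rewrite [in LHS]e; move: (q / d) => z; field; by rewrite gt_eqF.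
rewrite [in X in `|X|]e; move: (q / d) => z.
have A : 0 <= d * (p + z) ^+ 2 by rewrite mulr_ge0 ?sqr_ge0// ltW.
have B : 0 <= d * (p - z) ^+ 2 by rewrite mulr_ge0 ?sqr_ge0// ltW.
rewrite !expr2 in A B *; rewrite ler_norml; apply/andP; split; lra.
Qed.

(** With Q = (v r - v t) / (r - t) - g, the quotient of v^2 differs from 2 v g by 2 v Q + (r - t) (Q
    + g)^2. Young's inequality with parameter [del r] makes the integral of this error small with
    Q. *)
Lemma derive_within_quadratic a : cbounded a ->
  derive_within I (fun r => intR (fun x => v r x ^+ 2 * a x)) t (2 * intR (fun x => v t x * g x * a x)).
Proof.
move=> ba; have [ca [A aA]] := ba; have st := sv It.
have A0 : 0 <= A by exact: le_trans (aA 0).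
apply/subr_cvg0.
pose P := intR (fun x => v t x ^+ 2); pose G := intR (fun x => g x ^+ 2).
apply: (@cvg0_le _ _ _ _ _ (fun r => A * (del r * P + del r + 2 * del r * (del r ^+ 2 + G)))).
  apply/within_dnbhs; exists 1 => // r Ir rt _.
  have sr := sv Ir; have sq := sQ Ir.
  set Q := (fun x => _ - g x) in sq.
  have rt0 : r - t != 0 by rewrite subr_eq0.
  have d0 := del_gt0 rt.
  have l1r : cintegrable (fun x => v r x ^+ 2 * a x) by solve_closure.
  have l1t : cintegrable (fun x => v t x ^+ 2 * a x) by solve_closure.
  have l1g : cintegrable (fun x => v t x * g x * a x) by solve_closure.
  have -> : (intR (fun x => v r x ^+ 2 * a x) - intR (fun x => v t x ^+ 2 * a x)) / (r - t) -
      2 * intR (fun x => v t x * g x * a x) =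
      intR (fun x => (r - t)^-1 * (v r x ^+ 2 * a x - v t x ^+ 2 * a x) - 2 * (v t x * g x * a x)).
    rewrite intB; [|exact: itgZ (itgB l1r.2 l1t.2)|exact: itgZ l1g.2].
    rewrite (intZ _ (itgB l1r.2 l1t.2)) (intZ _ l1g.2).
    by rewrite intB; [ring|exact: l1r.2|exact: l1t.2].
  have i0 := itgB (itgZ (r - t)^-1 (itgB l1r.2 l1t.2)) (itgZ 2 l1g.2).
  apply: (le_trans (int_norm i0)).
  have i1 : itg (fun x => A * (del r * v t x ^+ 2 + (del r)^-1 * Q x ^+ 2 +
    2 * del r * (Q x ^+ 2 + g x ^+ 2))).
    by have [_] : cintegrable (fun x => A * (del r * v t x ^+ 2 + (del r)^-1 * Q x ^+ 2 +
      2 * del r * (Q x ^+ 2 + g x ^+ 2))) by solve_closure.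
  apply: (le_trans (int_le (itg_norm i0) i1 _)).
    move=> x.
    have -> : (r - t)^-1 * (v r x ^+ 2 * a x - v t x ^+ 2 * a x) - 2 * (v t x * g x * a x) =
       (2 * v t x * Q x + (r - t) * (Q x + g x) ^+ 2) * a x by rewrite /Q; field.
    rewrite normrM [leRHS]mulrC; apply: ler_pM => //.
    apply: (le_trans (ler_normD _ _)); apply: lerD.
      by rewrite [_^-1 * _]mulrC; exact: young_del.
    rewrite normrM normrX -mulrA [2 * _]mulrCA; apply: ler_pM => //;
      first by rewrite lerDr sqrtr_ge0.
    rewrite real_normK ?num_real//; have := sqr_ge0 (Q x - g x); rewrite !expr2; lra.
  have iv := st.2; have iq := sq.2; have ig := sg.2.
  have ivd := itgZ (del r) iv; have iqd := itgZ (del r)^-1 iq; have iqg := itgD iq ig.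
  rewrite intZ; last exact: itgD (itgD ivd iqd) (itgZ _ iqg).
  rewrite intD; [|exact: itgD ivd iqd|exact: itgZ iqg].
  rewrite intD// !intZ// intD// -/P -/G -/(J r).
  apply: ler_wpM2l => //; have Jd := J_del r.
  apply: lerD; last by rewrite ler_wpM2l ?mulr_ge0 ?lerD2r// ltW.
  by rewrite lerD2l ler_pdivrMl// -expr2.
have -> : (0 : R) = A * (0 * P + 0 + 2 * 0 * (0 * 0 + G)) by ring.
apply: cvgM; first exact: cvg_cst.
apply: cvgD; first by apply: cvgD => //; apply: cvgM => //; exact: cvg_cst.
apply: cvgM; first by apply: cvgM => //; exact: cvg_cst.
apply: cvgD; last exact: cvg_cst.
by rewrite (_ : (fun r => _) = fun r => del r * del r); [exact: cvgM|apply/funext => r;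
  rewrite expr2].
Qed.

Lemma derive_within_linear th : sqint th ->
  derive_within I (fun r => intR (fun x => v r x * th x)) t (intR (fun x => g x * th x)).
Proof.
move=> sth; have st := sv It.
apply/subr_cvg0.
pose P := intR (fun x => th x ^+ 2).
apply: (@cvg0_le _ _ _ _ _ (fun r => del r * P + del r)).
  apply/within_dnbhs; exists 1 => // r Ir rt _.
  have sr := sv Ir; have sq := sQ Ir.
  set Q := (fun x => _ - g x) in sq.
  have rt0 : r - t != 0 by rewrite subr_eq0.
  have d0 := del_gt0 rt.
  have l1r : cintegrable (fun x => v r x * th x) by solve_closure.
  have l1t : cintegrable (fun x => v t x * th x) by solve_closure.
  have l1g : cintegrable (fun x => g x * th x) by solve_closure.
  have lgN2 : cintegrable (fun x => th x * Q x) by solve_closure.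
  have -> : (intR (fun x => v r x * th x) - intR (fun x => v t x * th x)) / (r - t) -
      intR (fun x => g x * th x) = intR (fun x => th x * Q x).
    rewrite mulrC -intB; [|exact: l1r.2|exact: l1t.2].
    rewrite -intZ; last exact: itgB l1r.2 l1t.2.
    rewrite -intB; [|exact: itgZ (itgB l1r.2 l1t.2)|exact: l1g.2].
    by apply: eq_int => x; rewrite /Q; field.
  apply: (le_trans (int_norm lgN2.2)).
  have ith := itgZ (del r) sth.2; have iq := itgZ (del r)^-1 sq.2.
  apply: (le_trans (int_le (itg_norm lgN2.2) (itgD ith iq) _)).
    move=> x; have := young_del (th x) (Q x) rt; rewrite -mulrA normrM [`|2|]ger0_norm//.
    have := normr_ge0 (th x * Q x); rewrite [_^-1 * _]mulrC; lra.
  rewrite intD// !intZ; [|exact: sq.2|exact: sth.2].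
  by rewrite -/P -/(J r) lerD2l ler_pdivrMl// -expr2; exact: J_del.
have -> : (0 : R) = 0 * P + 0 by ring.
by apply: cvgD => //; apply: cvgM => //; exact: cvg_cst.
Qed.

End Quadratic.
End TimeDerivative.

(** * Solutions as families of classical slices *)

Section Flow.
Variable R : realType.
Local Notation mu := (@lebesgue_measure R).
Implicit Types (I : set R).

(** u and u_x carry their time derivatives in L^2; of u_xx only continuity in L^2 is kept, for the
    uniform bound on u_x. *)
Record flow (k : nat) I (u u1 u2 f f1 : R -> R -> R) : Prop := Flow {
  fl_slice : forall t, I t -> slice k (u t) (u1 t) (u2 t) (f t) (f1 t);
  fl_dt : forall t, I t ->
    intR (fun x => ((u r x - u t x) / (r - t) - f t x) ^+ 2) @[r --> within I t^'] --> (0 : R);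
  fl_dt1 : forall t, I t ->
    intR (fun x => ((u1 r x - u1 t x) / (r - t) - f1 t x) ^+ 2) @[r --> within I t^'] --> (0 : R);
  fl_ct2 : forall t, I t ->
    intR (fun x => (u2 r x - u2 t x) ^+ 2) @[r --> within I (nbhs t)] --> (0 : R) }.

Lemma cvg0_norm_sqr {T : Type} (P : set_system T) {FP : Filter P} (N : T -> \bar R) (J : T -> R) :
  N @ P --> 0%E -> (forall t, 0 <= J t) ->
  (\forall t \near P, forall e : R, (N t < e%:E)%E -> J t <= e ^+ 2) -> J @ P --> (0 : R).
Proof.
move=> N0 J0 NJ; apply/cvgrPdist_le => e e0.
pose d := Num.min e 1.
have d0 : 0 < d by rewrite lt_min e0 ltr01.
have X : \forall t \near P, (N t < d%:E)%E by exact: near_lt_ereal.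
apply: filterS2 NJ X => t H /H Jt.
rewrite sub0r normrN ger0_norm//; apply: (le_trans Jt).
have d1 : d <= 1 by rewrite ge_min lexx orbT.
have de : d <= e by rewrite ge_min lexx.
by apply: le_trans de; rewrite expr2 ler_piMl// ltW.
Qed.

Lemma lty_fin (x : \bar R) : (x < +oo)%E -> exists N : R, (x < N%:E)%E.
Proof.
case: x => [r| |] //= h; last by exists 0; rewrite ltNyr.
by exists (r + 1); rewrite lte_fin ltrDl.
Qed.

Lemma dvZr (c : R) (F f : R -> R) : dv F f -> dv (fun x => F x * c) (fun x => f x * c).
Proof.
move=> /(dvZ c) dF; rewrite (_ : (fun x => F x * c) = fun x => c * F x).
  by apply: (dv_eq dF) => x; rewrite mulrC.
by apply/funext => x; rewrite mulrC.
Qed.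

(** Classical derivatives are chosen for each time separately. The H^s norm controls u, u_x and
    u_xx, the H^(s-1) norm controls u_t and u_tx, and the same bounds for differences and difference
    quotients give the continuity and differentiability in time. *)
Lemma flow_exists (k : nat) I (s : R) (u : R -> R -> R) : 3 <= s ->
  C0_sobolev I s u -> (forall t, I t -> continuous (u t)) ->
  solves_equation k I s u -> exists u1 u2 f f1, flow k I u u1 u2 f f1.
Proof.
move=> hs hu cu [ut [hut dtu eqn]].
have s0 : 0 <= s by lra.
have s1 : 1 <= s by lra.
have s2 : 2 <= s by lra.
have p0 : 0 <= s - 1 by lra.
have p1 : 1 <= s - 1 by lra.
pose reg t (w : (R -> R) * (R -> R) * (R -> R) * (R -> R)) := I t ->
  [/\ dv (u t) w.1.1.1, dv w.1.1.1 w.1.1.2, continuous w.1.1.2,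
      {ae mu, forall x, ut t x = w.1.2 x} & dv w.1.2 w.2 /\ continuous w.2 /\
      dv (fun x => w.2 x + (k%:R * u t x ^+ k.-1 * w.1.1.1 x * w.1.1.1 x + u t x ^+ k * w.1.1.2 x))
         (fun x => w.1.2 x + u t x ^+ k * w.1.1.1 x + flux k (u t) w.1.1.1 w.1.1.2 x)].
have X t : exists w, reg t w.
  have [It|nIt] := pselect (I t); last by exists (u t, u t, u t, u t).
  have [ux [uxxx [utxx [wx wxxx wtxx ae]]]] := eqn t It.
  have [u1 [u2 [f [f1 H]]]] := equation_regular (cu t It) wx wxxx wtxx ae.
  by exists (u1, u2, f, f1).
have [W HW] := choice X.
pose u1 t := (W t).1.1.1; pose u2 t := (W t).1.1.2; pose f t := (W t).1.2; pose f1 t := (W t).2.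
have {}HW t (It : I t) : [/\ dv (u t) (u1 t), dv (u1 t) (u2 t), continuous (u2 t),
      {ae mu, forall x, ut t x = f t x} & dv (f t) (f1 t) /\ continuous (f1 t) /\
      dv (fun x => f1 t x + (k%:R * u t x ^+ k.-1 * u1 t x * u1 t x + u t x ^+ k * u2 t x))
         (fun x => f t x + u t x ^+ k * u1 t x + flux k (u t) (u1 t) (u2 t) x)] by exact: HW t It.
exists u1, u2, f, f1; split.
- move=> t It; have [du du1 cu2 utf [df [cf1 dh]]] := HW t It.
  have cu1 := dv_continuous du1; have cf := dv_continuous df.
  have [N hN] := lty_fin (hu t It).1.
  have [N' hN'] := lty_fin (hut t It).1.
  have ae0 : {ae mu, forall x, u t x = u t x} by exact: aeW.
  split => //; split => //.
  + exact: cu.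
  + exact: (sobolev_L2_0 s0 hN ae0 (cu t It)).1.
  + exact: (sobolev_L2_1 s1 hN ae0 du cu1).1.
  + exact: (sobolev_L2_2 s2 hN ae0 du du1 cu2).1.
  + exact: (sobolev_L2_0 p0 hN' utf cf).1.
  + exact: (sobolev_L2_1 p1 hN' utf df cf1).1.
- move=> t It; have [du du1 cu2 utf [df [cf1 dh]]] := HW t It.
  apply: (cvg0_norm_sqr (dtu t It)) => [r|]; first by apply: int_ge0 => x; exact: sqr_ge0.
  apply/within_dnbhs; exists 1 => // r Ir _ _ e hN.
  apply: (sobolev_L2_0 p0 hN _ _).2.
    by apply: ae_imp utf => x ->.
  apply: ctsD; last exact: ctsN (dv_continuous df).
  apply: ctsM; last exact: cts_cst.
  by apply: ctsD; [exact: cu|apply: ctsN; exact: cu].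
- move=> t It; have [du du1 cu2 utf [df [cf1 dh]]] := HW t It.
  apply: (cvg0_norm_sqr (dtu t It)) => [r|]; first by apply: int_ge0 => x; exact: sqr_ge0.
  apply/within_dnbhs; exists 1 => // r Ir _ _ e hN.
  have [dur dur1 _ _ _] := HW r Ir.
  have ae1 : {ae mu, forall x, (u r x - u t x) / (r - t) - ut t x = (u r x - u t x) /
    (r - t) - f t x}.
    by apply: ae_imp utf => x ->.
  apply: (sobolev_L2_1 p1 hN ae1 (dvB (dvZr (r - t)^-1 (dvB dur du)) df) _).2.
  apply: ctsD; last exact: ctsN.
  apply: ctsM; last exact: cts_cst.
  by apply: ctsD; [exact: dv_continuous dur1|apply: ctsN; exact: dv_continuous du1].
- move=> t It; have [du du1 cu2 utf [df [cf1 dh]]] := HW t It.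
  apply: (cvg0_norm_sqr (hu t It).2) => [r|]; first by apply: int_ge0 => x; exact: sqr_ge0.
  rewrite near_withinE; apply: nearW => r Ir e hN.
  have [dur dur1 cur2 _ _] := HW r Ir.
  have ae1 : {ae mu, forall x, u r x - u t x = u r x - u t x} by exact: aeW.
  apply: (sobolev_L2_2 s2 hN ae1 (dvB dur du) (dvB dur1 du1) _).2.
  by apply: ctsD => //; exact: ctsN.
Qed.

Lemma cvg_quadratic {T : Type} (P : set_system T) {FP : Filter P} (v : T -> R -> R) (w : R -> R) :
  (\forall r \near P, sqint (v r)) -> sqint w ->
  intR (fun x => (v r x - w x) ^+ 2) @[r --> P] --> (0 : R) ->
  intR (fun x => v r x ^+ 2) @[r --> P] --> intR (fun x => w x ^+ 2).
Proof.
move=> sv sw J0; apply/cvgrPdist_le => e e0.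
pose Q := intR (fun x => w x ^+ 2).
have Q0 : 0 <= Q by apply: int_ge0 => x; exact: sqr_ge0.
(* One half of e is for eta Q, the other for (1 / eta + 1) J, where J is the integral of (v r -
   w)^2. *)
pose eta := e / 2 / (Q + 1).
have Q1 : 0 < Q + 1 by rewrite ltr_wpDl.
have eta0 : 0 < eta by rewrite !divr_gt0.
have z0 : 0 < eta^-1 + 1 by rewrite addr_gt0// invr_gt0.
have d0 : 0 < e / 2 / (eta^-1 + 1) by rewrite divr_gt0// divr_gt0.
move/cvgrPdist_le/(_ _ d0) : J0; apply: filterS2 sv => r sr.
have sq : sqint (fun x => v r x - w x) by solve_closure.
rewrite sub0r normrN; set J := intR _ => Jd.
have {}Jd : J * (eta^-1 + 1) <= e / 2.
  rewrite -ler_pdivlMr//; apply: le_trans Jd; exact: ler_norm.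
have l1d : cintegrable (fun x => w x ^+ 2 - v r x ^+ 2) by solve_closure.
have l1b : cintegrable (fun x => eta * w x ^+ 2 + (eta^-1 +
  1) * (v r x - w x) ^+ 2) by solve_closure.
rewrite -intB; [|exact: sw.2|exact: sr.2].
apply: (le_trans (int_norm l1d.2)).
apply: (le_trans (int_le (itg_norm l1d.2) l1b.2 _)).
  move=> x; set q := v r x - w x.
  have -> : v r x = w x + q by rewrite /q addrC subrK.
  have -> : w x ^+ 2 - (w x + q) ^+ 2 = - (2 * w x * q) - q ^+ 2 by ring.
  have [z qz] : exists z, q = eta * z.
    by exists (q / eta); rewrite mulrCA divff ?mulr1// gt_eqF.
  have -> : (eta^-1 + 1) * q ^+ 2 = eta * z ^+ 2 + q ^+ 2.
    by rewrite mulrDl mul1r {1}qz; congr (_ + _); field; rewrite gt_eqF.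
  have A : 0 <= eta * (w x + z) ^+ 2 by rewrite mulr_ge0 ?sqr_ge0// ltW.
  have B : 0 <= eta * (w x - z) ^+ 2 by rewrite mulr_ge0 ?sqr_ge0// ltW.
  have C := sqr_ge0 q.
  have -> : 2 * w x * q = 2 * (eta * w x * z) by rewrite qz; ring.
  rewrite !expr2 in A B C *; rewrite ler_norml; apply/andP; split; lra.
rewrite intD; [|exact: itgZ sw.2|exact: itgZ sq.2].
rewrite !intZ; [|exact: sq.2|exact: sw.2].
rewrite -/Q -/J; have : eta * Q <= e / 2.
  have <- : eta * (Q + 1) = e / 2 by rewrite divfK// gt_eqF.
  by rewrite ler_wpM2l ?lerDl// ltW.
move: Jd; lra.
Qed.

Section OnInterval.
Variables (k : nat) (T0 : R) (u u1 u2 f f1 : R -> R -> R).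
Hypotheses (k0 : (0 < k)%N) (T00 : 0 <= T0).
Let I : set R := `[0, T0].
Hypothesis fl : flow k I u u1 u2 f f1.

Let segI t : I t = (0 <= t <= T0) :> Prop.
Proof. by rewrite /I /mkset /= in_itv. Qed.

Let su t : I t -> sqint (u t). Proof. by case/(fl_slice fl). Qed.
Let su1 t : I t -> sqint (u1 t). Proof. by case/(fl_slice fl). Qed.
Let su2 t : I t -> sqint (u2 t). Proof. by case/(fl_slice fl). Qed.
Let sf t : I t -> sqint (f t). Proof. by case/(fl_slice fl). Qed.
Let sf1 t : I t -> sqint (f1 t). Proof. by case/(fl_slice fl). Qed.

Lemma segment_max (F : R -> R) : (forall t, I t -> F @ within I (nbhs t) --> F t) ->
  exists A : R, forall t, I t -> F t <= A.
Proof.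
move=> cF; have /(EVT_max T00) [c _ H] : {within `[0, T0], continuous F}.
  by apply/subspace_continuousP.
by exists (F c) => t It; apply: H; rewrite in_itv/=; rewrite -segI.
Qed.

(** The L^2 norms of u, u_x and u_xx are continuous in time, hence bounded on the compact interval,
    and [sqint_sup] turns them into bounds of u and u_x. *)
Lemma flow_bounded : exists2 M : R, 1 <= M &
  forall t, I t -> forall x, `|u t x| <= M /\ `|u1 t x| <= M.
Proof.
have [A hA] : exists A : R, forall t, I t -> intR (fun x => u t x ^+ 2 * 1) <= A.
  apply: segment_max => t It.
  exact: derive_within_cvg (derive_within_quadratic It su (sf It) (fl_dt fl It) (cbounded_cst 1)).
have [B hB] : exists A : R, forall t, I t -> intR (fun x => u1 t x ^+ 2 * 1) <= A.
  apply: segment_max => t It.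
  exact: derive_within_cvg (derive_within_quadratic It su1 (sf1 It) (fl_dt1 fl It) (cbounded_cst 1)).
have [C hC] : exists A : R, forall t, I t -> intR (fun x => u2 t x ^+ 2) <= A.
  apply: segment_max => t It.
  apply: cvg_quadratic (su2 It) (fl_ct2 fl It).
  by rewrite near_withinE; apply: nearW.
have I0 : I 0 by rewrite segI lexx.
have m1 (g : R -> R) : intR (fun x => g x ^+ 2 * 1) = intR (fun x => g x ^+ 2).
  by apply: eq_int => x; rewrite mulr1.
have i0 (g : R -> R) : 0 <= intR (fun x => g x ^+ 2) by apply: int_ge0 => x; exact: sqr_ge0.
have A0 : 0 <= A by apply: le_trans (hA 0 I0); rewrite m1.
have B0 : 0 <= B by apply: le_trans (hB 0 I0); rewrite m1.
have C0 : 0 <= C by exact: le_trans (hC 0 I0).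
exists (1 + (A + B + C)) => [|t It x]; first by lra.
have [du du1 _ _ _ _ _ _ _] := fl_slice fl It.
have := hA t It; have := hB t It; have := hC t It; rewrite !m1 => c b a.
have sq (z D : R) : 0 <= D -> z ^+ 2 <= D -> z <= 1 + D.
  by move=> D0; have := sqr_ge0 (z - 1); rewrite !expr2; nra.
have := sqint_sup (su It) (su1 It) du x; have := sqint_sup (su1 It) (su2 It) du1 x.
move=> h1 h2; split.
  apply: (le_trans (sq _ (A + B) _ _)); [exact: addr_ge0|lra|lra].
apply: (le_trans (sq _ (B + C) _ _)); [exact: addr_ge0|lra|lra].
Qed.

Let E (psi : R -> R) t := intR (fun x => (u t x ^+ 2 + u1 t x ^+ 2) * psi x).

Let ES psi t : cbounded psi -> I t ->
  E psi t = intR (fun x => u t x ^+ 2 * psi x) + intR (fun x => u1 t x ^+ 2 * psi x).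
Proof.
move=> bpsi It; have a := su It; have b := su1 It.
have la : cintegrable (fun x => u t x ^+ 2 * psi x) by solve_closure.
have lb : cintegrable (fun x => u1 t x ^+ 2 * psi x) by solve_closure.
rewrite -intD; [|exact: la.2|exact: lb.2].
by apply: eq_int => x; ring.
Qed.

Lemma flow_growth : exists2 K : R, 0 <= K & forall psi psi', weight psi psi' ->
  forall t, I t -> E psi t <= K * E psi 0.
Proof.
have [M M1 uM] := flow_bounded.
pose C := 2 * energy_cst k M.
have C0 : 0 <= C.
  rewrite /C /energy_cst; set B := 2 * _ * _.
  have B0 : 0 <= B by rewrite /B !mulr_ge0// exprn_ge0// (le_trans _ M1).
  have := sqr_ge0 B; lra.
exists (expR (C * T0)) => [|psi psi' w t It]; first exact: expR_ge0.
have bpsi : cbounded psi by case: w.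
have psi0 x : 0 <= psi x by case: w => _ _ _ /(_ x) [].
have /andP[t0 tT] : 0 <= t <= T0 by rewrite -segI.
have sub r : 0 <= r <= t -> I r by rewrite segI => /andP[-> /le_trans ->].
have I0 : I 0 by apply: sub; rewrite lexx.
have := @gronwall R 0 t (fun r => intR (fun x => u r x ^+ 2 * psi x) +
  intR (fun x => u1 r x ^+ 2 * psi x))
  (fun r => 2 * intR (fun x => u r x * f r x * psi x) +
    2 * intR (fun x => u1 r x * f1 r x * psi x)) C t0.
rewrite -!ES// subr0 => G; apply: (le_trans (G _)).
  move=> r /sub Ir; split.
    apply: derive_withinD; apply: (@derive_within_sub _ _ I).
    - by move=> z; rewrite /mkset /= in_itv /= => /sub.
    - have := derive_within_quadratic Ir su (sf Ir) (fl_dt fl Ir) bpsi; exact.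
    - by move=> z; rewrite /mkset /= in_itv /= => /sub.
    - have := derive_within_quadratic Ir su1 (sf1 Ir) (fl_dt1 fl Ir) bpsi; exact.
  rewrite -ES// -mulrDr /C -mulrA ler_pM2l//.
  have sl := fl_slice fl Ir.
  have := static_energy k0 M1 sl (fun x => (uM r Ir x).1) (fun x => (uM r Ir x).2) w.
  apply: le_trans.
  have a := su Ir; have b := su1 Ir; have c := sf Ir; have d := sf1 Ir.
  have la : cintegrable (fun x => u r x * f r x * psi x) by solve_closure.
  have lb : cintegrable (fun x => u1 r x * f1 r x * psi x) by solve_closure.
  rewrite -intD; [|exact: la.2|exact: lb.2].
  by rewrite le_eqVlt; apply/orP; left; apply/eqP; apply: eq_int => x; ring.
apply: ler_wpM2r.
  by apply: int_ge0 => x; rewrite mulr_ge0// addr_ge0// sqr_ge0.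
by rewrite ler_expR ler_wpM2l.
Qed.

Lemma flow_unique : (forall x, u 0 x = 0) -> forall t x, I t -> u t x = 0.
Proof.
move=> u00 t x It.
have I0 : I 0 by rewrite segI lexx.
have u10 y : u1 0 y = 0.
  have [du _ _ _ _ _ _ _ _] := fl_slice fl I0.
  have z : dv (u 0) (fun=> 0) by rewrite (funext u00); exact: dv_cst.
  by rewrite (dv_unique du z).
have w1 : weight (fun _ : R => (1 : R)) (fun=> 0).
  split; [exact: dv_cst|exact: cbounded_cst|exact: cbounded_cst|].
  by move=> y; rewrite normr0 mulr1; split.
have [K K0 G] := flow_growth.
have := G _ _ w1 t It.
have -> : E (fun=> 1) 0 = 0.
  rewrite -[RHS]int0; apply: eq_int => y; rewrite u00 u10 !expr2; ring.
rewrite mulr0 => E0.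
have a := su It; have b := su1 It.
have l : cintegrable (fun y => (u t y ^+ 2 + u1 t y ^+ 2) * 1) by solve_closure.
have P y : 0 <= (u t y ^+ 2 + u1 t y ^+ 2) * 1 by rewrite mulr1 addr_ge0// sqr_ge0.
have /eqP := int_eq0 l.1 P l.2 E0 x.
by rewrite mulr1 paddr_eq0 ?sqr_ge0// => /andP[]; rewrite sqrf_eq0 => /eqP.
Qed.

End OnInterval.
End Flow.

(** * Logistic weights *)

Section Logistic.
Variable R : realType.
Local Notation mu := (@lebesgue_measure R).

Definition logistic (y : R) : R := (1 + expR (- y))^-1.

Let den_gt0 (y : R) : 0 < 1 + expR (- y). Proof. by rewrite addr_gt0// expR_gt0. Qed.

Lemma logistic_gt0 y : 0 < logistic y.
Proof. by rewrite invr_gt0. Qed.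

Lemma one_sub_logistic y : 1 - logistic y = expR (- y) * logistic y.
Proof. by rewrite /logistic; field; rewrite gt_eqF. Qed.

Lemma one_sub_logistic_gt0 y : 0 < 1 - logistic y.
Proof. by rewrite one_sub_logistic mulr_gt0 ?expR_gt0// logistic_gt0. Qed.

Lemma logistic_norm y : `|logistic y| <= 1.
Proof.
by rewrite ger0_norm ?(ltW (logistic_gt0 y))//; have := one_sub_logistic_gt0 y; lra.
Qed.

Lemma dv_logistic : dv logistic (fun y => logistic y * (1 - logistic y)).
Proof.
have A := dv_comp (@dv_expR R) (dvN (@dv_id R)).
have B := dvV (dvD (@dv_cst R 1) A) (fun y => lt0r_neq0 (den_gt0 y)).
apply: (dv_eq B) => y /=; rewrite one_sub_logistic /logistic.
by field; rewrite gt_eqF.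
Qed.

Lemma logistic_sub_le y : logistic y * (1 - logistic y) <= damp 1 y.
Proof.
have s0 := logistic_gt0 y; have s1 := one_sub_logistic_gt0 y.
rewrite /damp mul1r; have [y0|y0] := leP 0 y.
  rewrite ger0_norm// one_sub_logistic mulrCA -[leRHS]mulr1 ler_wpM2l ?expR_ge0//.
  have : logistic y <= 1 by lra.
  by move=> h; rewrite mulr_ile1// ltW.
rewrite ltr0_norm// opprK; apply: (@le_trans _ _ (logistic y)).
  by rewrite ler_piMr// ltW//; lra.
rewrite /logistic -[expR y]invrK -expRN lef_pV2 ?posrE ?expR_gt0//.
by rewrite lerDr.
Qed.

Section Bump.
Variable N : R.

Definition lgN x := logistic (x - N).
Definition lgN2 x := logistic ((x - N) / 2).
(** Equal to e^x / (1 + e^(x - N))^2: close to e^x far to the left of N, decaying to its right, and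
    visibly increasing in N. *)
Definition phi x := expR N * (lgN x * (1 - lgN x)).
Definition phi' x := phi x * (1 - 2 * lgN x).
(* [theta = phi - phi''], see [dv_phi']. *)
Definition theta x := 6 * expR N * (lgN x * (1 - lgN x)) ^+ 2.
(* The logistic function of half speed is what gives [|chi'| <= 3/2 chi]; the error
   term [e^N p^2 (1 - p)], with [p := lgN], violates this bound. *)
Definition chi x := expR N * (lgN2 x ^+ 3 * (1 - lgN2 x) ^+ 2).

Lemma dv_lgN : dv lgN (fun x => lgN x * (1 - lgN x)).
Proof.
have A := dv_comp dv_logistic (dvB (@dv_id R) (@dv_cst R N)).
by apply: (dv_eq A) => x; rewrite subr0 mul1r.
Qed.

Lemma dv_lgN2 : dv lgN2 (fun x => 1 / 2 * (lgN2 x * (1 - lgN2 x))).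
Proof.
have A := dv_comp dv_logistic (dvZr 2^-1 (dvB (@dv_id R) (@dv_cst R N))).
by apply: (dv_eq A) => x; rewrite subr0.
Qed.

Lemma cbounded_lgN : cbounded lgN.
Proof. by split; [exact: dv_continuous dv_lgN|exists 1 => x; exact: logistic_norm]. Qed.

Lemma cbounded_lgN2 : cbounded lgN2.
Proof. by split; [exact: dv_continuous dv_lgN2|exists 1 => x; exact: logistic_norm]. Qed.

Lemma sqint_lgN : sqint (fun x => lgN x * (1 - lgN x)).
Proof.
have b := cbounded_lgN;
  have c : cbounded (fun x => (lgN x * (1 - lgN x)) * (lgN x * (1 - lgN x))) by solve_closure.
split; first by have [] : cbounded (fun x => lgN x * (1 - lgN x)) by solve_closure.
apply: (itg_dom (g := fun x => damp 1 (x + - N))).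
- by under eq_fun do rewrite expr2; exact: cont_measurable c.1.
- move=> x; have s0 := logistic_gt0 (x - N); have s1 := one_sub_logistic_gt0 (x - N).
  rewrite ger0_norm ?sqr_ge0//; apply: le_trans (logistic_sub_le (x - N)).
  rewrite /lgN; move: s0 s1; set P := logistic _ => s0 s1.
  have A0 : 0 <= P * (1 - P) by rewrite mulr_ge0// ltW.
  by rewrite expr2 ler_piMl//; nra.
- exact: itg_shift (poisson_kernel 0 (@ltr01 R)).1.
Qed.

Lemma dv_phi : dv phi phi'.
Proof.
have A := dvZ (expR N) (dvM dv_lgN (dvB (@dv_cst R 1) dv_lgN)).
by apply: (dv_eq A) => x; rewrite /phi' /phi; ring.
Qed.

Lemma dv_phi' : dv phi' (fun x => phi x - theta x).
Proof.
have A := dvM dv_phi (dvB (@dv_cst R 1) (dvZ 2 dv_lgN)).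
by apply: (dv_eq A) => x; rewrite /phi' /theta /phi; ring.
Qed.

Definition theta' x := 12 * expR N * (lgN x * (1 - lgN x)) ^+ 2 * (1 - 2 * lgN x).

Lemma dv_theta : dv theta theta'.
Proof.
have A := dvZ (6 * expR N) (dvX 2 (dvM dv_lgN (dvB (@dv_cst R 1) dv_lgN))).
by apply: (dv_eq A) => x; rewrite /theta' /= expr1; ring.
Qed.

Lemma cbounded_phi : cbounded phi. Proof. by have b := cbounded_lgN; rewrite /phi;
  solve_closure. Qed.
Lemma cbounded_chi : cbounded chi. Proof. by have b := cbounded_lgN2; rewrite /chi;
  solve_closure. Qed.
Lemma sqint_phi : sqint phi.
Proof. by have s := sqint_lgN; rewrite /phi; solve_closure. Qed.
Lemma sqint_phi' : sqint phi'.
Proof. by have s := sqint_phi; have b := cbounded_lgN; rewrite /phi'; solve_closure. Qed.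
Lemma cbounded_theta : cbounded theta. Proof. by have b := cbounded_lgN; rewrite /theta;
  solve_closure. Qed.
Lemma cbounded_theta' : cbounded theta'. Proof. by have b := cbounded_lgN; rewrite /theta';
  solve_closure. Qed.
Lemma sqint_theta : sqint theta.
Proof.
have s := sqint_lgN; have b := cbounded_lgN.
rewrite (_ : theta = fun x => 6 * expR N * ((lgN x * (1 - lgN x)) * (lgN x * (1 - lgN x)))).
  by solve_closure.
by apply/funext => x; rewrite /theta expr2.
Qed.

Lemma chi_ge0 x : 0 <= chi x.
Proof. by rewrite mulr_ge0 ?expR_ge0// mulr_ge0 ?sqr_ge0// exprn_ge0// ltW// logistic_gt0. Qed.

(** As q = [lgN2 x] runs through (0, 1), the factor (3 - 5 q) / 2 runs through (-1, 3/2). *)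
Lemma weight_chi : weight chi (fun x => 1 / 2 * (3 - 5 * lgN2 x) * chi x).
Proof.
have b := cbounded_lgN2; have c := cbounded_chi; split => //.
- have A := dvZ (expR N) (dvM (dvX 3 dv_lgN2) (dvX 2 (dvB (@dv_cst R 1) dv_lgN2))).
  by apply: (dv_eq A) => x; rewrite /chi /=; field.
- by solve_closure.
- move=> x; split; first exact: chi_ge0.
  rewrite normrM [`|chi x|]ger0_norm ?chi_ge0// ler_wpM2r ?chi_ge0//.
  have s0 := logistic_gt0 ((x - N) / 2); have s1 := one_sub_logistic_gt0 ((x - N) / 2).
  by rewrite ler_norml /lgN2; lra.
Qed.

(** With w = e^(-(x - N) / 2) the claim reads (1 + w)^5 <= 8 (1 + w^2)^3. It follows from (1 + w)^2
    <= 2 (1 + w^2), and 8 is the cube of this 2. *)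
Lemma lgN_le_lgN2 x : lgN x ^+ 2 * (1 - lgN x) <= 8 * (lgN2 x ^+ 3 * (1 - lgN2 x) ^+ 2).
Proof.
rewrite /lgN /lgN2 !one_sub_logistic /logistic.
have -> : - (x - N) = - ((x - N) / 2) + - ((x - N) / 2) by field.
rewrite expRD; set w := expR _.
have w0 : 0 < w by exact: expR_gt0.
have a0 : 0 < 1 + w * w by rewrite addr_gt0// mulr_gt0.
have b0 : 0 < 1 + w by rewrite addr_gt0.
have -> : (1 + w * w)^-1 ^+ 2 * (w * w * (1 + w * w)^-1) = w ^+ 2 / (1 + w * w) ^+ 3.
  by field; rewrite gt_eqF.
have -> : 8 * ((1 + w)^-1 ^+ 3 * (w * (1 + w)^-1) ^+ 2) = w ^+ 2 * 8 / (1 + w) ^+ 5.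
  by field; rewrite gt_eqF.
rewrite -[leRHS]mulrA ler_wpM2l ?sqr_ge0//.
rewrite ler_pdivlMr ?exprn_gt0// mulrC ler_pdivrMr ?exprn_gt0//.
apply: (@le_trans _ _ ((1 + w) ^+ 6)).
  by rewrite [leRHS]exprS ler_peMl ?exprn_ge0 ?ltW// ltrDl.
rewrite -[6%N]/(2 * 3)%N exprM; have -> : 8 * (1 + w * w) ^+ 3 = (2 * (1 + w * w)) ^+ 3 by ring.
have a2 : 0 <= 2 * (1 + w * w) by rewrite mulr_ge0// ltW.
rewrite lerXn2r ?nnegrE ?sqr_ge0//.
by have := sqr_ge0 (1 - w); rewrite !expr2; lra.
Qed.

(* Both sides differ by the integral of the derivative of
   h phi' - h' phi + 3/2 u_x^2 phi + 1/2 u^2 theta. *)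
Lemma slice1_identity u u1 u2 f f1 : slice 1 u u1 u2 f f1 ->
  intR (fun x => f x * theta x) =
  intR (fun x => 3 / 2 * (u1 x ^+ 2 * phi' x) + 1 / 2 * (u x ^+ 2 * theta' x)).
Proof.
move=> sl; have [bu bu1] := slice_cbounded sl; case: sl => du du1 df dh su su1 su2 sf sf1.
have bph := cbounded_phi; have sph := sqint_phi; have sph' := sqint_phi'.
have bth := cbounded_theta; have bth' := cbounded_theta'; have sth := sqint_theta.
pose h x := f x + u x * u1 x.
pose h1 x := f1 x + (u1 x * u1 x + u x * u2 x).
have sh : sqint h by rewrite /h; solve_closure.
have sh1 : sqint h1 by rewrite /h1; solve_closure.
have dhh : dv h h1 by exact: dvD df (dvM du du1).
have dh1 : dv h1 (fun x => h x + 3 * (u1 x * u2 x)).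
  have e : (fun x => f1 x + (1%:R * u x ^+ 1.-1 * u1 x * u1 x + u x ^+ 1 * u2 x)) = h1.
    by apply/funext => x; rewrite /h1 /= expr0 expr1 !mul1r.
  rewrite -e; apply: (dv_eq dh) => x; rewrite /h /flux /= expr0 expr1; ring.
pose F x := h x * phi' x - h1 x * phi x + 3 / 2 * (u1 x * u1 x * phi x) + 1 /
  2 * (u x * u x * theta x).
pose F' x := 3 / 2 * (u1 x ^+ 2 * phi' x) + 1 / 2 * (u x ^+ 2 * theta' x) - f x * theta x.
have bp := cbounded_lgN.
have bph' : cbounded phi' by rewrite /phi'; solve_closure.
have lF : cintegrable F by rewrite /F; solve_closure.
have la : cintegrable (fun x => 3 / 2 * (u1 x ^+ 2 * phi' x) + 1 /
  2 * (u x ^+ 2 * theta' x)) by solve_closure.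
have lb : cintegrable (fun x => f x * theta x) by solve_closure.
have lF' : cintegrable F' by rewrite /F'; solve_closure.
have dF : dv F F'.
  have A := dvB (dvM dhh dv_phi') (dvM dh1 dv_phi).
  have B := dvZ (3/2) (dvM (dvM du1 du1) dv_phi).
  have C := dvZ (1/2) (dvM (dvM du du) dv_theta).
  apply: (dv_eq (dvD (dvD A B) C)) => x; by rewrite /F' /h /h1; field.
have := int_deriv0 dF lF'.1 lF.2 lF'.2.
rewrite /F' intB; [|exact: la.2|exact: lb.2].
by move/eqP; rewrite subr_eq0 => /eqP ->.
Qed.

(** Since phi' = phi - 2 e^N p^2 (1 - p), replacing phi' by phi costs 3 u_x^2 e^N p^2 (1 - p), at
    most 24 u_x^2 chi. The term with theta' is at least - 6 u^2 e^N (p (1 - p))^2, hence at least -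
    48 u^2 chi. The factor 8 of [lgN_le_lgN2] enters both times. *)
Lemma slice1_lower u u1 u2 f f1 : slice 1 u u1 u2 f f1 ->
  3 / 2 * intR (fun x => u1 x ^+ 2 * phi x) - 48 * intR (fun x => (u x ^+ 2 + u1 x ^+ 2) * chi x)
  <= intR (fun x => f x * theta x).
Proof.
move=> sl; rewrite (slice1_identity sl).
have su := sl_u sl; have su1 := sl_u1 sl.
have bph := cbounded_phi; have bth' := cbounded_theta'; have bch := cbounded_chi;
  have bp := cbounded_lgN.
have bph' : cbounded phi' by rewrite /phi'; solve_closure.
have l1a : cintegrable (fun x => u1 x ^+ 2 * phi x) by solve_closure.
have l1b : cintegrable (fun x => (u x ^+ 2 + u1 x ^+ 2) * chi x) by solve_closure.
have l1c : cintegrable (fun x => 3 / 2 * (u1 x ^+ 2 * phi' x) + 1 /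
  2 * (u x ^+ 2 * theta' x)) by solve_closure.
have ia := itgZ (3/2) l1a.2; have ib := itgZ 48 l1b.2.
rewrite -(intZ _ l1a.2) -(intZ _ l1b.2) -intB//.
apply: int_le; [exact: itgB|exact: l1c.2|] => x.
have H := lgN_le_lgN2 x.
have p0 : 0 < lgN x by exact: logistic_gt0.
have p1 : 0 < 1 - lgN x by exact: one_sub_logistic_gt0.
have e0 := expR_gt0 N.
have H1 : expR N * (lgN x ^+ 2 * (1 - lgN x)) <= 8 * chi x.
  by rewrite /chi [leRHS]mulrCA ler_wpM2l// ltW.
have H2 : expR N * (lgN x * (1 - lgN x)) ^+ 2 <= expR N * (lgN x ^+ 2 * (1 - lgN x)).
  apply: ler_wpM2l; first exact: ltW.
  rewrite exprMn ler_wpM2l ?sqr_ge0// expr2; nra.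
have H3 : - (8 * chi x) <= expR N * (lgN x * (1 - lgN x)) ^+ 2 * (1 - 2 * lgN x).
  set B := expR N * _ in H2 *.
  have B0 : 0 <= B by rewrite mulr_ge0 ?sqr_ge0// ltW.
  have : 0 <= B * (2 * (1 - lgN x)) by rewrite mulr_ge0// mulr_ge0// ltW.
  have -> : B * (2 * (1 - lgN x)) = B * (1 - 2 * lgN x) + B by ring.
  by move: H1 H2; lra.
have U0 := sqr_ge0 (u x); have U1 := sqr_ge0 (u1 x).
have J1 := ler_wpM2l U1 H1; have J3 := ler_wpM2l U0 H3.
have C0 := mulr_ge0 U1 (chi_ge0 x).
rewrite /phi' /theta' /phi.
rewrite [(u x ^+ 2 + _) * _]mulrDl; move: J1 J3 C0; set a := u1 x ^+ 2; set b := u x ^+ 2;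
  set c := chi x.
set P := lgN x => J1 J3 C0.
have -> : 3 / 2 * (a * (expR N * (P * (1 - P)) * (1 - 2 * P))) =
  3 / 2 * (a * (expR N * (P * (1 - P)))) - 3 * (a * (expR N * (P ^+ 2 * (1 - P)))) by field.
have -> : 1 / 2 * (b * (12 * expR N * (P * (1 - P)) ^+ 2 * (1 - 2 * P))) =
  6 * (b * (expR N * (P * (1 - P)) ^+ 2 * (1 - 2 * P))) by field.
lra.
Qed.

Lemma phi_gt0 x : 0 < phi x.
Proof.
by rewrite mulr_gt0 ?expR_gt0// mulr_gt0 ?logistic_gt0 ?one_sub_logistic_gt0.
Qed.

End Bump.

Lemma phi_mono (N x : R) : 0 <= N -> phi 0 x <= phi N x.
Proof.
move=> N0; rewrite /phi /lgN !one_sub_logistic subr0 expR0 mul1r /logistic.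
rewrite opprB expRD; set z := expR (- x); set E := expR N.
have z0 : 0 < z by exact: expR_gt0.
have E1 : 1 <= E by rewrite -expR0 ler_expR.
have E0 : 0 < E by exact: lt_le_trans E1.
have -> : (1 + z)^-1 * (z * (1 + z)^-1) = z / (1 + z) ^+ 2.
  by field; rewrite gt_eqF// addr_gt0.
have -> : E * ((1 + E * z)^-1 * (E * z * (1 + E * z)^-1)) = z / ((1 + E * z) / E) ^+ 2.
  have k1 : 1 + E * z != 0 by rewrite gt_eqF// addr_gt0// mulr_gt0.
  have k2 : E != 0 by rewrite gt_eqF.
  by field; rewrite k1 k2.
have -> : (1 + E * z) / E = E^-1 + z.
  by have k2 : E != 0 by [rewrite gt_eqF]; field.
have EV : 0 < E^-1 by rewrite invr_gt0.
apply: ler_wpM2l; first exact: ltW.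
rewrite lef_pV2 ?posrE ?exprn_gt0 ?addr_gt0//.
have z1 : 0 <= 1 + z by rewrite addr_ge0// ltW.
have z2 : 0 <= E^-1 + z by rewrite addr_ge0// ltW.
rewrite lerXn2r ?nnegrE//.
have : E^-1 <= 1 by rewrite invf_le1.
lra.
Qed.

(** With w = e^(-(x - N) / 2), e^N = e^x w^2 and chi = e^x w^4 / (1 + w)^5, a fraction at most 1 and
    at most 1 / w. The first bound is the majorant, the second the pointwise convergence to 0, in
    [int_chi_cvg0]. *)
Lemma chi_le (N x : R) : chi N x <= expR x /\ chi N x <= expR x * expR ((x - N) / 2).
Proof.
rewrite /chi /lgN2 one_sub_logistic /logistic.
have -> : expR N = expR x * (expR (- ((x - N) / 2)) * expR (- ((x - N) / 2))).
  by rewrite -!expRD; congr expR; field.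
have -> : expR ((x - N) / 2) = (expR (- ((x - N) / 2)))^-1 by rewrite expRN invrK.
set w := expR (- _); set E := expR x.
have w0 : 0 < w by exact: expR_gt0.
have b0 : 0 < 1 + w by rewrite addr_gt0.
have -> : E * (w * w) * ((1 + w)^-1 ^+ 3 * (w * (1 + w)^-1) ^+ 2) = E * (w ^+ 4 / (1 + w) ^+ 5).
  by field; rewrite gt_eqF.
have w4 : w ^+ 4 <= (1 + w) ^+ 4 by rewrite lerXn2r ?nnegrE ?ltW// ltrDr.
have w5 : w ^+ 5 <= (1 + w) ^+ 5 by rewrite lerXn2r ?nnegrE ?ltW// ltrDr.
split.
  rewrite -[leRHS]mulr1 ler_wpM2l ?expR_ge0// ler_pdivrMr ?exprn_gt0// mul1r.
  apply: (le_trans w4); rewrite [leRHS]exprS ler_peMl ?exprn_ge0 ?ltW// ltrDl//.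
rewrite ler_wpM2l ?expR_ge0// ler_pdivrMr ?exprn_gt0//.
by rewrite mulrC ler_pdivlMr// -exprSr.
Qed.

End Logistic.

(** * Decay at infinity *)

Section Decay.
Variable R : realType.
Local Notation mu := (@lebesgue_measure R).
Implicit Types (v : R -> R).

(** To the right of X0 >= 0 the integrand is at most C^2 e^((1 - 2 a) x), with a negative exponent;
    to the left e^x <= e^X0. *)
Lemma itg_exp_weight v (a C X : R) : sqint v -> 1 < 2 * a ->
  (forall x, X <= x -> `|v x| <= C * expR (- (a * x))) ->
  itg (fun x => v x ^+ 2 * expR x).
Proof.
move=> [cv iv] a1 hv.
have [X0 X0X hX] : exists2 X0, 0 <= X0 & forall x, X0 <= x -> `|v x| <= C * expR (- (a * x)).
  exists (Num.max X 0); first by rewrite le_max lexx orbT.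
  by move=> x; rewrite ge_max => /andP[/hv].
have b0 : 0 < 2 * a - 1 by rewrite subr_gt0.
apply: (itg_dom (g := fun x => expR X0 * v x ^+ 2 + C ^+ 2 * damp (2 * a - 1) x)).
- apply: cont_measurable; apply: ctsM; first exact: ctsX.
  exact: continuous_expR.
- move=> x; rewrite ger0_norm; last by apply: mulr_ge0; [exact: sqr_ge0|exact: expR_ge0].
  have d0 : 0 <= C ^+ 2 * damp (2 * a - 1) x by apply: mulr_ge0; [exact: sqr_ge0|exact: damp_ge0].
  have e0 : 0 <= expR X0 * v x ^+ 2 by apply: mulr_ge0; [exact: expR_ge0|exact: sqr_ge0].
  have [xX|xX] := leP x X0.
    apply: (@le_trans _ _ (expR X0 * v x ^+ 2)); last by rewrite lerDl.
    by rewrite mulrC ler_wpM2r ?sqr_ge0// ler_expR.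
  apply: (@le_trans _ _ (C ^+ 2 * damp (2 * a - 1) x)); last by rewrite lerDr.
  have x0 : 0 <= x by exact: le_trans (ltW xX).
  have H := hX x (ltW xX).
  have {}H : v x ^+ 2 <= (C * expR (- (a * x))) ^+ 2.
    rewrite -real_normK ?num_real// lerXn2r ?nnegrE//.
    exact: le_trans H.
  apply: (le_trans (ler_wpM2r (expR_ge0 x) H)).
  rewrite /damp (ger0_norm x0) exprMn -[leLHS]mulrA; apply: ler_wpM2l; first exact: sqr_ge0.
  by rewrite expr2 -!expRD ler_expR; lra.
- by apply: itgD; apply: itgZ => //; exact: (poisson_kernel 0 b0).1.
Qed.

Lemma sim_o_bound v : sim_o v (fun x => expR (- x)) ->
  exists X, forall x, X <= x -> `|v x| <= 1 * expR (- (1 * x)).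
Proof.
move=> /cvgrPdist_le/(_ _ ltr01) [X [_ H]]; exists (X + 1) => x Xx.
have Hx : X < x by lra.
have := H x Hx; rewrite sub0r normrN ger0_norm; last by rewrite mulr_ge0// invr_ge0 expR_ge0.
by rewrite ler_pdivrMr ?expR_gt0// !mul1r.
Qed.

Lemma sim_O_bound v (a : R) : sim_O v (fun x => expR (- (a * x))) ->
  exists C X, forall x, X <= x -> `|v x| <= C * expR (- (a * x)).
Proof.
move=> [L /cvgrPdist_le/(_ _ ltr01) [X [_ H]]]; exists (L + 1), (X + 1) => x Xx.
rewrite -ler_pdivrMr ?expR_gt0//.
have Hx : X < x by lra.
by have := H x Hx; rewrite /= ler_norml => /andP[]; lra.
Qed.

Lemma sim_o_cvg v : sim_o v (fun x => expR (- x)) -> v x * expR x @[x --> +oo] --> (0 : R).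
Proof.
move=> H; apply: cvg0_le H; apply: nearW => x.
by rewrite expRN invrK normrM [`|expR x|]ger0_norm ?expR_ge0.
Qed.

(** Gives e^(- n / 2) <= 2 / (n + 1), so that the harmonic sequence serves as a majorant. *)
Lemma half_le_expR (n : nat) : 2^-1 * n.+1%:R <= expR (n%:R / 2) :> R.
Proof.
apply: le_trans (expR_ge1Dx _); rewrite -(natr1 n).
have : 0 <= n%:R :> R by [].
lra.
Qed.

Lemma int_chi_cvg0 v v1 : sqint v -> sqint v1 ->
  itg (fun x => (v x ^+ 2 + v1 x ^+ 2) * expR x) ->
  intR (fun x => (v x ^+ 2 + v1 x ^+ 2) * chi n%:R x) @[n --> \oo] --> (0 : R).
Proof.
move=> sv sv1 iv; rewrite -(@int0 R).
have P x : 0 <= v x ^+ 2 + v1 x ^+ 2 by rewrite addr_ge0 ?sqr_ge0.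
have Q n x : 0 <= (v x ^+ 2 + v1 x ^+ 2) * chi n%:R x by apply: mulr_ge0 => //; exact: chi_ge0.
apply: (int_dct (g := fun x => (v x ^+ 2 + v1 x ^+ 2) * expR x)).
- move=> n; have c := cbounded_chi (n%:R : R).
  by have [/cont_measurable] : cintegrable (fun x => (v x ^+ 2 +
    v1 x ^+ 2) * chi n%:R x) by solve_closure.
- exact: measurable_cst.
- apply: aeW => x.
  apply: (@cvg0_le _ _ _ _ _ (fun n => (v x ^+ 2 + v1 x ^+ 2) * (expR x * (expR (x /
    2) * (2 * harmonic n))))).
    apply: nearW => n; rewrite ger0_norm//.
    rewrite ler_wpM2l//; apply: (le_trans (chi_le n%:R x).2).
    rewrite ler_wpM2l ?expR_ge0// mulrBl expRD ler_wpM2l ?expR_ge0//.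
    rewrite expRN /harmonic /= -[2 in leRHS]invrK -invfM lef_pV2 ?posrE ?expR_gt0 ?mulr_gt0 ?invr_gt0//.
    exact: half_le_expR.
  rewrite -(mulr0 (v x ^+ 2 + v1 x ^+ 2)); apply: cvgM; first exact: cvg_cst.
  rewrite -(mulr0 (expR x)); apply: cvgM; first exact: cvg_cst.
  rewrite -(mulr0 (expR (x / 2))); apply: cvgM; first exact: cvg_cst.
  rewrite -(mulr0 2); apply: cvgM; [exact: cvg_cst|exact: cvg_harmonic].
- exact: iv.
- move=> n x; rewrite ger0_norm//.
  by rewrite ler_wpM2l//; exact: (chi_le _ _).1.
Qed.

(** [theta] is e^x k(x - N) with a fixed integrable profile k. After translation by n the integrand
    is v(y + n) e^(y + n) k(y), which tends to 0 pointwise and is dominated because v e^x is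
    bounded. *)
Lemma int_theta_cvg0 v : cbounded v -> sim_o v (fun x => expR (- x)) ->
  intR (fun x => v x * theta n%:R x) @[n --> \oo] --> (0 : R).
Proof.
move=> bv hv.
have [S hS] : exists S, forall x, `|v x * expR x| <= S.
  have [_ [M hM]] := bv; have [X hX] := sim_o_bound hv.
  exists (M * expR X + 1) => x; rewrite normrM [`|expR x|]ger0_norm ?expR_ge0//.
  have M0 : 0 <= M by exact: le_trans (hM 0).
  have [xX|xX] := leP x X.
    apply: (@le_trans _ _ (M * expR X)); last by rewrite lerDl.
    by apply: ler_pM; rewrite ?expR_ge0// ler_expR.
  apply: (@le_trans _ _ 1); last by rewrite lerDr mulr_ge0// expR_ge0.
  have := ler_wpM2r (expR_ge0 x) (hX x (ltW xX)).
  by rewrite !mul1r -expRD addNr expR0.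
have S0 : 0 <= S by exact: le_trans (hS 0).
pose k (y : R) := 6 * (expR (- y) * (logistic y * (1 - logistic y)) ^+ 2).
have k0 y : 0 <= k y.
  by apply: mulr_ge0 => //; apply: mulr_ge0; [exact: expR_ge0|exact: sqr_ge0].
have kd y : k y <= 6 * damp 1 y.
  rewrite /k ler_wpM2l//; apply: le_trans (logistic_sub_le y).
  have s0 := logistic_gt0 y; have s1 := one_sub_logistic_gt0 y.
  have -> : expR (- y) * (logistic y * (1 - logistic y)) ^+ 2 =
    (logistic y * (1 - logistic y)) * (1 - logistic y) ^+ 2.
    transitivity ((expR (- y) * logistic y) * (logistic y * (1 - logistic y) ^+ 2)); first by ring.
    by rewrite -one_sub_logistic; ring.
  rewrite ler_piMr ?mulr_ge0 ?ltW// expr2; nra.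
have thk (n : nat) x : theta n%:R x = expR x * k (x - n%:R).
  have e : expR x * expR (- (x - n%:R)) = expR n%:R by rewrite -expRD; congr expR; ring.
  by rewrite /theta /k /lgN -e; ring.
have E n : intR (fun x => v x * theta n%:R x) = intR (fun y => (v (y + n%:R) * expR (y +
  n%:R)) * k y).
  have sth := sqint_theta (n%:R : R).
  have l : cintegrable (fun x => theta n%:R x * v x).
    split; first exact: ctsM sth.1 bv.1.
    have bth := cbounded_theta (n%:R : R).
    apply: (itg_dom (g := fun x => S * (6 * damp 1 (x + - n%:R)))).
    - exact: cont_measurable (ctsM sth.1 bv.1).
    - move=> x; rewrite mulrC normrM.
      rewrite thk.
      rewrite normrM mulrA -normrM [`|k _|]ger0_norm//; apply: ler_pM => //; exact: kd.
    - apply: itgZ; apply: itgZ; exact: itg_shift (poisson_kernel 0 (@ltr01 R)).1.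
  rewrite (@eq_int _ _ (fun x => theta n%:R x * v x)); last by move=> x; rewrite mulrC.
  rewrite -(int_shift n%:R l.2); apply: eq_int => y.
  by rewrite thk addrK; ring.
rewrite (funext E) -(@int0 R).
apply: (int_dct (g := fun y => S * (6 * damp 1 y))).
- move=> n; apply: cont_measurable; apply: ctsM.
    apply: ctsM => x; (apply: continuous_comp; first by apply: cvgD;
      [exact: cvg_id|exact: cvg_cst]).
      exact: bv.1.
    exact: continuous_expR.
  apply: ctsM; first exact: cts_cst.
  apply: ctsM; last first.
    apply: ctsX; apply: dv_continuous;
      first exact: (dvM (@dv_logistic R) (dvB (@dv_cst R 1) (@dv_logistic R))).
  exact: dv_continuous (dv_comp (@dv_expR R) (dvN (@dv_id R))).
- exact: measurable_cst.
- apply: aeW => y; rewrite -(mul0r (k y)); apply: cvgM; last exact: cvg_cst.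
  have := sim_o_cvg hv => /cvgrPdist_le H; apply/cvgrPdist_le => e /H [X [_ HX]].
  near=> n; apply: HX => /=.
  rewrite -ltrBlDl; near: n; exact: nbhs_infty_gtr.
- apply: itgZ; apply: itgZ; exact: (poisson_kernel 0 (@ltr01 R)).1.
- by move=> n y; rewrite normrM [`|k _|]ger0_norm//; apply: ler_pM.
Unshelve. all: by end_near. Qed.

(* [e^-x (v + v')] is nonincreasing and tends to [0] at [+oo], so [e^x v] is
   nondecreasing; it tends to [0] at both ends. *)
Lemma sign_rigidity v v1 v2 : dv v v1 -> dv v1 v2 -> cbounded v -> cbounded v1 ->
  (forall x, v2 x <= v x) -> sim_o v (fun x => expR (- x)) -> forall x, v x = 0.
Proof.
move=> d1 d2 [_ [M hM]] [_ [M1 hM1]] vv hv.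
have M0 : 0 <= M by exact: le_trans (hM 0).
have M10 : 0 <= M1 by exact: le_trans (hM1 0).
have dE : dv (fun x : R => expR (- x)) (fun x => - expR (- x)).
  by apply: (dv_eq (dv_comp (@dv_expR R) (dvN (@dv_id R)))) => x; rewrite mulN1r.
pose A x := expR (- x) * (v x + v1 x).
have dA : dv A (fun x => expR (- x) * (v2 x - v x)).
  by apply: (dv_eq (dvM dE (dvD d1 d2))) => x /=; ring.
have A0 x : 0 <= A x.
  have L : A y @[y --> +oo] --> (0 : R).
    apply: (@cvg0_le _ _ _ _ _ (fun y => expR (- y) * (M + M1))).
      apply: nearW => y; rewrite normrM ger0_norm ?expR_ge0// ler_wpM2l ?expR_ge0//.
      by apply: (le_trans (ler_normD _ _)); exact: lerD.
    rewrite -(mul0r (M + M1)); apply: cvgM; [exact: cvgr_expR|exact: cvg_cst].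
  apply: (cvgr_to_le L); exists x; split => [|y xy]; first exact: num_real.
  have [c _ H] := dv_mvt dA xy.
  rewrite -subr_le0 H mulr_le0_ge0 ?subr_ge0 ?(ltW xy)//.
  by rewrite mulr_ge0_le0 ?expR_ge0// subr_le0.
pose B x := v x * expR x.
have dB : dv B (fun x => (expR x * expR x) * A x).
  apply: (dv_eq (dvM d1 (@dv_expR R))) => x /=.
  by rewrite /A mulrA -!expRD addrK; ring.
have Bmono x y : x < y -> B x <= B y.
  move=> xy; have [c _ H] := dv_mvt dB xy.
  rewrite -subr_ge0 H mulr_ge0 ?subr_ge0 ?(ltW xy)//.
  by rewrite mulr_ge0// mulr_ge0 ?expR_ge0.
move=> x; have Bx : B x = 0.
  apply/eqP; rewrite eq_le; apply/andP; split.
    apply: (cvgr_to_ge (sim_o_cvg hv)); exists x; split => [|y xy]; first exact: num_real.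
    exact: Bmono.
  have L : B (- y) @[y --> +oo] --> (0 : R).
    apply: (@cvg0_le _ _ _ _ _ (fun y => M * expR (- y))).
      by apply: nearW => y; rewrite normrM [`|expR _|]ger0_norm ?expR_ge0// ler_wpM2r ?expR_ge0.
    rewrite -(mulr0 M); apply: cvgM; [exact: cvg_cst|exact: cvgr_expR].
  apply: (cvgr_to_le L); exists (- x); split => [|y xy]; first exact: num_real.
  apply: Bmono; lra.
by move/eqP: Bx; rewrite mulf_eq0 (gt_eqF (expR_gt0 x)) orbF => /eqP.
Qed.

End Decay.

(** * Vanishing of the initial datum for k = 1 *)

Section Rigidity.
Variable R : realType.

Lemma lower_arith (a b d e z : R) : 3 / 2 * b - 48 * a <= z -> a <= e -> d <= b ->
  3 / 2 * d <= z + 48 * e.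
Proof. lra. Qed.

(** No integral in time is taken: if D(0) > 0, then D >= D(0) / 2 on some [0, eta] by continuity.
    Monotonicity on [0, eta] and on [eta, t1], where D >= 0 is enough, bounds
    [g n t1 - g n 0 + c n * t1] from below by a positive number independent of n, whereas it tends
    to 0. *)
Lemma flow1_rigidity (T0 t1 : R) (u u1 u2 f f1 : R -> R -> R) :
  flow 1 `[0, T0] u u1 u2 f f1 -> 0 < t1 <= T0 ->
  sim_o (u 0) (fun x => expR (- x)) -> sim_o (u t1) (fun x => expR (- x)) ->
  itg (fun x => (u 0 x ^+ 2 + u1 0 x ^+ 2) * expR x) ->
  forall x, u 0 x = 0.
Proof.
move=> fl /andP[t10 t1T] o0 o1 iexp.
have T00 : 0 <= T0 by lra.
pose I : set R := `[0, T0]%classic.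
have segI t : 0 <= t -> t <= T0 -> I t by move=> h1 h2; rewrite /I /mkset /= in_itv /= h1.
have I0 : I 0 by apply: segI.
have It1 : I t1 by apply: segI => //; exact: ltW.
have sub a b : 0 <= a -> b <= T0 -> `[a, b]%classic `<=` I.
  move=> a0 bT t; rewrite /mkset /= in_itv /= => /andP[h1 h2].
  by apply: segI; [exact: le_trans h1|exact: le_trans bT].
have su t : I t -> sqint (u t) by case/(fl_slice fl).
have su1 t : I t -> sqint (u1 t) by case/(fl_slice fl).
have sf t : I t -> sqint (f t) by case/(fl_slice fl).
have sf1 t : I t -> sqint (f1 t) by case/(fl_slice fl).
have bu t : I t -> cbounded (u t) by move=> /(fl_slice fl)/slice_cbounded[].
have [K K0 growth] := flow_growth (ltn0Sn 0) T00 fl.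
(* The fixed weight [phi 0] lies below every [phi n], so D gives a lower bound uniform in n. *)
pose D t := intR (fun x => u1 t x ^+ 2 * phi 0 x).
pose g n t := intR (fun x => u t x * theta n%:R x).
pose c (n : nat) := 48 * (K * intR (fun x => (u 0 x ^+ 2 + u1 0 x ^+ 2) * chi n%:R x)).
have lD N t : I t -> cintegrable (fun x => u1 t x ^+ 2 * phi N x).
  by move=> It; have s := su1 t It; have b := cbounded_phi N; solve_closure.
have D_ge0 t : 0 <= D t by apply: int_ge0 => x; rewrite mulr_ge0 ?sqr_ge0// ltW// phi_gt0.
have lower n t : I t -> 3 / 2 * D t <= intR (fun x => f t x * theta n%:R x) + c n.
  move=> It; have H1 := slice1_lower n%:R (fl_slice fl It).
  have H2 := growth _ _ (weight_chi n%:R) t It.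
  have H3 : D t <= intR (fun x => u1 t x ^+ 2 * phi n%:R x).
    apply: int_le; [exact: (lD 0 t It).2|exact: (lD _ t It).2|] => x.
    by rewrite ler_wpM2l ?sqr_ge0//; exact: phi_mono.
  exact: lower_arith H1 H2 H3.
have wdg n t : I t -> derive_within I (g n) t (intR (fun x => f t x * theta n%:R x)).
  by move=> It; have := derive_within_linear It su (sf t It) (fl_dt fl It) (sqint_theta n%:R);
    exact.
have wdaff (b t : R) : derive_within I (fun r => b * r) t b.
  by apply: is_derive_within; have := dvZ b (@dv_id R) t; rewrite mulr1.
have D0 : D 0 <= 0.
  rewrite leNgt; apply/negP => D0.
  have cD : D @ within I (nbhs 0) --> D 0.
    have := derive_within_quadratic I0 su1 (sf1 0 I0) (fl_dt1 fl I0) (cbounded_phi 0);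
      exact: derive_within_cvg.
  have [d d0 hd] : exists2 d : R, 0 < d & forall t, I t -> t < d -> D 0 / 2 <= D t.
    have D2 : D 0 / 2 < D 0 by lra.
    have : \forall t \near within I (nbhs 0), D 0 / 2 <= D t by exact: cvgr_ge cD _ D2.
    rewrite near_withinE => -[d /= d0 H]; exists d => // t It td.
    apply: H => //; rewrite /ball /= sub0r normrN ger0_norm//.
    by move: It; rewrite /I /mkset /= in_itv /= => /andP[].
  pose eta := Num.min t1 (d / 2).
  have eta0 : 0 < eta by rewrite lt_min t10 divr_gt0.
  have etat : eta <= t1 by rewrite ge_min lexx.
  have etad : eta < d.
    by apply: (@le_lt_trans _ _ (d / 2)); [rewrite ge_min lexx orbT|lra].
  (* 3/4 is the coefficient 3/2 times the half of D(0) that survives up to time eta. *)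
  have gap n : 3 / 4 * D 0 * eta <= g n t1 - g n 0 + c n * t1.
    have S1 : g n 0 + (c n - 3 / 4 * D 0) * 0 <= g n eta + (c n - 3 / 4 * D 0) * eta.
      apply: (@derive_within_mono _ 0 eta (fun t => g n t + (c n - 3 / 4 * D 0) * t)
        (fun t => intR (fun x => f t x * theta n%:R x) + (c n - 3 / 4 * D 0))); first exact: ltW.
      move=> t /andP[t0 te].
      have It : I t by apply: segI => //; lra.
      split; first by apply: derive_withinD; apply: (derive_within_sub (sub 0 eta _ _));
        [lra|lra|exact: wdg|lra|lra|exact: wdaff].
      move: (lower n t It) (hd t It (le_lt_trans te etad)); move: (D t) (intR _) => a b; lra.
    have S2 : g n eta + c n * eta <= g n t1 + c n * t1.
      apply: (@derive_within_mono _ eta t1 (fun t => g n t + c n * t)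
        (fun t => intR (fun x => f t x * theta n%:R x) + c n)) => //.
      move=> t /andP[t0 te].
      have It : I t by apply: segI; lra.
      split; first by apply: derive_withinD; apply: (derive_within_sub (sub eta t1 _ _));
        [lra|lra|exact: wdg|lra|lra|exact: wdaff].
      move: (lower n t It) (D_ge0 t); move: (D t) (intR _) => a b; lra.
    lra.
  have L : g n t1 - g n 0 + c n * t1 @[n --> \oo] --> (0 : R).
    have z : (0 : R) - 0 + 48 * (K * 0) * t1 = 0 by rewrite !mulr0 mul0r subrr addr0.
    rewrite -[X in _ --> X]z.
    apply: cvgD.
      by apply: cvgB; apply: int_theta_cvg0 => //; exact: bu.
    apply: cvgM; last exact: cvg_cst.
    apply: cvgM; first exact: cvg_cst.
    apply: cvgM; first exact: cvg_cst.
    by apply: int_chi_cvg0 => //; [exact: su|exact: su1].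
  have gap0 : 3 / 4 * D 0 * eta <= 0 by apply: (cvgr_to_ge L); exact: nearW.
  have : 0 < 3 / 4 * D 0 * eta by rewrite mulr_gt0// mulr_gt0.
  by rewrite ltNge gap0.
have u10 x : u1 0 x = 0.
  have P y : 0 <= u1 0 y ^+ 2 * phi 0 y by rewrite mulr_ge0 ?sqr_ge0// ltW// phi_gt0.
  have /eqP := int_eq0 (lD 0 0 I0).1 P (lD 0 0 I0).2 D0 x.
  by rewrite mulf_eq0 (gt_eqF (phi_gt0 _ _)) orbF sqrf_eq0 => /eqP.
have du := sl_du (fl_slice fl I0).
have cst x : u 0 x = u 0 0.
  have [x0|x0|->//] := ltgtP x 0.
    by have [z _] := dv_mvt du x0; rewrite u10 mul0r => /eqP; rewrite subr_eq0 => /eqP.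
  by have [z _] := dv_mvt du x0; rewrite u10 mul0r => /eqP; rewrite subr_eq0 => /eqP.
have [u00|u00] := eqVneq (u 0 0) 0; first by move=> x; rewrite cst.
have := (su 0 I0).2; rewrite (_ : (fun x => _) = fun=> u 0 0 ^+ 2); last first.
  by apply/funext => x; rewrite cst.
by move/itg_infty; rewrite expf_neq0// => /(_ isT).
Qed.

End Rigidity.

Theorem theorem2p6 (R : realType) (k : nat) (hk : (0 < k)%N)
  (s : R) (hs : 3 <= s) (T0 : R) (hT0 : 0 < T0)
  (u0 : R -> R) (u : R -> R -> R)
  (hu : C0_sobolev `[0, T0] s u)
  (hu_cont : forall t, 0 <= t <= T0 -> continuous (u t))
  (hsol : solves_equation k `[0, T0] s u)
  (hinit : forall x, u 0 x = u0 x)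
  (h1 : exists alpha : R, [/\ 1 / (k.+1)%:R < alpha < 1,
          sim_o u0 (fun x => expR (- x)) &
          sim_O (derive1 u0) (fun x => expR (- (alpha * x)))])
  (h2 : exists t1 : R, 0 < t1 <= T0 /\ sim_o (u t1) (fun x => expR (- x))) :
  let m0 := fun x => u0 x - derive1n 2 u0 x in
  let u_is_zero := forall t x, 0 <= t <= T0 -> u t x = 0 in
  [/\ k = 1%N -> u_is_zero,
      ~~ odd k -> (forall x, 0 <= m0 x) -> u_is_zero &
      odd k -> (forall x, 0 <= m0 x) \/ (forall x, m0 x <= 0) -> u_is_zero].
Proof.
move=> m0 u_is_zero.
have segI t : (`[0, T0]%classic t : Prop) = (0 <= t <= T0) :> Prop by rewrite /mkset /= in_itv.
have hc t : `[0, T0]%classic t -> continuous (u t) by rewrite segI; exact: hu_cont.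
have [u1 [u2 [f [f1 fl]]]] := flow_exists hs hu hc hsol.
have I0 : `[0, T0]%classic 0 by rewrite segI lexx ltW.
have sl := fl_slice fl I0.
have uz : (forall x, u 0 x = 0) -> u_is_zero.
  by move=> z t x tT; apply: (flow_unique hk (ltW hT0) fl z); rewrite segI.
have e0 : u 0 = u0 by apply/funext.
have e1 : derive1 u0 = u1 0 by rewrite -e0; exact: dv_derive1 (sl_du sl).
have e2 : derive1n 2 u0 = u2 0 by rewrite /= e1; exact: dv_derive1 (sl_du1 sl).
have [alpha [/andP[al _] o0 O1]] := h1.
rewrite -e0 in o0.
have [bu bu1] := slice_cbounded sl.
have pos : (forall x, 0 <= m0 x) -> u_is_zero.
  move=> m; apply: uz; apply: sign_rigidity (sl_du sl) (sl_du1 sl) bu bu1 _ o0 => x.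
  by have := m x; rewrite /m0 e2 e0 subr_ge0.
(* [sign_rigidity] concerns the datum alone, so it applies to - u_0 for every k. *)
have neg : (forall x, m0 x <= 0) -> u_is_zero.
  move=> m; apply: uz => x; apply/eqP; rewrite -oppr_eq0; apply/eqP.
  apply: (sign_rigidity (dvN (sl_du sl)) (dvN (sl_du1 sl)) (cboundedN bu) (cboundedN bu1)) => [y|].
    by have := m y; rewrite /m0 e2 e0 lerN2 subr_le0.
  by apply: cvg_ext o0 => y; rewrite normrN.
split => [k1|_ //|_ [|]//].
apply: uz; have [t1 [t1T o1]] := h2.
move: fl al; rewrite k1 => fl al.
apply: (flow1_rigidity fl t1T o0 o1).
have [X hX] := sim_o_bound o0; have [C [Y hY]] := sim_O_bound O1.
have a1 : 1 < 2 * (1 : R) by rewrite mulr1 ltr1n.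
(* For k = 1 the bound alpha > 1 / (k + 1) says 2 alpha > 1, which makes u_x^2 e^x integrable at
   time 0. *)
have a2 : 1 < 2 * alpha by move: al; lra.
rewrite e1 in hY.
have := itgD (itg_exp_weight (sl_u sl) a1 hX) (itg_exp_weight (sl_u1 sl) a2 hY).
by apply: eq_itg => x; ring.
Qed.
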